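(* Let $\mathfrak{g}$ be a finite-dimensional complex Lie algebra with nilpotent radical $\mathfrak{n}$, let $B$ be a complex Banach algebra with norm $\|\cdot\|$, let $|\cdot|$ be a norm on $\mathfrak{n}$, and let $\theta\colon U(\mathfrak{g})\to B$ be a homomorphism of associative algebras with dense range. Let $U(\mathfrak{n})_0$ denote the augmentation ideal of $U(\mathfrak{n})$, i.e. the kernel of the homomorphism $U(\mathfrak{n})\to\mathbb{C}$ induced by the trivial representation. Then the following conditions are equivalent. (1) $B$ is a PI-algebra. (2a) $\theta(\eta)$ is nilpotent for every $\eta\in\mathfrak{n}$. (2b) The non-unital associative algebra $\theta(U(\mathfrak{n})_0)$ is nilpotent. (3a) $e^{\theta(\eta)}-1$ is nilpotent for every $\eta\in\mathfrak{n}$. (3b) There is $d\in\mathbb{N}$ such that $e^{\theta(\eta)}-1$ is nilpotent of degree at most $d$ for every $\eta\in\mathfrak{n}$. (4) There are $C>0$ and $\alpha>0$ such that $\|e^{\theta(\eta)}\|\le C(1+|\eta|)^\alpha$ for every $\eta\in\mathfrak{n}$.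
   Context: $U(\mathfrak{g})$ is the universal enveloping algebra, and $\mathfrak{n}\subset\mathfrak{g}\subset U(\mathfrak{g})$. An associative algebra $A$ (not necessarily unital) is a PI-algebra if there is a nonzero non-commutative polynomial $p$ in finitely many variables such that $p(a_1,\ldots,a_n)=0$ for all $a_1,\ldots,a_n\in A$. The nilpotent radical of a Lie algebra $\mathfrak{g}$ is the intersection of the kernels of all irreducible representations of $\mathfrak{g}$. A non-unital associative algebra $A_0$ is nilpotent if $A_0^d=0$ for some $d\in\mathbb{N}$. $e^x=\sum_{n\ge0}x^n/n!$ is the exponential in $B$ (or in its unitization). *)

(* Defs.v *)
From HB Require Import structures.
From mathcomp Require Import all_boot all_order all_algebra.
From mathcomp Require Import all_classical all_reals all_analysis.
From mathcomp Require Import complex.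
Set Implicit Arguments. Unset Strict Implicit. Unset Printing Implicit Defensive.
Import Order.TTheory GRing.Theory Num.Theory.
Import numFieldNormedType.Exports.
Local Open Scope ring_scope.
Local Open Scope complex_scope.
Local Open Scope classical_set_scope.

Definition lie_bracket (K : fieldType) (g : lmodType K) (br : g -> g -> g) :=
  [/\ forall (a : K) x y z, br (a *: x + y) z = a *: br x z + br y z,
      forall (a : K) x y z, br z (a *: x + y) = a *: br z x + br z y,
      forall x, br x x = 0 &
      forall x y z, br x (br y z) + br y (br z x) + br z (br x y) = 0].

Definition lie_rep (K : fieldType) (g : lmodType K) (br : g -> g -> g)
    (m : nat) (rho : g -> 'M[K]_m) :=
  (forall (a : K) x y, rho (a *: x + y) = a *: rho x + rho y) /\
  (forall x y, rho (br x y) = rho x *m rho y - rho y *m rho x).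

(** Irreducibility: the module K^m is nonzero and its only invariant subspaces
    are 0 and K^m.  A subspace of column vectors is encoded by the row space
    of a matrix [W] whose rows are the transposed vectors; invariance of the
    subspace under [rho x] (acting on columns on the left) is then
    [W *m (rho x)^T <= W]. *)
Definition lie_rep_irreducible (K : fieldType) (g : lmodType K)
    (m : nat) (rho : g -> 'M[K]_m) :=
  (0 < m)%N /\
  forall W : 'M[K]_m,
    (forall x, (W *m (rho x)^T <= W)%MS) -> \rank W = 0%N \/ \rank W = m.

Definition nil_radical (K : fieldType) (g : lmodType K) (br : g -> g -> g)
    (x : g) : Prop :=
  forall (m : nat) (rho : g -> 'M[K]_m),
    lie_rep br rho -> lie_rep_irreducible rho -> rho x = 0.

Definition norm_on (R : realType) (g : lmodType R[i]) (n : g -> Prop)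
    (nrm : g -> R) :=
  [/\ forall x, n x -> 0 <= nrm x,
      forall x, n x -> nrm x = 0 -> x = 0,
      forall (a : R[i]) x, n x -> (nrm (a *: x))%:C = `|a| * (nrm x)%:C &
      forall x y, n x -> n y -> nrm (x + y) <= nrm x + nrm y].

Definition banach_algebra (R : realType) (B : completeNormedModType R[i])
    (mul : B -> B -> B) (one : B) :=
  [/\ associative mul /\ left_id one mul /\ right_id one mul,
      forall (a : R[i]) x y z, mul (a *: x + y) z = a *: mul x z + mul y z,
      forall (a : R[i]) x y z, mul z (a *: x + y) = a *: mul z x + mul z y &
      forall x y, `|mul x y| <= `|x| * `|y| ].

Section BanachOps.
Context (R : realType) (B : completeNormedModType R[i])
        (mul : B -> B -> B) (one : B).

Definition bpow (x : B) (k : nat) : B := iter k (mul x) one.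

Definition bexp (x : B) : B :=
  limn (series (fun k : nat => (k`!%:R : R[i])^-1 *: bpow x k)).

Definition bnilpotent (x : B) : Prop := exists k : nat, bpow x k = 0.

Inductive ualg_gen (S : set B) : B -> Prop :=
  | ug_in x : S x -> ualg_gen S x
  | ug_one : ualg_gen S one
  | ug_add x y : ualg_gen S x -> ualg_gen S y -> ualg_gen S (x + y)
  | ug_scale (a : R[i]) x : ualg_gen S x -> ualg_gen S (a *: x)
  | ug_mul x y : ualg_gen S x -> ualg_gen S y -> ualg_gen S (mul x y).

Inductive nalg_gen (S : set B) : B -> Prop :=
  | ng_in x : S x -> nalg_gen S x
  | ng_zero : nalg_gen S 0
  | ng_add x y : nalg_gen S x -> nalg_gen S y -> nalg_gen S (x + y)
  | ng_scale (a : R[i]) x : nalg_gen S x -> nalg_gen S (a *: x)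
  | ng_mul x y : nalg_gen S x -> nalg_gen S y -> nalg_gen S (mul x y).

Definition nilpotent_subalg (A0 : B -> Prop) : Prop :=
  exists d : nat, forall a : 'I_d -> B,
    (forall i, A0 (a i)) -> \big[mul/one]_(i < d) a i = 0.

Definition eval_word (k : nat) (a : 'I_k -> B) (w : seq 'I_k) : B :=
  foldr (fun i acc => mul (a i) acc) one w.

(** PI-algebra: some nonzero noncommutative polynomial p in finitely many
    variables vanishes identically on B.  A polynomial is given by a
    duplicate-free list S of words and coefficients c; it is nonzero iff some
    word of S has nonzero coefficient. *)
Definition PI_algebra : Prop :=
  exists (k : nat) (S : seq (seq 'I_k)) (c : seq 'I_k -> R[i]),
    [/\ uniq S, (exists2 w, w \in S & c w != 0) &
        forall a : 'I_k -> B, \sum_(w <- S) c w *: eval_word a w = 0].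

End BanachOps.

(** Lie algebra homomorphism from (g, br) into B with the commutator bracket;
    by the universal property of U(g) these are exactly the restrictions to g
    of (unital) algebra homomorphisms U(g) -> B. *)
Definition lie_hom_to (R : realType) (g : lmodType R[i]) (br : g -> g -> g)
    (B : completeNormedModType R[i]) (mul : B -> B -> B) (phi : g -> B) :=
  (forall (a : R[i]) x y, phi (a *: x + y) = a *: phi x + phi y) /\
  (forall x y, phi (br x y) = mul (phi x) (phi y) - mul (phi y) (phi x)).

(* Main.v *)
(** (2a) => (2b) is Engel's theorem for the Lie algebra theta(n).

    (2b) => (3b) and (4): the exponential series of theta(eta) is a finite sum.

    (3a) => (2a): n is a linear space, so eta can be rescaled to make x = theta(eta)
    small; then e^x - 1 = x (1 + w) with |w| < 1, and its nilpotency passes to x.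

    (4) => (2a): z |-> e^(z x) is an entire function of polynomial growth, hence a
    polynomial by Cauchy's estimates.

    (1) => (2a): let A = theta(U(g)), an algebra of countable dimension over the
    uncountable field C.  Schur's lemma and Jacobson's density theorem show that every
    simple A-module is finite dimensional, hence an irreducible representation of g
    killed by n.  So theta(eta) lies in every maximal left ideal of A; thus
    theta(eta) - c is left invertible for every c <> 0, theta(eta) is algebraic by
    uncountability, and therefore nilpotent.

    (2b) => (1): let L be the ideal of g spanned by the generalized eigenvectors of the
    operators ad x for nonzero eigenvalues.  The orthogonal q of L for the trace form of
    finitely many irreducible representations with joint kernel n satisfies g = L + q
    and [q, g] <= n.  In a Banach algebra theta maps the spanning vectors of L to
    nilpotent elements, so theta(U(L)) is finite dimensional by the
    Poincare-Birkhoff-Witt reordering, while theta(q) is central modulo the nilpotent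
    ideal A theta(n) A.  Hence A satisfies a power of a standard identity, and so does B
    by density. *)

Require Import Defs.
From HB Require Import structures.
From mathcomp Require Import all_boot all_order all_algebra.
From mathcomp Require Import perm cyclic separable cyclotomic.
From mathcomp Require Import all_classical all_reals all_analysis.
From mathcomp Require Import complex ring lra zify.
Set Implicit Arguments. Unset Strict Implicit. Unset Printing Implicit Defensive.
Import Order.TTheory GRing.Theory Num.Theory.
Import numFieldNormedType.Exports.
Local Open Scope ring_scope.

(** * Linear spans and Engel's theorem *)

(** The step (2b) => (1) cannot be purely algebraic: for semisimple g != 0 the radical is 0, yet
    U(g) satisfies no polynomial identity. The norm enters through [geig_nilpotent]: if [h, y] = nu
    y, then [h, y^k] = k nu y^k, and once |k nu| > 2 |h| this forces y^k = 0. That is why L is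
    spanned by eigenvectors for nonzero eigenvalues; L and q take the place of a Levi decomposition.
    Centrality of q modulo n rests on a form of Cartan's criterion in which each eigenvalue is
    paired with its complex conjugate: the decisive trace is a sum of squared moduli, so its
    vanishing alone makes the matrix nilpotent. In (1) => (2a) the simple module is finite
    dimensional for a concrete reason: more independent vectors than the length of a word w0 of the
    identity would, by density, allow elements that move the last vector to the first along w0 and
    along no other word. Neither U(g) nor a quotient module is built: the algebra is the span of
    words in the letters [phi x], and modules are congruences modulo a left ideal. *)

Section Subspaces.
Context (K : fieldType).

Definition is_subspace (V : lmodType K) (P : V -> Prop) :=
  P 0 /\ forall a u v, P u -> P v -> P (a *: u + v).

Section Basics.
Context (V : lmodType K) (P : V -> Prop) (HP : is_subspace P).

Lemma subspace0 : P 0. Proof. by case: HP. Qed.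

Lemma subspaceD u v : P u -> P v -> P (u + v).
Proof. by move=> Pu Pv; rewrite -[u]scale1r; case: HP => _; apply. Qed.

Lemma subspaceZ a u : P u -> P (a *: u).
Proof. by move=> Pu; rewrite -[_ *: _]addr0; case: HP => P0; apply. Qed.

Lemma subspaceN u : P u -> P (- u).
Proof. by rewrite -scaleN1r; apply: subspaceZ. Qed.

Lemma subspaceB u v : P u -> P v -> P (u - v).
Proof. by move=> Pu /subspaceN; apply: subspaceD. Qed.

Lemma subspace_sum (I : Type) (s : seq I) (Q : pred I) (F : I -> V) :
  (forall i, Q i -> P (F i)) -> P (\sum_(i <- s | Q i) F i).
Proof. by move=> PF; apply: big_ind => //; [exact: subspace0|exact: subspaceD]. Qed.

End Basics.

Inductive lspan (V : lmodType K) (Q : V -> Prop) : V -> Prop :=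
  | lspan0 : lspan Q 0
  | lspan_cons a u v : Q u -> lspan Q v -> lspan Q (a *: u + v).

Lemma lspan_in (V : lmodType K) (Q : V -> Prop) u : Q u -> lspan Q u.
Proof. by move=> Qu; rewrite -[u]addr0 -[u]scale1r; apply: lspan_cons (lspan0 _). Qed.

Lemma lspan_sub (V : lmodType K) (Q P : V -> Prop) :
  is_subspace P -> (forall u, Q u -> P u) -> forall u, lspan Q u -> P u.
Proof.
move=> HP QP u; elim=> [|a v w Qv _ Pw]; first exact: subspace0.
by apply: (subspaceD HP) Pw; apply: (subspaceZ HP); apply: QP.
Qed.

Lemma lspan_subspace (V : lmodType K) (Q : V -> Prop) : is_subspace (lspan Q).
Proof.
split=> [|a u v Hu Hv]; first exact: lspan0.
elim: Hu => [|b x y Qx _ IH]; first by rewrite scaler0 add0r.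
by rewrite scalerDr scalerA -addrA; apply: lspan_cons.
Qed.

Lemma lspan_eq0 (V : lmodType K) (Q : V -> Prop) u :
  lspan Q u -> (forall u, Q u -> u = 0) -> u = 0.
Proof.
move=> Qu Q0; apply: (lspan_sub (P := fun v => v = 0)) Qu => //.
by split=> // a x y -> ->; rewrite scaler0 addr0.
Qed.

Lemma lspan_mono (V : lmodType K) (Q P : V -> Prop) u :
  (forall u, Q u -> P u) -> lspan Q u -> lspan P u.
Proof.
by move=> QP; apply: lspan_sub (lspan_subspace _) _ u => v /QP; apply: lspan_in.
Qed.

Definition linmap (V W : lmodType K) (f : V -> W) :=
  forall a x y, f (a *: x + y) = a *: f x + f y.

Section Linmap.
Context (V W : lmodType K) (f : V -> W) (Hf : linmap f).

Lemma linmap0 : f 0 = 0.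
Proof.
by have := Hf 1 0 0; rewrite !scale1r addr0 -{1}[f 0]addr0 => /addrI <-.
Qed.

Lemma linmapD x y : f (x + y) = f x + f y.
Proof. by rewrite -{1}[x]scale1r Hf scale1r. Qed.

Lemma linmapZ a x : f (a *: x) = a *: f x.
Proof. by rewrite -[_ *: _]addr0 Hf linmap0 addr0. Qed.

Lemma linmapN x : f (- x) = - f x.
Proof. by rewrite -!scaleN1r linmapZ. Qed.

Lemma linmapB x y : f (x - y) = f x - f y.
Proof. by rewrite linmapD linmapN. Qed.

Lemma linmap_sum (I : Type) (s : seq I) (Q : pred I) (F : I -> V) :
  f (\sum_(i <- s | Q i) F i) = \sum_(i <- s | Q i) f (F i).
Proof.
by elim/big_rec2: _ => [|i y z _ <-]; [exact: linmap0|exact: linmapD].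
Qed.

Lemma subspace_preim (P : W -> Prop) : is_subspace P -> is_subspace (P \o f).
Proof.
move=> HP; split=> [|a u v Pu Pv] /=; first by rewrite linmap0; apply: subspace0.
by rewrite Hf; case: HP => _; apply.
Qed.

Lemma subspace_ker : is_subspace (fun x => f x = 0).
Proof.
by split=> [|a u v fu fv]; [exact: linmap0|rewrite Hf fu fv scaler0 addr0].
Qed.

Lemma lspan_map (Q : V -> Prop) (P : W -> Prop) :
  (forall u, Q u -> lspan P (f u)) -> forall u, lspan Q u -> lspan P (f u).
Proof. by move=> QP; apply: lspan_sub => //; apply/subspace_preim/lspan_subspace. Qed.

End Linmap.

Lemma subspaceI (V : lmodType K) (P Q : V -> Prop) :
  is_subspace P -> is_subspace Q -> is_subspace (fun x => P x /\ Q x).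
Proof.
move=> [P0 PD] [Q0 QD]; split=> // a u v [Pu Qu] [Pv Qv].
by split; [apply: PD|apply: QD].
Qed.

(** Subspaces are predicates throughout; this yields a [{vspace V}] when a dimension or a basis is
    wanted. A contained space of maximal dimension is everything, since another line could otherwise
    be added. *)
Lemma subspace_vspace (V : vectType K) (P : V -> Prop) :
  is_subspace P -> exists U : {vspace V}, forall x, x \in U <-> P x.
Proof.
move=> HP.
pose good n := `[< exists U : {vspace V}, \dim U = n /\ forall x, x \in U -> P x >].
have good0 : exists n, good n.
  exists 0%N; apply/asboolP; exists 0%VS; split; first exact: dimv0.
  by move=> x; rewrite memv0 => /eqP->; apply: subspace0.
have goodle n : good n -> (n <= \dim {:V})%N.
  by move=> /asboolP [U [<- _]]; apply: dimvS; apply: subvf.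
case: (ex_maxnP good0 goodle) => n /asboolP [U [dimU UP]] maxn.
exists U => x; split=> [/UP //|Px]; apply/negPn/negP => xU.
have sUx y : y \in (U + <[x]>)%VS -> P y.
  move=> /memv_addP [u uU [v /vlineP [k ->]] ->].
  by apply: (subspaceD HP); [exact: UP|exact: subspaceZ].
have /maxn : good (\dim (U + <[x]>)%VS) by apply/asboolP; exists (U + <[x]>)%VS.
rewrite -dimU leqNgt => /negP[]; rewrite ltn_neqAle dimvS ?addvSl // andbT.
apply/negP => /eqP eqd.
have /eqP eqU : U == (U + <[x]>)%VS by rewrite eqEdim addvSl eqd leqnn.
by move: xU; rewrite eqU memvE addvSr.
Qed.

End Subspaces.

(** * Nilpotency of products of letters *)

Section Words.
Context (K : fieldType) (A : algType K).

Definition wordnil (P : A -> Prop) (d : nat) :=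
  forall s : seq A, size s = d -> (forall x, x \in s -> P x) -> \prod_(x <- s) x = 0.

Lemma wordnil_le (P : A -> Prop) d e : (d <= e)%N -> wordnil P d -> wordnil P e.
Proof.
move=> de Pd s ss sP; rewrite -(cat_take_drop d s) big_cat /=.
rewrite (Pd (take d s)) ?mul0r ?size_takel ?ss // => x xs.
exact: sP (mem_take xs).
Qed.

Definition is_word (P : A -> Prop) (r : nat) (w : A) :=
  exists s : seq A, [/\ size s = r, forall x, x \in s -> P x & w = \prod_(x <- s) x].

Lemma is_word0 (P : A -> Prop) : is_word P 0 1.
Proof. by exists [::]; rewrite big_nil. Qed.

Lemma is_word_cat (P : A -> Prop) r r' w w' :
  is_word P r w -> is_word P r' w' -> is_word P (r + r') (w * w').
Proof.
move=> [s [<- sP ->]] [t [<- tP ->]]; exists (s ++ t).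
rewrite size_cat big_cat; split=> // x; rewrite mem_cat => /orP[/sP|/tP] //.
Qed.

Lemma is_word1 (P : A -> Prop) p : P p -> is_word P 1 p.
Proof. by move=> Pp; exists [:: p]; rewrite big_seq1; split=> // x; rewrite inE => /eqP->. Qed.

Lemma linmap_mulr (a : A) : linmap (fun x : A => x * a).
Proof. by move=> k x y; rewrite mulrDl scalerAl. Qed.

Lemma linmap_mull (a : A) : linmap (fun x : A => a * x).
Proof. by move=> k x y; rewrite mulrDr scalerAr. Qed.

Lemma lspan_mul (P Q : A -> Prop) (T : A -> Prop) :
  (forall x y, P x -> Q y -> lspan T (x * y)) ->
  forall x y, lspan P x -> lspan Q y -> lspan T (x * y).
Proof.
move=> PQ x y Px; elim: Px y => [|a u v Pu _ IH] y Qy.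
  by rewrite mul0r; apply: lspan0.
rewrite mulrDl -scalerAl; apply: (subspaceD (lspan_subspace _)); last exact: IH.
apply: (subspaceZ (lspan_subspace _)).
by apply: (lspan_map (linmap_mull u)) Qy => z; apply: PQ.
Qed.

(** Commutation with [x] is a derivation: it replaces one letter at a time by its commutator with
    [x], again in [P], so the length is kept. *)
Lemma word_mul_comm (P : A -> Prop) (x : A) :
  (forall p, P p -> P (p * x - x * p)) ->
  forall r w, is_word P r w -> lspan (is_word P r) (w * x - x * w).
Proof.
move=> Hx r w [s [<- sP ->]] {r w}; elim: s sP => [|p s IH] sP.
  by rewrite big_nil mulr1 mul1r subrr; apply: lspan0.
have Pp : P p by apply: sP; rewrite inE eqxx.
have sP' y : y \in s -> P y by move=> ys; apply: sP; rewrite inE ys orbT.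
rewrite big_cons; set w := \prod_(_ <- s) _.
have -> : p * w * x - x * (p * w) = p * (w * x - x * w) + (p * x - x * p) * w.
  by rewrite mulrBr mulrBl !mulrA addrA subrK.
apply: (subspaceD (lspan_subspace _)).
  apply: (lspan_mul (P := is_word P 1) (Q := is_word P (size s))).
  - by move=> a b Ha Hb; apply: lspan_in; apply: (is_word_cat Ha Hb).
  - by apply/lspan_in/is_word1.
  - exact: IH.
apply: lspan_in; apply: (is_word_cat (r := 1)); first exact/is_word1/Hx.
by exists s.
Qed.

(* A letter [p + c x] either adds a factor in [P], after which the powers of [x]
   can be commuted to the left without changing the number of factors in [P], or
   extends the current run of [x], which vanishes at length [k]. *)
Lemma wordnil_ext (P : A -> Prop) (x : A) N k :
  (forall p, P p -> P (p * x - x * p)) -> x ^+ k = 0 -> wordnil P N ->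
  wordnil (fun y => exists p c, P p /\ y = p + c *: x) (N.+1 * k).
Proof.
move=> Hx xk PN.
pose I r := lspan (fun y => exists a w, is_word P r w /\ y = x ^+ a * w).
have I0 r u : I r u -> (N <= r)%N -> u = 0.
  move=> Iu Nr; apply: (lspan_eq0 Iu) => {Iu}u [a [w [[t [st tP ->]] ->]]].
  by rewrite (wordnil_le Nr PN) ?mulr0.
have Ix r u : I r u -> I r (u * x).
  apply: (lspan_map (linmap_mulr x)).
  move=> _ [a [w [Pw ->]]]; rewrite -mulrA -[w * x](subrK (x * w)) mulrDr.
  apply: (subspaceD (lspan_subspace _)).
    apply: (lspan_map (linmap_mull _)) (word_mul_comm Hx Pw) => v Pv.
    by apply: lspan_in; exists a, v.
  by apply: lspan_in; exists a.+1, w; split=> //; rewrite exprSr mulrA.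
have IxX r b u : I r u -> I r (u * x ^+ b).
  by elim: b => [|b IH] Iu; rewrite ?mulr1 // exprSr mulrA; apply/Ix/IH.
have Ip r u p : P p -> I r u -> I r.+1 (u * p).
  move=> Pp; apply: (lspan_map (linmap_mulr p)).
  move=> _ [a [w [Pw ->]]]; apply: lspan_in; exists a, (w * p).
  split; last by rewrite mulrA.
  by rewrite -addn1; apply: is_word_cat => //; apply: is_word1.
(* Here [r] counts the letters of [P] read so far and [b] the current run of [x]. A letter of [P]
   ends a run shorter than [k], and the weight [k] of the new unit of [r] makes up for the lost
   run. *)
pose T n y := exists r b u, [/\ I r u, (n <= r * k + b)%N & y = u * x ^+ b].
have Tmul n y p c : lspan (T n) y -> P p -> lspan (T n.+1) (y * (p + c *: x)).
  move=> Ty Pp; apply: (lspan_map (linmap_mulr (p + c *: x))) Ty => _ [r [b [u [Iu nb ->]]]].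
  rewrite mulrDr; apply: (subspaceD (lspan_subspace _)).
    case: (leqP k b) => kb.
      by rewrite -(subnK kb) exprD xk !mulr0 mul0r; apply: lspan0.
    apply: lspan_in; exists r.+1, 0%N, (u * x ^+ b * p); split; last by rewrite mulr1.
    - by apply/Ip/IxX.
    - by rewrite mulSn addn0 addnC (leq_ltn_trans nb) // ltn_add2l.
  rewrite -scalerAr; apply/(subspaceZ (lspan_subspace _))/lspan_in.
  by exists r, b.+1, u; split=> //; rewrite ?addnS // exprSr mulrA.
have Tprod n : forall s, size s = n ->
    (forall y, y \in s -> exists p c, P p /\ y = p + c *: x) -> lspan (T n) (\prod_(y <- s) y).
  elim: n => [|n IH] s.
    move=> /size0nil -> _; rewrite big_nil; apply: lspan_in.
    exists 0%N, 0%N, 1; split; rewrite ?mulr1 //; apply: lspan_in.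
    by exists 0%N, 1; rewrite mulr1; split=> //; apply: is_word0.
  case/lastP: s => // s y; rewrite size_rcons => -[ss] sP.
  rewrite big_rcons /=; have [|p [c [Pp ->]]] := sP y.
    by rewrite mem_rcons inE eqxx.
  by apply: Tmul => //; apply: IH => // z zs; apply: sP; rewrite mem_rcons inE zs orbT.
move=> s ss sP; apply: (lspan_eq0 (Tprod _ s ss sP)) => _ [r [b [u [Iu nb ->]]]].
case: (leqP N r) => [|rN]; first by move=> /(I0 _ _ Iu) ->; rewrite mul0r.
have kb : (k <= b)%N.
  rewrite -(leq_add2l (r * k)); apply: leq_trans nb.
  by rewrite addnC -mulSn leq_mul2r ltnW ?orbT // ltnS.
by rewrite -(subnK kb) exprD xk !mulr0.
Qed.

End Words.

Section LieEngel.
Context (K : fieldType) (A : algType K) (g : vectType K) (br : g -> g -> g).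
Context (phi : g -> A).
Hypothesis br_linl : forall z, linmap (br^~ z).
Hypothesis br_linr : forall z, linmap (br z).
Hypothesis br_anti : forall x y, br x y = - br y x.
Hypothesis phi_lin : linmap phi.
Hypothesis phi_br : forall x y, phi (br x y) = phi x * phi y - phi y * phi x.

Definition img (P : g -> Prop) (y : A) := exists x, P x /\ y = phi x.

Definition adw (l : seq g) (y : g) := foldr br y l.

(** Expanding the nested commutators gives products [w * phi y * w'] whose outer words have [size l]
    letters together; with [N.*2] letters one of them has at least [N]. *)
Lemma phi_adw_nil (M : g -> Prop) N (l : seq g) (y : g) :
  wordnil (img M) N -> (forall x, x \in l -> M x) -> (N.*2 <= size l)%N ->
  phi (adw l y) = 0.
Proof.
move=> MN lM sl.
pose T n z := exists a b, [/\ is_word (img M) a.1 a.2, is_word (img M) b.1 b.2,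
   (a.1 + b.1 = n)%N & z = a.2 * phi y * b.2].
have HT l' : (forall x, x \in l' -> M x) -> lspan (T (size l')) (phi (adw l' y)).
  elim: l' => [|x l' IH] l'M.
    apply: lspan_in; exists (0%N, 1), (0%N, 1); rewrite /= mul1r mulr1; split=> //;
    exact: is_word0.
  have Mx : M x by apply: l'M; rewrite inE eqxx.
  have /IH {}IH : forall x, x \in l' -> M x by move=> z zl; apply: l'M; rewrite inE zl orbT.
  have wx : is_word (img M) 1 (phi x) by apply: is_word1; exists x.
  rewrite /= phi_br; apply: (subspaceB (lspan_subspace _)).
    apply: (lspan_map (linmap_mull _)) IH => _ [a [b [Ha Hb <- ->]]]; apply: lspan_in.
    exists ((1 + a.1)%N, phi x * a.2), b; split=> //=; last by rewrite !mulrA.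
    exact: is_word_cat.
  apply: (lspan_map (linmap_mulr _)) IH => _ [a [b [Ha Hb <- ->]]]; apply: lspan_in.
  exists a, ((b.1 + 1)%N, b.2 * phi x); split=> //=; last by rewrite !mulrA.
    exact: is_word_cat.
  by rewrite addn1 addnS.
apply: (lspan_eq0 (HT l lM)) => _ [a [b [[s [ss sM ea]] [t [st tM eb]] ab ->]]].
case: (leqP N a.1) => Na; first by rewrite ea (wordnil_le Na MN) // !mul0r.
have Nb : (N <= b.1)%N.
  rewrite leqNgt; apply/negP => bN; have := sl; rewrite -ab -addnn leqNgt => /negP[].
  by apply: leq_trans (leq_add Na bN); rewrite addSn ltnS addnS.
by rewrite eb (wordnil_le Nb MN) // !mulr0.
Qed.

(* A maximal subalgebra [U] of [a] containing the kernel of [phi] and having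
   vanishing long words is all of [a]: applying [ad U] to an element outside [U]
   as often as possible without entering [U] gives [t] normalizing [U]. *)
Lemma engel (a : g -> Prop) :
  is_subspace a -> (forall x y, a x -> a y -> a (br x y)) ->
  (forall x, a x -> exists k, phi x ^+ k = 0) ->
  exists d, wordnil (img a) d.
Proof.
move=> sa abr anil.
pose good (U : {vspace g}) := [/\ forall x, x \in U -> a x,
   forall x, a x -> phi x = 0 -> x \in U,
   forall x y, x \in U -> y \in U -> br x y \in U &
   exists d, wordnil (img (fun x => x \in U)) d].
pose goodn n := `[< exists U, good U /\ \dim U = n >].
have good0 : exists n, goodn n.
  (* The start is the kernel of [phi] in [a]: its image is 0, so words of length 1 vanish. Keeping
     this kernel inside [U] allows membership in [U] to be deduced from the vanishing of [phi]. *)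
  have [U HU] := subspace_vspace (subspaceI sa (subspace_ker phi_lin)).
  exists (\dim U); apply/asboolP; exists U; split=> //; split.
  - by move=> x /HU[].
  - by move=> x ax px; apply/HU.
  - move=> x y /HU[ax px] /HU[ay py]; apply/HU; split; first exact: abr.
    by rewrite phi_br px py !mulr0 subrr.
  - exists 1%N => -[//|z [|//]] _ sP; rewrite big_seq1.
    by have [|x [/HU[_ ->] ->]] := sP z; rewrite ?inE.
have goodle n : goodn n -> (n <= \dim {:g})%N.
  by move=> /asboolP [U [_ <-]]; apply/dimvS/subvf.
case: (ex_maxnP good0 goodle) => n /asboolP [U [[Ua Uker Ubr [d Ud]] dimU]] maxn.
suff aU x : a x -> x \in U.
  exists d => s ss sP; apply: Ud => // z /sP [x [ax ->]]; exists x; split=> //.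
  exact: aU.
move=> ax; apply/negPn/negP => xU.
pose out m := `[< exists l y, [/\ size l = m, forall z, z \in l -> z \in U & a y /\ y \notin U] /\ adw l y \notin U >].
have adwa l y : (forall z, z \in l -> z \in U) -> a y -> a (adw l y).
  elim: l => //= z l IH lU ay; apply: abr; first by apply/Ua/lU; rewrite inE eqxx.
  by apply: IH => // t tl; apply: lU; rewrite inE tl orbT.
have out0 : exists m, out m by exists 0%N; apply/asboolP; exists [::], x.
have outle m : out m -> (m <= d.*2)%N.
  move=> /asboolP [l [y [[<- lU [ay _]] ]]] /negP nU; rewrite leqNgt; apply/negP => /ltnW dl.
  apply: nU; apply: Uker; first exact: adwa.
  by apply: phi_adw_nil Ud _ dl.
case: (ex_maxnP out0 outle) => m /asboolP [l [y [[sl lU [ay yU]]]]].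
move: (adwa l y lU ay); set t := adw l y => at_ tU maxm.
have brt u : u \in U -> br u t \in U.
  move=> uU; apply/negPn/negP => Hn.
  have /maxm : out m.+1.
    apply/asboolP; exists (u :: l), y; split; first split=> //=; first by rewrite sl.
      by move=> z; rewrite inE => /orP[/eqP->|/lU].
    exact: Hn.
  by rewrite ltnn.
have brt' u : u \in U -> br t u \in U by move=> uU; rewrite br_anti rpredN brt.
pose W := (U + <[t]>)%VS.
have WP z : z \in W -> exists u c, u \in U /\ z = u + c *: t.
  by move=> /memv_addP [u uU [v /vlineP [c ->] ->]]; exists u, c.
have brtt : br t t \in U.
  apply: Uker; first exact: abr.
  by rewrite phi_br subrr.
have /maxn : goodn (\dim W)%VS.
  apply/asboolP; exists W; split=> //; split.
  - move=> z /WP [u [c [uU ->]]]; apply: (subspaceD sa); first exact: Ua.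
    exact: (subspaceZ sa).
  - by move=> z az pz; apply: (subvP (addvSl _ _)); apply: Uker.
  - move=> z1 z2 /WP [u1 [c1 [uU1 ->]]] /WP [u2 [c2 [uU2 ->]]].
    apply: (subvP (addvSl U <[t]>)).
    rewrite (linmapD (br_linr _)) (linmapD (br_linl _)) (linmapD (br_linl _)).
    rewrite !(linmapZ (br_linr _)) !(linmapZ (br_linl _)).
    do ?[apply: rpredD|apply: rpredZ]; first [exact: Ubr|exact: brt|exact: brt'|exact: brtt].
  - have [k tk] := anil t at_; exists (d.+1 * k)%N => s ss sP.
    apply: (wordnil_ext (P := img (fun x => x \in U)) (x := phi t) _ tk Ud ss).
      by move=> _ [u [uU ->]]; exists (br u t); rewrite phi_br; split=> //; apply: brt.
    move=> z /sP [w [/WP [u [c [uU ->]]] ->]]; exists (phi u), c; split; first by exists u.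
    by rewrite (linmapD phi_lin) (linmapZ phi_lin).
rewrite -dimU leqNgt => /negP[]; rewrite ltn_neqAle dimvS ?addvSl // andbT.
apply/negP => /eqP eqd.
have /eqP eqU : U == W by rewrite eqEdim addvSl eqd leqnn.
by move: tU; rewrite eqU memvE addvSr.
Qed.

End LieEngel.

(** * Irreducible representations *)

Section Irreducible.
Context (K : fieldType) (g : vectType K) (br : g -> g -> g).
Hypothesis Hbr : lie_bracket br.

Lemma br_linl z : linmap (br^~ z). Proof. by case: Hbr => Hl _ _ _ a x y; rewrite Hl. Qed.
Lemma br_linr z : linmap (br z). Proof. by case: Hbr => _ Hr _ _ a x y; rewrite Hr. Qed.
Lemma brxx x : br x x = 0. Proof. by case: Hbr. Qed.
Lemma br_anti x y : br x y = - br y x.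
Proof.
apply/eqP; rewrite -addr_eq0; apply/eqP; have := brxx (x + y).
rewrite (linmapD (br_linl _)) !(linmapD (br_linr _)) !brxx addr0 add0r.
by [].
Qed.
Lemma br_jacobi x y z : br x (br y z) = br (br x y) z + br y (br x z).
Proof.
case: Hbr => _ _ _ /(_ x y z) /eqP; rewrite -addrA addr_eq0 => /eqP ->.
rewrite opprD addrC -br_anti; congr (_ + _).
by rewrite [in RHS](br_anti x z) (linmapN (br_linr _)).
Qed.

Lemma irr_subspace m (rho : g -> 'M[K]_m) (P : 'rV[K]_m -> Prop) :
  lie_rep_irreducible rho -> is_subspace P ->
  (forall x v, P v -> P (v *m (rho x)^T)) -> (forall v, P v -> v = 0) \/ (forall v, P v).
Proof.
move=> [m0 irr] sP Pinv; have [U HU] := subspace_vspace sP.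
pose W0 := \matrix_(i < \dim U) (vbasis U)`_i.
have W0P v : (v <= W0)%MS <-> P v.
  split=> [/submxP [D ->]|/HU vU].
    rewrite mulmx_sum_row; apply: (subspace_sum sP) => i _; apply: (subspaceZ sP).
    by apply/HU; rewrite rowK vbasis_mem // mem_nth // size_tuple.
  rewrite (coord_vbasis vU); apply: summx_sub => i _; apply: scalemx_sub.
  by rewrite -(rowK (fun i => (vbasis U)`_i)) row_sub.
(* Irreducibility is stated for square matrices; [<<W0>>] is square with the row space of [W0]. *)
pose W := <<W0>>%MS.
have WP v : (v <= W)%MS <-> P v by rewrite genmxE.
have inv x : (W *m (rho x)^T <= W)%MS.
  by apply/row_subP => i; apply/WP; rewrite row_mul; apply/Pinv/WP/row_sub.
have [rW|rW] := irr W inv; [left|right] => v.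
  move/WP; move/eqP: rW; rewrite mxrank_eq0 => /eqP->.
  by rewrite submx0 => /eqP.
by apply/WP/submx_full; rewrite /row_full rW.
Qed.

(** By [engel] long words in the image of [a] vanish. The span of the vectors [rho x v] with [x] in
    [a] is invariant, [a] being an ideal; were it the whole space, every vector would be a
    combination of values of arbitrarily long words, hence 0. *)
Lemma irr_nil_ideal m (rho : g -> 'M[K]_m) (a : g -> Prop) :
  lie_rep br rho -> lie_rep_irreducible rho ->
  is_subspace a -> (forall x y, a y -> a (br x y)) ->
  (forall x, a x -> exists k, iter k (mulmx (rho x)) 1%:M = 0) ->
  forall x, a x -> rho x = 0.
Proof.
move=> [rlin rbr] irr; have [m0 _] := irr; case: m m0 rho rlin rbr irr => // m _ rho rlin rbr irr.
move=> sa aid anil.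
have {}anil x : a x -> exists k, rho x ^+ k = 0.
  by move=> /anil [k e]; exists k; rewrite -e; elim: k {e} => // k IH; rewrite exprS IH.
have [d Hd] : exists d, wordnil (img rho a) d.
  by apply: (engel br_linl br_linr br_anti rlin rbr sa) => // x y _; apply: aid.
pose P := lspan (fun v : 'rV[K]_m.+1 => exists u x, a x /\ v = u *m (rho x)^T).
have linT (M : 'M[K]_m.+1) : linmap (fun v : 'rV_m.+1 => v *m M).
  by move=> c u v; rewrite mulmxDl scalemxAl.
have Pinv x v : P v -> P (v *m (rho x)^T).
  apply: (lspan_map (linT _)) => _ [u [y [ay ->]]].
  have -> : u *m (rho y)^T *m (rho x)^T =
      u *m (rho x)^T *m (rho y)^T + u *m (rho (br x y))^T.
    rewrite rbr -!mulmxA -!trmx_mul -mulmxDr -linearD /=.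
    by rewrite addrC subrK.
  apply: (subspaceD (lspan_subspace _)); apply: lspan_in.
    by exists (u *m (rho x)^T), y.
  by exists u, (br x y); split=> //; apply: aid.
have [P0|PT] := irr_subspace irr (lspan_subspace _) Pinv.
  move=> x ax; apply/trmx_inj; rewrite trmx0; apply/row_matrixP => i.
  by rewrite row0 rowE; apply/P0/lspan_in; exists (delta_mx 0 i), x.
have Hn n v : lspan (fun v : 'rV[K]_m.+1 => exists u w, is_word (img rho a) n w /\ v = u *m w^T) v.
  elim: n v => [|n IH] v.
    apply: lspan_in; exists v, 1; rewrite trmx1 mulmx1; split=> //; exact: is_word0.
  apply: lspan_sub (lspan_subspace _) _ v (IH v) => _ [u [w [Hw ->]]].
  apply: (lspan_map (linT _)) (PT u) => _ [t [x [ax ->]]].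
  apply: lspan_in; exists t, (w * rho x); split.
    by rewrite -addn1; apply: is_word_cat => //; apply: is_word1; exists x.
  by rewrite -mulmxA -trmx_mul.
have : (delta_mx 0 0 : 'rV[K]_m.+1) = 0.
  apply: (lspan_eq0 (Hn d _)) => _ [u [w [[s [ss sP ->]] ->]]].
  by rewrite Hd // trmx0 mulmx0.
by move=> /matrixP /(_ 0 0) /eqP; rewrite !mxE oner_eq0.
Qed.

End Irreducible.

Lemma irr_schur (C : closedFieldType) (g : vectType C) m (rho : g -> 'M[C]_m) (S : 'M[C]_m) :
  lie_rep_irreducible rho -> (forall x, S *m rho x = rho x *m S) -> exists c, S = c%:M.
Proof.
move=> irr; have [m0 _] := irr; case: m m0 rho irr S => // m _ rho irr S Sc.
have [c /eqP cr] : exists c, root (char_poly S^T) c.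
  by apply/closed_rootP; rewrite size_char_poly.
have ev : eigenvalue S^T c by rewrite eigenvalue_root_char; apply/eqP.
have linT (M : 'M[C]_m.+1) : linmap (fun v : 'rV_m.+1 => v *m M).
  by move=> k u v; rewrite mulmxDl scalemxAl.
have sP : is_subspace (fun v : 'rV[C]_m.+1 => v *m (S^T - c%:M) = 0).
  exact: subspace_ker.
have [x v|H|H] := irr_subspace irr sP.
- rewrite mulmxBr scalar_mxC => /eqP; rewrite subr_eq0 => /eqP e.
  rewrite mulmxBr -mulmxA -trmx_mul Sc trmx_mul mulmxA e.
  by rewrite scalar_mxC -mulmxA subrr.
- move/eigenvalueP: ev => [v ve /negP[]]; apply/eqP/H.
  by rewrite mulmxBr ve mul_mx_scalar subrr.
- exists c; apply/trmx_inj; rewrite tr_scalar_mx; apply/eqP; rewrite -subr_eq0; apply/eqP.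
  by apply/row_matrixP => i; rewrite row0 rowE H.
Qed.

(** * Generalized eigenvectors *)

Section Peval.
Context (K : fieldType) (V : lmodType K) (f : V -> V).
Hypothesis Hf : linmap f.

(** The vector p(f) v. The map [f] is a bare linear function, so that one calculus of generalized
    eigenvectors serves [br x], multiplication by a matrix and commutators in the Banach algebra. *)
Definition peval (p : {poly K}) (v : V) : V := \sum_(i < size p) p`_i *: iter i f v.

Lemma iter_linmap n : linmap (iter n f).
Proof. by elim: n => // n IH a x y; rewrite /= IH Hf. Qed.

Lemma peval_wide n (p : {poly K}) v : (size p <= n)%N -> peval p v = \sum_(i < n) p`_i *: iter i f v.
Proof.
move=> pn; rewrite /peval (big_ord_widen n (fun i => p`_i *: iter i f v) pn) big_mkcond.
apply: eq_bigr => i _; case: ltnP => // pi.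
by rewrite nth_default // scale0r.
Qed.

Lemma peval_linl v : linmap (peval^~ v : {poly K} -> V).
Proof.
move=> a p q; pose n := maxn (size (a *: p + q)) (maxn (size p) (size q)).
rewrite !(@peval_wide n) ?leq_max ?leqnn ?orbT //.
rewrite scaler_sumr -big_split; apply: eq_bigr => i _.
by rewrite coefD coefZ scalerDl scalerA.
Qed.

Lemma peval_linr p : linmap (peval p).
Proof.
move=> a u v; rewrite scaler_sumr -big_split; apply: eq_bigr => i _.
by rewrite iter_linmap scalerDr !scalerA mulrC.
Qed.

Lemma pevalMX p v : peval (p * 'X) v = peval p (f v).
Proof.
rewrite (@peval_wide (size p).+1); last first.
  by rewrite (leq_trans (size_polyMleq _ _)) // size_polyX addnC.
rewrite big_ord_recl coefMX eqxx scale0r add0r; apply: eq_bigr => i _.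
by rewrite coefMX /= -iterSr.
Qed.

Lemma pevalC c v : peval c%:P v = c *: v.
Proof.
rewrite (@peval_wide 1) ?size_polyC ?leq_b1 //.
by rewrite big_ord1 coefC.
Qed.

Lemma peval_f p v : peval p (f v) = f (peval p v).
Proof.
rewrite (linmap_sum Hf); apply: eq_bigr => i _.
by rewrite (linmapZ Hf) -iterS -iterSr.
Qed.

Lemma pevalM p q v : peval (p * q) v = peval p (peval q v).
Proof.
elim/poly_ind: p v => [|p c IH] v; first by rewrite mul0r !(linmap0 (peval_linl _)).
rewrite mulrDl !(linmapD (peval_linl _)) mul_polyC pevalMX (linmapZ (peval_linl _)) pevalC.
by rewrite -mulrA ['X * q]mulrC mulrA pevalMX IH peval_f.
Qed.

Lemma peval1 v : peval 1 v = v. Proof. by rewrite pevalC scale1r. Qed.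

Lemma pevalX v : peval 'X v = f v.
Proof. by rewrite -['X]mul1r pevalMX peval1. Qed.

Lemma pevalXn n v : peval 'X^n v = iter n f v.
Proof. by elim: n v => [|n IH] v; rewrite ?peval1 // exprS pevalM IH pevalX. Qed.

Definition gshift c v := f v - c *: v.

Lemma gshift_lin c : linmap (gshift c).
Proof.
move=> a x y; rewrite /gshift Hf scalerDr opprD addrACA scalerBr !scalerA.
by rewrite [c * a]mulrC.
Qed.

Definition geig c n v := iter n (gshift c) v = 0.

Lemma gshiftE c v : gshift c v = peval ('X - c%:P) v.
Proof. by rewrite (linmapB (peval_linl _)) pevalX pevalC. Qed.

Lemma gshift_iterE c n v : iter n (gshift c) v = peval (('X - c%:P) ^+ n) v.
Proof.
by elim: n => [|n IH]; rewrite ?peval1 // exprS pevalM /= IH gshiftE.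
Qed.

Lemma geigE c n v : geig c n v <-> peval (('X - c%:P) ^+ n) v = 0.
Proof. by rewrite /geig gshift_iterE. Qed.

Lemma geig_le c n m v : (n <= m)%N -> geig c n v -> geig c m v.
Proof.
move=> nm /geigE e; apply/geigE.
by rewrite -(subnK nm) exprD pevalM e (linmap0 (peval_linr _)).
Qed.

Lemma peval_geig p c n v : geig c n v -> geig c n (peval p v).
Proof.
move=> /geigE e; apply/geigE.
by rewrite -pevalM mulrC pevalM e (linmap0 (peval_linr _)).
Qed.

Lemma coprime_kill p q v : coprimep p q -> peval p v = 0 -> peval q v = 0 -> v = 0.
Proof.
move=> /Bezout_eq1_coprimepP [[a b] /= e] pv qv.
by rewrite -[v]peval1 -e (linmapD (peval_linl _)) !pevalM pv qv
  !(linmap0 (peval_linr _)) addr0.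
Qed.

Lemma coprime_XsubC_exp c d n m : c != d -> coprimep (('X - c%:P) ^+ n) (('X - d%:P) ^+ m : {poly K}).
Proof.
move=> cd; apply/coprimep_expl/coprimep_expr.
by rewrite coprimep_XsubC root_XsubC eq_sym.
Qed.

Lemma coprime_XsubC_prod c (s : seq K) n m : c \notin s ->
  coprimep (('X - c%:P) ^+ n) (\prod_(d <- s) ('X - d%:P) ^+ m : {poly K}).
Proof.
elim: s => [|d s IH]; first by rewrite big_nil coprimep1.
rewrite inE negb_or big_cons coprimepMr => /andP[cd /IH ->].
by rewrite coprime_XsubC_exp.
Qed.

Lemma geig_decomp_prod (s : seq K) n v : uniq s ->
  peval (\prod_(c <- s) ('X - c%:P) ^+ n) v = 0 ->
  exists p : K -> {poly K}, (forall c, c \in s -> geig c n (peval (p c) v)) /\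
    v = \sum_(c <- s) peval (p c) v.
Proof.
elim: s v => [|c s IH] v /=.
  by move=> _; rewrite big_nil peval1 => ->; exists (fun=> 0); rewrite big_nil.
move=> /andP[cs us]; rewrite big_cons; set P := _ ^+ n; set Q := \prod_(_ <- _) _ => PQ.
have /Bezout_eq1_coprimepP [[a b] /= e] : coprimep P Q.
  exact: coprime_XsubC_prod.
have [|p [pg pe]] := IH (peval (a * P) v) us.
  by rewrite -pevalM mulrCA pevalM [Q * P]mulrC PQ (linmap0 (peval_linr _)).
exists (fun d => if d == c then b * Q else p d * (a * P)); split.
  move=> d; rewrite inE; case: eqVneq => [-> _|_ /= ds].
    apply/geigE; rewrite -/P -pevalM mulrCA pevalM PQ.
    by rewrite (linmap0 (peval_linr _)).
  by rewrite pevalM; apply: pg.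
rewrite big_cons eqxx -[LHS]peval1 -e (linmapD (peval_linl _)) addrC; congr (_ + _).
rewrite [LHS]pe big_seq [RHS]big_seq; apply: eq_bigr => d ds.
rewrite -pevalM; case: eqVneq => // dc.
by rewrite -dc ds in cs.
Qed.

Lemma geig_decomp (r : seq K) n v : (size r <= n)%N ->
  peval (\prod_(c <- r) ('X - c%:P)) v = 0 ->
  exists p : K -> {poly K}, (forall c, c \in r -> geig c n (peval (p c) v)) /\
    v = \sum_(c <- undup r) peval (p c) v.
Proof.
move=> rn rv; have [|p [pg pe]] := @geig_decomp_prod (undup r) n v (undup_uniq r).
  suff [q ->] : exists q, \prod_(c <- undup r) ('X - c%:P) ^+ n =
      q * \prod_(c <- r) ('X - c%:P) by rewrite pevalM rv (linmap0 (peval_linr _)).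
  exists (\prod_(c <- undup r) ('X - c%:P) ^+ (n - count_mem c r)).
  rewrite -(prodr_undup_exp_count r predT) -big_split; apply: eq_bigr => c _.
  by rewrite /= -exprD subnK // (leq_trans (count_size _ _)).
by exists p; split=> // c cr; apply: pg; rewrite mem_undup.
Qed.

(** On the generalized eigenspace for [c != 0] the map [f] is invertible: the Bezout coefficient of
    ['X^N] evaluates to an inverse of [iter N f]. *)
Lemma geig_iter_im c n N v : c != 0 -> geig c n v -> exists u, v = iter N f u.
Proof.
move=> c0 /geigE e.
have /Bezout_eq1_coprimepP [[a b] /= E] : coprimep 'X^N (('X - c%:P) ^+ n).
  by rewrite coprimep_expl // coprimep_expr // coprimep_XsubC rootX.
exists (peval a v); rewrite -pevalXn -pevalM -[LHS]peval1 -E.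
rewrite (linmapD (peval_linl _)) [peval (b * _) _]pevalM e (linmap0 (peval_linr _)).
by rewrite addr0 mulrC.
Qed.

(** The vector [v] is killed by the product and by a power of ['X - c%:P], hence by their greatest
    common divisor, whose exponent is at most the multiplicity of [c] in [r]. *)
Lemma geig_root (r : seq K) c n v :
  peval (\prod_(c <- r) ('X - c%:P)) v = 0 -> geig c n v ->
  geig c (size r) v /\ (c \notin r -> v = 0).
Proof.
set q := \prod_(_ <- _) _ => qv /geigE cv.
have q0 : q != 0 by apply/monic_neq0/monic_prod_XsubC.
have [m [q'] ] := multiplicity_XsubC q c; rewrite q0 /= => rq qe.
have mr : (m <= size r)%N.
  have := dvdp_mull q' (dvdpp (('X - c%:P) ^+ m)); rewrite -qe => /dvdp_leq.
  by move=> /(_ q0); rewrite size_exp_XsubC size_prod_XsubC ltnS.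
have mv : geig c m v.
  apply/geigE; apply: (@coprime_kill (('X - c%:P) ^+ n) q').
  - by rewrite coprimep_expl // coprimep_sym coprimep_XsubC.
  - by rewrite -pevalM mulrC pevalM cv (linmap0 (peval_linr _)).
  - by rewrite -pevalM -qe.
split; first exact: geig_le mv.
move=> cr; have : ~~ root q c by rewrite root_prod_XsubC.
rewrite qe rootM negb_or => /andP[_].
case: m mv {mr qe} => [//|m] _.
by rewrite root_exp_XsubC eqxx.
Qed.

End Peval.

(** The shifted operators again satisfy the Leibniz rule, so each term in the expansion of [N + M]
    applications has at least [N] of them on [a] or at least [M] on [b]. *)
Lemma geig_leibniz (K : fieldType) (V1 V2 V : lmodType K)
  (f1 : V1 -> V1) (f2 : V2 -> V2) (f : V -> V) (m : V1 -> V2 -> V) :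
  linmap f ->
  (forall a, linmap (m a)) -> (forall b, linmap (m^~ b)) ->
  (forall a b, f (m a b) = m (f1 a) b + m a (f2 b)) ->
  forall c d N M a b, geig f1 c N a -> geig f2 d M b -> geig f (c + d) (N + M) (m a b).
Proof.
move=> fl ml mr fm c d N M a b.
have g0 k : iter k (gshift f (c + d)) 0 = 0.
  by rewrite (linmap0 (iter_linmap (gshift_lin fl _) _)).
have step x y : gshift f (c + d) (m x y) = m (gshift f1 c x) y + m x (gshift f2 d y).
  rewrite /gshift fm (linmapB (ml _)) (linmapB (mr _)) (linmapZ (ml _)) (linmapZ (mr _)).
  by rewrite scalerDl opprD addrACA.
elim: N a M b => [|N IHN] a M b.
  by rewrite /geig /= => -> _; rewrite (linmap0 (mr _)) g0.
elim: M b => [|M IHM] b aN.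
  by rewrite /geig /= => ->; rewrite (linmap0 (ml _)) -iterS g0.
move=> bM; rewrite /geig addSn iterSr step (linmapD (iter_linmap (gshift_lin fl _) _)).
rewrite (IHN (gshift f1 c a)) //; last by rewrite /geig -iterSr.
rewrite add0r addnS -addSn; apply: IHM => //.
by rewrite /geig -iterSr.
Qed.

Section ClosedDecomp.
Context (C : closedFieldType).

Lemma geig_decomp_fd (V : vectType C) (f : V -> V) v : linmap f ->
  exists (s : seq C) (w : C -> V), (forall c, geig f c (\dim {:V}) (w c)) /\
    v = \sum_(c <- s) w c.
Proof.
move=> fl; set n := \dim _.
have [p [p0 sp pv]] : exists p : {poly C}, [/\ p != 0, (size p <= n.+1)%N & peval f p v = 0].
  (* One more iterate than the dimension: a linear dependence among them is an annihilating
     polynomial of [v]. *)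
  pose X := [tuple iter i f v | i < n.+1].
  have nf : ~ free X.
    move=> /eqP; rewrite size_tuple => e; have := dimvS (subvf <<X>>%VS).
    by rewrite e ltnn.
  apply: contrapT => H; apply: nf; apply/freeP => k ek i; apply/eqP/negPn/negP => ki.
  apply: H; exists (\poly_(j < n.+1) k (inord j)); rewrite size_poly; split=> //.
    apply: contraNneq ki => /polyP /(_ i); rewrite coef_poly ltn_ord coef0.
    by rewrite inord_val => ->.
  rewrite (peval_wide _ _ (size_poly _ _)) -[RHS]ek; apply: eq_bigr => j _.
  by rewrite coef_poly ltn_ord inord_val (nth_map j) ?size_enum_ord // nth_ord_enum.
have [r pr] := closed_field_poly_normal p.
have sr : (size r <= n)%N.
  by move: sp; rewrite pr size_scale ?lead_coef_eq0 // size_prod_XsubC.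
have rv : peval f (\prod_(c <- r) ('X - c%:P)) v = 0.
  move/eqP: pv; rewrite pr (linmapZ (peval_linl _ _)) scaler_eq0 lead_coef_eq0.
  by rewrite (negPf p0) /= => /eqP.
have [q [qg qe]] := geig_decomp fl sr rv.
(* The family is 0 outside the roots, so that its eigenvector property holds for every [c], in
   particular for 0, without a membership test. *)
exists (undup r), (fun c => if c \in r then peval f (q c) v else 0); split.
  move=> c; case: ifP => [/qg //|_].
  by rewrite /geig (linmap0 (iter_linmap (gshift_lin fl _) _)).
rewrite [LHS]qe big_seq [RHS]big_seq; apply: eq_bigr => c.
by rewrite mem_undup => ->.
Qed.

End ClosedDecomp.

Section TrigHorner.
Context (C : fieldType) (n : nat).

Lemma trig_mulmx (A B : 'M[C]_n.+1) : is_trig_mx A -> is_trig_mx B ->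
  is_trig_mx (A *m B) /\ forall i, (A *m B) i i = A i i * B i i.
Proof.
move=> /is_trig_mxP Ht /is_trig_mxP Bt; split.
  apply/is_trig_mxP => i j ij; rewrite mxE big1 // => k _.
  case: (ltnP i k) => ik; first by rewrite Ht // mul0r.
  by rewrite Bt ?mulr0 // (leq_ltn_trans ik).
move=> i; rewrite mxE (bigD1 i) //= big1 ?addr0 // => k ki.
case: (ltnP i k) => ik; first by rewrite Ht // mul0r.
by rewrite Bt ?mulr0 // ltn_neqAle ik andbT.
Qed.

Lemma trig_horner_mx (A : 'M[C]_n.+1) (p : {poly C}) : is_trig_mx A ->
  is_trig_mx (horner_mx A p) /\ forall i, horner_mx A p i i = p.[A i i].
Proof.
move=> At; elim/poly_ind: p => [|p c [IHt IH]].
  rewrite rmorph0; split=> [|i]; first exact: mx0_is_trig.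
  by rewrite horner0 mxE.
have [Pt P] := trig_mulmx IHt At.
rewrite rmorphD rmorphM /= horner_mx_X horner_mx_C; split=> [|i].
  apply/is_trig_mxP => i j ij; rewrite mxE (is_trig_mxP Pt) // add0r.
  by rewrite mxE -val_eqE ltn_eqF ?mulr0n.
by rewrite hornerMXaddC mxE P IH mxE eqxx.
Qed.

End TrigHorner.

(** Chinese remainders with constant residues: evaluated at an operator, [P] acts as the scalar
    [h c] on the generalized eigenvectors of exponent [n] for [c]. *)
Lemma interp_XsubC (K : fieldType) (s : seq K) (h : K -> K) n : uniq s ->
  exists P : {poly K}, forall c, c \in s -> exists q, P - (h c)%:P = q * ('X - c%:P) ^+ n.
Proof.
elim: s => [|c s IH] /=; first by exists 0.
move=> /andP[cs us]; have [P HP] := IH us.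
have /Bezout_eq1_coprimepP [[a b] /= e] := coprime_XsubC_prod n n cs.
set Q := \prod_(_ <- s) _ in e.
(* The factor [b * Q] is 1 modulo the new power and 0 modulo the old ones. *)
exists (P + b * Q * ((h c)%:P - P)) => d; rewrite inE => /orP[/eqP ->|ds].
  exists (a * (P - (h c)%:P)).
  have {e} -> : b * Q = 1 - a * ('X - c%:P) ^+ n by rewrite -e addrC addKr.
  by ring.
have [q qe] := HP d ds.
exists (q + b * ((h c)%:P - P) * \prod_(e <- rem d s) ('X - e%:P) ^+ n).
have -> : Q = ('X - d%:P) ^+ n * \prod_(e <- rem d s) ('X - e%:P) ^+ n.
  by rewrite /Q (big_rem d) //.
by rewrite [RHS]mulrDl -qe; ring.
Qed.

(** * The conjugate part of a matrix *)

Section ConjPart.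
Context (C : numClosedFieldType) (n : nat) (X : 'M[C]_n.+1).

Definition adX (Y : 'M[C]_n.+1) := X *m Y - Y *m X.

Lemma mulmx_lin k : linmap (mulmx X : 'M[C]_(n.+1, k) -> _).
Proof. by move=> a Y Z; rewrite mulmxDr scalemxAr. Qed.

Lemma peval_mulmx k p (v : 'M[C]_(n.+1, k)) : peval (mulmx X) p v = horner_mx X p *m v.
Proof.
elim/poly_ind: p v => [|p c IH] v.
  by rewrite (linmap0 (peval_linl (mulmx X) v)) rmorph0 mul0mx.
rewrite (linmapD (peval_linl _ _)) pevalMX pevalC IH.
rewrite rmorphD rmorphM /= horner_mx_X horner_mx_C mulmxDl mulmxA.
by rewrite mul_scalar_mx.
Qed.

(** The list [r] is the diagonal of a Schur triangular form of [X]: its eigenvalues with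
    multiplicity. *)
Lemma char_roots : exists r : seq C,
  [/\ size r = n.+1, horner_mx X (\prod_(c <- r) ('X - c%:P)) = 0 &
      forall p, \tr (horner_mx X p) = \sum_(c <- r) p.[c]].
Proof.
have [P Pu Pt] := Schur X (ltn0Sn n).
have uP : P \in unitmx by apply: unitarymx_unit.
pose T := P *m X *m invmx P.
have Tt : is_trig_mx T by move: Pt; rewrite /mxred.similar_to mxred.conjumx.
have TX p : horner_mx T p = P *m horner_mx X p *m invmx P by apply: horner_mx_uconj.
exists [seq T i i | i <- enum 'I_n.+1]; split.
- by rewrite size_map size_enum_ord.
- rewrite big_map big_enum /= -char_poly_trig //.
  have := TX (char_poly T); rewrite Cayley_Hamilton => /esym.
  move=> /(congr1 (fun M => invmx P *m M *m P)); rewrite mulmx0 mul0mx !mulmxA.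
  by rewrite mulVmx // mul1mx mulmxKV.
- move=> p; rewrite big_map big_enum /=.
  have -> : \tr (horner_mx X p) = \tr (horner_mx T p).
    by rewrite TX mxtrace_mulC mulmxA mulVmx // mul1mx.
  by apply: eq_bigr => i _; have [_ ->] := trig_horner_mx p Tt.
Qed.

(* [S] is the scalar [c^*] on the generalized eigenspace of [X] for [c], so that
   [\tr (X *m S)] is the sum of the squared moduli of the eigenvalues of [X]. *)
Lemma conj_part : exists S : 'M[C]_n.+1,
  [/\ 0 <= \tr (X *m S), \tr (X *m S) = 0 -> X ^+ n.+1 = 0 &
   forall nu N Y, geig adX nu N Y -> S *m Y - Y *m S = nu^* *: Y].
Proof.
have [r [sr rX rtr]] := char_roots.
have [P HP] := interp_XsubC (fun c => c^*) n.+1 (undup_uniq r).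
have HP' c : c \in r -> exists q, P = q * ('X - c%:P) ^+ n.+1 + (c^*)%:P.
  by rewrite -mem_undup => /HP [q e]; exists q; rewrite -e subrK.
have trXS : \tr (X *m horner_mx X P) = \sum_(c <- r) `|c| ^+ 2.
  rewrite -{1}[X]horner_mx_X -[_ *m _]/(_ * _) -rmorphM rtr big_seq [RHS]big_seq.
  apply: eq_bigr => c cr; have [q ->] := HP' c cr.
  by rewrite !hornerE subrr expr0n mulr0 add0r normCK.
have Sgeig k c N (v : 'M[C]_(n.+1, k)) : geig (mulmx X) c N v -> horner_mx X P *m v = c^* *: v.
  move=> cv; have rv : peval (mulmx X) (\prod_(c <- r) ('X - c%:P)) v = 0.
    by rewrite peval_mulmx rX mul0mx.
  have [cv' c0] := geig_root (@mulmx_lin k) rv cv.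
  have [cr|/c0 ->] := boolP (c \in r); last by rewrite mulmx0 scaler0.
  have [q ->] := HP' c cr; move: cv'; rewrite sr => /(geigE (@mulmx_lin k)) e.
  rewrite -peval_mulmx (linmapD (peval_linl _ _)) (pevalM (@mulmx_lin k)) e pevalC.
  by rewrite (linmap0 (peval_linr (@mulmx_lin k) _)) add0r.
exists (horner_mx X P); rewrite trXS; split.
- by apply: sumr_ge0 => c _; rewrite exprn_ge0.
(* A vanishing sum of squared moduli leaves only the eigenvalue 0, and the characteristic polynomial
   becomes a power of ['X]. *)
- move=> e; have r0 c : c \in r -> c = 0.
    move=> cr; move/eqP: e; rewrite psumr_eq0 => [/allP /(_ c cr)|d _].
      by rewrite /= sqrf_eq0 normr_eq0 => /eqP.
    by rewrite exprn_ge0.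
  move: rX; rewrite (eq_big_seq (fun=> 'X)) => [|c /r0 ->]; last by rewrite subr0.
  by rewrite big_const_seq count_predT sr iter_mulr_1 rmorphXn /= horner_mx_X.
- move=> nu N Y YN; apply/eqP; rewrite -subr_eq0; apply/eqP; set D := _ - _.
  (* It suffices to test on generalized eigenvectors [w] of [X] for [c]: then [Y *m w] belongs to
     [nu + c], and conjugation is additive. *)
  suff H (v : 'cV[C]_n.+1) : D *m v = 0.
    by apply/trmx_inj/row_matrixP => i; rewrite trmx0 row0 -tr_col colE H trmx0.
  have [p [pg pe]] : exists p : C -> {poly C}, (forall c, c \in r -> geig (mulmx X) c n.+1 (peval (mulmx X) (p c) v)) /\
      v = \sum_(c <- undup r) peval (mulmx X) (p c) v.
    apply: geig_decomp; [exact: mulmx_lin|by rewrite sr|].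
    by rewrite peval_mulmx rX mul0mx.
  rewrite pe mulmx_sumr big_seq big1 // => c; rewrite mem_undup => cr.
  move: (peval _ _ _) (pg c cr) => w wc.
  have Yw : geig (mulmx X) (nu + c) (N + n.+1) (Y *m w).
    apply: (geig_leibniz (f1 := adX) (f2 := mulmx X) (m := mulmx)) YN wc.
    + exact: mulmx_lin.
    + by move=> A a u t; rewrite mulmxDr scalemxAr.
    + by move=> A a u t; rewrite mulmxDl scalemxAl.
    + by move=> A u; rewrite /adX mulmxBl !mulmxA subrK.
  rewrite /D !mulmxBl -mulmxA (Sgeig _ _ _ _ Yw) -mulmxA (Sgeig _ _ _ _ wc).
  by rewrite -scalemxAr -scalemxAl rmorphD scalerDl addrK subrr.
Qed.

End ConjPart.

(** * The ideal of eigenvectors and its orthogonal *)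

(** The coefficients are recovered from the values at the nodes 0, ..., d - 1 by inverting a
    Vandermonde matrix; in characteristic 0 these nodes are distinct. *)
Lemma vandermonde_subspace (K : numFieldType) (V : lmodType K) (P : V -> Prop) d (u : 'I_d -> V) :
  is_subspace P -> (forall t : K, P (\sum_(i < d) t ^+ i *: u i)) -> forall i, P (u i).
Proof.
move=> sP H i; pose a : 'rV[K]_d := \row_j (j%:R).
pose W := Vandermonde d a.
have uW : W \in unitmx.
  rewrite unitmxE det_Vandermonde unitfE; apply/prodf_neq0 => j _; apply/prodf_neq0 => k jk.
  by rewrite !mxE subr_eq0 eqr_nat gtn_eqF.
suff -> : u i = \sum_(j < d) invmx W j i *: \sum_(k < d) (a 0 j) ^+ k *: u k.
  by apply: (subspace_sum sP) => j _; apply: (subspaceZ sP); apply: H.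
under eq_bigr do rewrite scaler_sumr.
rewrite exchange_big /= (bigD1 i) //= [X in _ + X]big1 => [|k ki].
  rewrite addr0 -[LHS]scale1r; under eq_bigr do rewrite scalerA.
  rewrite -scaler_suml; congr (_ *: _).
  have := congr1 (fun M : 'M[K]_d => M i i) (mulmxV uW); rewrite !mxE eqxx mulr1n => <-.
  by apply: eq_bigr => j _; rewrite !mxE mulrC.
under eq_bigr do rewrite scalerA.
rewrite -scaler_suml.
have := congr1 (fun M : 'M[K]_d => M k i) (mulmxV uW); rewrite !mxE (negPf ki) mulr0n => e.
rewrite -[RHS](scale0r (u k)) -[in RHS]e; congr (_ *: _).
by apply: eq_bigr => j _; rewrite !mxE mulrC.
Qed.

Lemma mxtraceB (R : pzRingType) n (A B : 'M[R]_n) : \tr (A - B) = \tr A - \tr B.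
Proof. exact: raddfB. Qed.

Section Split.
Context (C : numClosedFieldType) (g : vectType C) (br : g -> g -> g).
Hypothesis Hbr : lie_bracket br.
Let brl := br_linl Hbr.
Let brr := br_linr Hbr.

(** Exceeds the dimension, so that [iter lieN (br x)] kills the generalized eigenspace for 0; being
    a successor, it exhibits each value as a bracket. *)
Definition lieN := (\dim {:g}).+1.

(** The sum of the Fitting one-components of all [br x]. In this form, unlike as a span of
    eigenvectors, the generators depend polynomially on [x], so that [lieL_ideal] can
    differentiate. *)
Definition lieL := lspan (fun y => exists x v, y = iter lieN (br x) v).

Definition nonzero_eigvec (y : g) :=
  exists x nu n, nu != 0 /\ geig (br x) nu n y.

Lemma lieL_eigvec y : lieL y -> lspan nonzero_eigvec y.
Proof.
apply: lspan_sub (lspan_subspace _) _ y => _ [x [v ->]].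
have [s [w [wg ->]]] := geig_decomp_fd v (brr x).
rewrite (linmap_sum (iter_linmap (brr x) _)).
apply: (subspace_sum (lspan_subspace _)) => c _.
have [->|c0] := eqVneq c 0.
  have := wg 0; rewrite /geig => e.
  have -> : iter lieN (br x) (w 0) = br x (iter (\dim {:g}) (br x) (w 0)) by [].
  suff -> : iter (\dim {:g}) (br x) (w 0) = 0 by rewrite (linmap0 (brr _)); apply: lspan0.
  rewrite -[RHS]e; apply: eq_iter => z; by rewrite /gshift scale0r subr0.
apply: lspan_in; exists x, c, (\dim {:g}); split=> //.
by rewrite -(pevalXn (brr x)); apply: (peval_geig (brr x)).
Qed.

Lemma eigvec_lieL y : nonzero_eigvec y -> lieL y.
Proof.
move=> [x [nu [n [nu0 yg]]]]; have [u ->] := geig_iter_im (brr x) lieN nu0 yg.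
by apply: lspan_in; exists x, u.
Qed.

(* Coefficient of [t] in [(ad (x + t z))^n v]. *)
Fixpoint adder (x z : g) n (v : g) : g :=
  if n is n'.+1 then br z (iter n' (br x) v) + br x (adder x z n' v) else 0.

(** Polynomial curves in Horner form, which gives closure under sums and linear maps by plain
    induction. *)
Inductive polyfun : (C -> g) -> Prop :=
  | polyfun0 : polyfun (fun=> 0)
  | polyfunS v h : polyfun h -> polyfun (fun t => v + t *: h t).

Lemma polyfunD h k : polyfun h -> polyfun k -> polyfun (fun t => h t + k t).
Proof.
move=> Hh; elim: Hh k => [|v {}h Hh IH] k Hk.
  by under eq_fun do rewrite add0r.
case: Hk => [|w {}k Hk]; first by under eq_fun do rewrite addr0; apply: polyfunS.
under eq_fun do rewrite addrACA -scalerDr.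
exact/polyfunS/IH.
Qed.

Lemma polyfun_map (f : g -> g) h : linmap f -> polyfun h -> polyfun (f \o h).
Proof.
move=> fl; elim=> [|v {}h Hh IH]; rewrite /comp.
  by under eq_fun do rewrite (linmap0 fl); apply: polyfun0.
under eq_fun do rewrite (linmapD fl) (linmapZ fl).
exact: polyfunS IH.
Qed.

Lemma polyfun_sum h : polyfun h ->
  exists d (u : 'I_d -> g), forall t, h t = \sum_(i < d) t ^+ i *: u i.
Proof.
elim=> [|v {}h Hh [d [u hu]]]; first by exists 0%N, (fun=> 0) => t; rewrite big_ord0.
exists d.+1, (fun i => if unlift ord0 i is Some j then u j else v) => t.
rewrite big_ord_recl unlift_none expr0 scale1r hu scaler_sumr; congr (_ + _).
by apply: eq_bigr => i _; rewrite liftK lift0 exprS scalerA.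
Qed.

(** The coefficients of [t *: h t] are those of [h] shifted by one, so all of them lie in [P].
    Dividing by [t] would miss the value at 0, the one that is wanted. *)
Lemma polyfun_sub (P : g -> Prop) h : is_subspace P -> polyfun h ->
  (forall t, P (t *: h t)) -> forall t, P (h t).
Proof.
move=> sP /polyfun_sum [d [u hu]] HP t; rewrite hu.
apply: (subspace_sum sP) => i _; apply: (subspaceZ sP).
pose u' (j : 'I_d.+1) := if unlift ord0 j is Some k then u k else 0.
suff : P (u' (lift ord0 i)) by rewrite /u' liftK.
apply: vandermonde_subspace sP _ _ => {}t.
rewrite big_ord_recl /u' unlift_none scaler0 add0r.
move: (HP t); rewrite hu scaler_sumr; congr P; apply: eq_bigr => j _.
by rewrite liftK lift0 exprS scalerA.
Qed.

Lemma adder_expand x z n v : exists h, polyfun h /\ forall t,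
  iter n (br (x + t *: z)) v =
  iter n (br x) v + t *: adder x z n v + t ^+ 2 *: h t.
Proof.
elim: n => [|n [h [Hh IH]]].
  by exists (fun=> 0); split=> [|t]; [exact: polyfun0|rewrite /= !scaler0 !addr0].
exists (fun t => br x (h t) + (br z (adder x z n v) + t *: br z (h t))); split.
  by apply: polyfunD (polyfunS _ _); apply: polyfun_map.
move=> t; rewrite iterS IH.
rewrite (linmapD (brl _)) (linmapZ (brl _)) !(linmapD (brr _)) !(linmapZ (brr _)).
rewrite /= !scalerDr !scalerA -!addrA -expr2 -exprS -exprSr; congr (_ + _).
rewrite [RHS]addrCA; congr (_ + _); rewrite [RHS]addrCA; congr (_ + _).
Qed.

(** The derivation [br y] replaces one factor [br x] at a time by [br (br y x)]; the sum of these
    terms is the first-order coefficient in the direction [br y x]. *)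
Lemma adder_comm x y n v :
  br y (iter n (br x) v) = iter n (br x) (br y v) + adder x (br y x) n v.
Proof.
elim: n => [|n IH] /=; first by rewrite addr0.
by rewrite (br_jacobi Hbr) IH (linmapD (brr _)) addrCA.
Qed.

(* The ideal property is the derivative at [t = 0] of the fact that [lieL] contains
   the values of [(ad (x + t [y, x]))^N]. *)
Lemma lieL_ideal y l : lieL l -> lieL (br y l).
Proof.
apply: (lspan_map (brr y)) => _ [x [v ->]]; rewrite adder_comm.
apply: (subspaceD (lspan_subspace _)); first by apply: lspan_in; exists x, (br y v).
set z := br y x; have [h [Hh he]] := adder_expand x z lieN v.
have := polyfun_sub (lspan_subspace _) (polyfunS (adder x z lieN v) Hh) _ 0.
rewrite scale0r addr0; apply => t.
rewrite scalerDr scalerA -expr2.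
have -> : t *: adder x z lieN v + t ^+ 2 *: h t =
    iter lieN (br (x + t *: z)) v - iter lieN (br x) v.
  by rewrite he -[iter _ _ _ + _ + _]addrA [RHS]addrC addKr.
apply: (subspaceB (lspan_subspace _)); apply: lspan_in.
  by exists (x + t *: z), v.
by exists x, v.
Qed.

Definition brackets := lspan (fun z => exists x y, z = br x y).

Lemma lieL_brackets l : lieL l -> brackets l.
Proof.
apply: lspan_mono => _ [x [v ->]]; by exists x, (iter (\dim {:g}) (br x) v).
Qed.

(* The dimension is [idim + 1], so that the matrices form an [algType]. *)
Record irrep := Irrep {
  idim : nat;
  irho :> g -> 'M[C]_idim.+1;
  irepP : lie_rep br irho;
  iirrP : lie_rep_irreducible irho
}.

Lemma irho_lin (r : irrep) : linmap (irho r).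
Proof. by case: r => d rho [rl rb] ri. Qed.

Lemma irho_br (r : irrep) x y : irho r (br x y) = irho r x *m irho r y - irho r y *m irho r x.
Proof. by case: r => d rho [rl rb] ri; apply: rb. Qed.

Lemma nil_radicalP x : (forall r : irrep, irho r x = 0) <-> nil_radical br x.
Proof.
split=> [H m rho Hrep Hirr|H r]; last exact: H (irepP r) (iirrP r).
have [m0 _] := Hirr; case: m m0 rho Hrep Hirr => // m _ rho Hrep Hirr.
exact: (H (Irrep Hrep Hirr)).
Qed.

Lemma nil_radical_subspace : is_subspace (nil_radical br).
Proof.
split=> [|a x y nx ny]; apply/nil_radicalP => r.
  exact: linmap0 (irho_lin r).
by rewrite irho_lin (proj2 (nil_radicalP x)) // (proj2 (nil_radicalP y)) // scaler0 addr0.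
Qed.

Lemma nil_radical_ideal x y : nil_radical br y -> nil_radical br (br x y).
Proof.
move=> /nil_radicalP ny; apply/nil_radicalP => r.
by rewrite irho_br ny mulmx0 mul0mx subrr.
Qed.

(** A joint kernel of minimal dimension is contained in every further kernel. *)
Lemma finite_irreps : exists n (rs : 'I_n -> irrep),
  forall x, (forall i, irho (rs i) x = 0) -> nil_radical br x.
Proof.
pose good k := `[< exists n (rs : 'I_n -> irrep) (U : {vspace g}),
  \dim U = k /\ forall x, x \in U <-> forall i, irho (rs i) x = 0 >].
have ker_sub n (rs : 'I_n -> irrep) : is_subspace (fun x => forall i, irho (rs i) x = 0).
  split=> [i|a x y Hx Hy i]; first exact: linmap0 (irho_lin _).
  by rewrite irho_lin Hx Hy scaler0 addr0.
have good0 : exists k, good k.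
  exists (\dim {:g}); apply/asboolP; exists 0%N, (fun i : 'I_0 => False_rect _ (notF (ltn_ord i))), fullv.
  by split=> // x; split=> [_ []//|_]; apply: memvf.
case: (ex_minnP good0) => k /asboolP [n [rs [U [dU HU]]]] mink.
exists n, rs => x /HU xU; apply/nil_radicalP => r; apply/eqP/negPn/negP => rx.
pose rs' (i : 'I_n.+1) := if unlift ord0 i is Some j then rs j else r.
have [W HW] := subspace_vspace (ker_sub _ rs').
have WU : (W <= U)%VS.
  apply/subvP => y /HW Wy; apply/HU => i.
  by have := Wy (lift ord0 i); rewrite /rs' liftK.
have : (k <= \dim W)%N by apply: mink; apply/asboolP; exists n.+1, rs', W.
rewrite -dU => UW; have /eqP eWU : W == U by rewrite eqEdim WU.
move: xU; rewrite -eWU => /HW /(_ ord0); rewrite /rs' unlift_none => e.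
by rewrite e eqxx in rx.
Qed.

Lemma irho_trace_brackets (r : irrep) z : brackets z -> \tr (irho r z) = 0.
Proof.
apply: (lspan_sub (P := fun z => \tr (irho r z) = 0)) => [|_ [x [y ->]]].
  split=> [|a u v Hu Hv]; first by rewrite (linmap0 (irho_lin r)) mxtrace0.
  by rewrite irho_lin mxtraceD mxtraceZ Hu Hv mulr0 addr0.
by rewrite irho_br raddfB /= mxtrace_mulC subrr.
Qed.

Lemma irho_scalar_brackets (r : irrep) z c : brackets z -> irho r z = c%:M -> irho r z = 0.
Proof.
move=> /(irho_trace_brackets r) t e; move: t; rewrite e mxtrace_scalar.
by move=> /eqP; rewrite -mulr_natl mulf_eq0 pnatr_eq0 /= => /eqP ->; rewrite raddf0.
Qed.

Lemma irho_gshift (r : irrep) x nu n y :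
  irho r (iter n (gshift (br x) nu) y) = iter n (gshift (adX (irho r x)) nu) (irho r y).
Proof.
elim: n y => // n IH y; rewrite !iterSr IH; congr (iter _ _ _).
by rewrite /gshift (linmapB (irho_lin r)) (linmapZ (irho_lin r)) irho_br.
Qed.

Lemma irho_geig (r : irrep) x nu n y :
  geig (br x) nu n y -> geig (adX (irho r x)) nu n (irho r y).
Proof. by rewrite /geig -irho_gshift => ->; apply: linmap0 (irho_lin r). Qed.

Lemma ideal_brackets (k : g -> Prop) :
  (forall x y, k y -> k (br x y)) ->
  forall z y, lspan (fun z => exists x y, k x /\ z = br x y) y ->
  lspan (fun z => exists x y, k x /\ z = br x y) (br z y).
Proof.
move=> kid z; apply: (lspan_map (brr z)) => _ [x [y [kx ->]]].
rewrite (br_jacobi Hbr); apply: (subspaceD (lspan_subspace _)); apply: lspan_in.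
  by exists (br z x), y; split=> //; apply: kid.
by exists x, (br z y).
Qed.

Lemma nil_ideal_irho (r : irrep) (a : g -> Prop) :
  is_subspace a -> (forall x y, a y -> a (br x y)) ->
  (forall x, a x -> irho r x ^+ (idim r).+1 = 0) ->
  forall x, a x -> irho r x = 0.
Proof.
move=> sa aid anil x ax.
apply: (irr_nil_ideal Hbr (irepP r) (iirrP r) sa aid _ ax) => y ay.
have E k : iter k (mulmx (irho r y)) 1%:M = irho r y ^+ k.
  by elim: k => // k IH; rewrite exprS -IH.
by exists (idim r).+1; rewrite E anil.
Qed.

(** * The trace form and the orthogonal of the ideal *)

Section TraceForm.
Context (n : nat) (rs : 'I_n -> irrep).
Hypothesis Hrs : forall x, (forall i, irho (rs i) x = 0) -> nil_radical br x.

Definition tform x y := \sum_i \tr (irho (rs i) x *m irho (rs i) y).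

Lemma tformC x y : tform x y = tform y x.
Proof. by apply: eq_bigr => i _; rewrite mxtrace_mulC. Qed.

Lemma tform_lin x : forall a y z, tform x (a *: y + z) = a * tform x y + tform x z.
Proof.
move=> a y z; rewrite mulr_sumr -big_split; apply: eq_bigr => i _ /=.
by rewrite irho_lin mulmxDr -scalemxAr mxtraceD mxtraceZ.
Qed.

Lemma tform_inv x y z : tform (br x y) z = tform x (br y z).
Proof.
apply: eq_bigr => i _; rewrite !irho_br mulmxBl mulmxBr !raddfB /= !mulmxA; congr (_ - _).
by rewrite -[in LHS]mulmxA [LHS]mxtrace_mulC.
Qed.

Definition perp (x : g) := forall l, lieL l -> tform x l = 0.

Lemma perp_subspace : is_subspace perp.
Proof.
split=> [l _|a x y Hx Hy l Ll]; rewrite tformC.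
  by rewrite -[X in tform _ X](scale0r 0) -[_ *: _]addr0 tform_lin mul0r add0r
    /tform big1 // => i _; rewrite (linmap0 (irho_lin _)) mulmx0 mxtrace0.
by rewrite tform_lin ![tform l _]tformC Hx ?Hy // mulr0 addr0.
Qed.

Lemma perp_ideal x y : perp y -> perp (br x y).
Proof.
move=> Hy l Ll; rewrite tformC -tform_inv tformC Hy // (br_anti Hbr).
by apply: (subspaceN (lspan_subspace _)); apply: lieL_ideal.
Qed.

(** The brackets of [k] with all of [g] span an ideal; if it acts by nilpotent matrices,
    irreducibility makes it act by 0. *)
Lemma bracket_ideal_radical (k : g -> Prop) :
  (forall x y, k y -> k (br x y)) ->
  (forall x, lspan (fun z => exists x y, k x /\ z = br x y) x ->
    forall i, irho (rs i) x ^+ (idim (rs i)).+1 = 0) ->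
  forall x y, k x -> nil_radical br (br x y).
Proof.
move=> kid knil x y kx; apply: Hrs => i.
apply: (nil_ideal_irho (lspan_subspace _) (ideal_brackets kid)).
  by move=> z /knil.
by apply: lspan_in; exists x, y.
Qed.

(* Cartan's criterion: for [x] a sum of brackets [k, y], the traces of [rho x] times
   its conjugate part add up to combinations of [tform k y'] with [y'] in [lieL]. *)
Lemma lieL_perp_commute x y : lieL x /\ perp x -> nil_radical br (br x y).
Proof.
apply: (bracket_ideal_radical (k := fun x => lieL x /\ perp x)) => {x y}.
  by move=> x y [Ly py]; split; [exact: lieL_ideal|exact: perp_ideal].
move=> x Jx.
pose S i := projT1 (cid (conj_part (irho (rs i) x))).
have HS i := projT2 (cid (conj_part (irho (rs i) x))).
pose T z := \sum_i \tr (irho (rs i) z *m S i).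
have Tlin : linmap (T : g -> C^o).
  move=> a u v; rewrite -[a *: (T u : C^o)]/(a * T u) /T mulr_sumr -big_split; apply: eq_bigr => i _ /=.
  by rewrite irho_lin mulmxDl -scalemxAl mxtraceD mxtraceZ.
have Tx : T x = 0.
  apply: (lspan_sub (P := fun z => T z = 0)) Jx; first exact: (subspace_ker Tlin).
  move=> _ [k [y [[Lk pk] ->]]].
  have [s [w [wg ->]]] := geig_decomp_fd y (brr x).
  rewrite (linmap_sum (brr k)) (linmap_sum Tlin); apply: big1 => c _.
  rewrite [LHS](_ : _ = - (c^* * tform k (w c))); last first.
    rewrite mulr_sumr -sumrN; apply: eq_bigr => i _.
    have [_ _ /(_ c _ _ (irho_geig (rs i) (wg c))) e] := HS i.
    rewrite -mxtraceZ scalemxAr -e irho_br mulmxBl mulmxBr !mxtraceB opprB !mulmxA.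
    by rewrite -[in X in _ - X]mulmxA [X in _ - X]mxtrace_mulC.
  have [->|c0] := eqVneq c 0; first by rewrite rmorph0 mul0r oppr0.
  by rewrite pk ?mulr0 ?oppr0 //; apply: eigvec_lieL; exists x, c, (\dim {:g}).
move=> i; have [_ Hi _] := HS i; apply: Hi; apply: (psumr_eq0P _ Tx) => // j _.
by have [] := HS j.
Qed.

(** By [lieL_perp_commute] and Schur's lemma [x] acts by scalars, and these have trace 0 because [x]
    is a sum of brackets. *)
Lemma lieL_perp_radical x : lieL x -> perp x -> nil_radical br x.
Proof.
move=> Lx px; apply: Hrs => i.
have [c e] : exists c, irho (rs i) x = c%:M.
  apply: irr_schur (iirrP (rs i)) _ => y; apply/eqP; rewrite -subr_eq0 -irho_br.
  by apply/eqP/(proj2 (nil_radicalP _)); apply: lieL_perp_commute.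
exact: irho_scalar_brackets (lieL_brackets Lx) e.
Qed.

(** For [x] in the span of the brackets with [perp], iterating [br x] lands in [lieL] and in [perp],
    hence in the radical, so commutation with X = rho x is nilpotent on the image. The conjugate
    part S of X then commutes with the representation and is scalar; tr(X S) is a multiple of tr X =
    0, and X is nilpotent. *)
Lemma perp_commute x y : perp x -> nil_radical br (br x y).
Proof.
move: x y; apply: bracket_ideal_radical => [x y|x Jx i]; first exact: perp_ideal.
have bx : brackets x by apply: lspan_mono Jx => z [u [v [_ ->]]]; exists u, v.
have px : perp x.
  apply: lspan_sub perp_subspace _ _ Jx => _ [u [v [pu ->]]].
  by rewrite (br_anti Hbr); apply/(subspaceN perp_subspace)/perp_ideal.
have adx y : geig (adX (irho (rs i) x)) 0 lieN (irho (rs i) y).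
  rewrite /geig -irho_gshift; set w := iter _ _ y.
  have we : w = iter lieN (br x) y.
    by apply: eq_iter => z; rewrite /gshift scale0r subr0.
  apply: (proj2 (nil_radicalP w)); rewrite we; apply: lieL_perp_radical.
    by apply: lspan_in; exists x, y.
  rewrite iterS (br_anti Hbr).
  by apply/(subspaceN perp_subspace)/perp_ideal.
have [S [_ Xnil SY]] := conj_part (irho (rs i) x); apply: Xnil.
have [c ->] : exists c, S = c%:M.
  apply: irr_schur (iirrP (rs i)) _ => y; apply/eqP; rewrite -subr_eq0.
  by rewrite (SY 0 lieN) // rmorph0 scale0r.
by rewrite mul_mx_scalar mxtraceZ irho_trace_brackets // mulr0.
Qed.

End TraceForm.

(** The form may degenerate on [lieL], so orthogonal projection is not automatic. A kernel vector of
    the Gram matrix [G] gives an element of [lieL] orthogonal to [lieL]; it lies in the radical,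
    acts by 0 and is orthogonal to everything, which makes the linear system for the projection
    solvable. *)
Theorem reductive_split : exists q : g -> Prop,
  [/\ is_subspace q, forall x y, q x -> nil_radical br (br x y) &
   forall x, exists l y, [/\ lieL l, q y & x = l + y]].
Proof.
have [n [rs Hrs]] := finite_irreps; exists (perp rs); split.
- exact: perp_subspace.
- move=> x y; exact: perp_commute.
move=> x; have [U HU] := subspace_vspace (lspan_subspace (fun y => exists x v, y = iter lieN (br x) v)).
pose d := \dim U; pose e (j : 'I_d) := (vbasis U)`_j.
have Le j : lieL (e j) by apply/HU/vbasis_mem/mem_nth; rewrite size_tuple.
pose psi x : 'rV_d := \row_j tform rs x (e j).
pose G := \matrix_(j < d, k < d) tform rs (e j) (e k).
have tsum y (c : 'I_d -> C) : tform rs y (\sum_j c j *: e j) = \sum_j c j * tform rs y (e j).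
  have tl : linmap (tform rs y : g -> C^o) by move=> a u v; exact: tform_lin.
  by rewrite (linmap_sum tl); apply: eq_bigr => j _; exact: (linmapZ tl).
have /submxP [D De] : (psi x <= G)%MS.
  rewrite submxE; apply/eqP/rowP => k; rewrite !mxE.
  pose l := \sum_j cokermx G j k *: e j.
  have Ll : lieL l.
    apply: (subspace_sum (lspan_subspace _)) => j _.
    by apply: (subspaceZ (lspan_subspace _)); exact: Le.
  have pl : perp rs l.
    move=> z /HU zU; rewrite (coord_vbasis zU) tsum; apply: big1 => j _.
    rewrite tformC tsum; have /(congr1 (fun M : 'M[C]_d => M j k)) := mulmx_coker G.
    rewrite !mxE => E; rewrite -[RHS](mulr0 (coord (vbasis U) j z)) -[in RHS]E.
    by congr (_ * _); apply: eq_bigr => i _; rewrite !mxE mulrC.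
  have nl : nil_radical br l by apply: (lieL_perp_radical Hrs).
  have : tform rs x l = 0 by rewrite tformC; apply: big1 => i _; rewrite (proj2 (nil_radicalP l)) // mul0mx mxtrace0.
  by rewrite tsum => E; rewrite -[RHS]E; apply: eq_bigr => j _; rewrite !mxE mulrC.
pose l := \sum_j D 0 j *: e j.
have Ll : lieL l.
  apply: (subspace_sum (lspan_subspace _)) => j _.
  by apply: (subspaceZ (lspan_subspace _)); exact: Le.
exists l, (x - l); split=> //; last by rewrite addrC subrK.
have pe k : tform rs (x - l) (e k) = 0.
  have tl : linmap (tform rs (e k) : g -> C^o) by move=> a u v; exact: tform_lin.
  rewrite tformC (linmapB tl) tsum tformC; have /rowP /(_ k) := De; rewrite !mxE => ->.
  apply/eqP; rewrite subr_eq0; apply/eqP; apply: eq_bigr => j _.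
  by rewrite !mxE tformC.
by move=> z /HU zU; rewrite (coord_vbasis zU) tsum big1 // => j _; rewrite pe mulr0.
Qed.

End Split.

(** * Polynomial identities imply nilpotency *)

Lemma infinite_injective (T : choiceType) (D : set T) n : infinite_set D ->
  exists l : 'I_n -> T, injective l /\ forall i, D (l i).
Proof.
move=> Di; have [x0 _] := infinite_setN0 Di.
have [B BD nB] := infinite_set_fset n Di.
have szB (i : 'I_n) : (i < size (finmap.enum_fset B))%N by apply: leq_trans nB.
exists (fun i => nth x0 (finmap.enum_fset B) i); split=> [i j /eqP|i].
  by rewrite nth_uniq ?finmap.fset_uniq // => /eqP /val_inj.
by apply: BD; rewrite /mkset /=; apply: mem_nth.
Qed.

Section Algebraic.
Context (C : numClosedFieldType) (A : algType C).
Variable B0 : A -> Prop.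
Hypothesis B0sub : is_subspace B0.
Hypothesis B0mul : forall x y, B0 x -> B0 y -> B0 (x * y).
Hypothesis B01 : B0 1.
Hypothesis B0count : exists u : nat -> A,
  forall x, B0 x -> exists N (c : 'I_N -> C), x = \sum_i c i *: u i.

(** Countably many spans of initial segments of [u] cover [B0], so one of them, of dimension at most
    [N], contains [r c] for infinitely many [c]; any [N.+1] of these are dependent. *)
Lemma uncountable_dep (D : set C) (r : C -> A) : ~ countable D ->
  (forall c, D c -> B0 (r c)) ->
  exists n (l : 'I_n -> C) (a : 'I_n -> C), [/\ injective l, forall i, D (l i),
    exists i, a i != 0 & \sum_i a i *: r (l i) = 0].
Proof.
move=> Dnc rB; have [u Hu] := B0count.
pose F N : set C := fun c => D c /\ exists a : 'I_N -> C, r c = \sum_i a i *: u i.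
have [N FN] : exists N, infinite_set (F N).
  apply: contrapT => /forallNP H; apply: Dnc.
  apply: (sub_countable (B := \bigcup_(N in setT) F N)).
    apply: subset_card_le => c Dc; have [N [a e]] := Hu _ (rB c Dc).
    by exists N => //; split=> //; exists a.
  apply: bigcup_countable => [|N _]; first exact: countableP.
  by apply: finite_set_countable; apply: contrapT; exact: H.
have [l [linj lF]] := infinite_injective N.+1 FN.
have /choice [m Hm] : forall i : 'I_N.+1, exists a : 'I_N -> C, r (l i) = \sum_j a j *: u j.
  by move=> i; have [_] := lF i.
pose M := \matrix_(i, j) m i j.
have kM : kermx M != 0.
  by rewrite kermx_eq0 /row_free; apply/eqP => e; have := rank_leq_col M; rewrite e ltnn.
have [i ri] : exists i, row i (kermx M) != 0.
  apply: contrapT => /forallNP H; move/negP: kM; apply; apply/eqP/row_matrixP => i.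
  by rewrite row0; apply/eqP/negPn/negP/H.
exists N.+1, l, (fun j => kermx M i j); split=> //.
- by move=> j; have [] := lF j.
- apply: contrapT => /forallNP H; move/negP: ri; apply; apply/eqP/rowP => j.
  by rewrite [LHS]mxE [RHS]mxE; apply/eqP/negPn/negP/H.
- under eq_bigr do rewrite Hm scaler_sumr.
  rewrite exchange_big /= big1 // => k _.
  under eq_bigr do rewrite scalerA.
  rewrite -scaler_suml; have := congr1 (fun X : 'M[C]_(N.+1, N) => X i k) (mulmx_ker M).
  rewrite [LHS]mxE [RHS]mxE => e; rewrite -[RHS](scale0r (u k)) -[in RHS]e; congr (_ *: _).
  by apply: eq_bigr => j _; rewrite [M j k]mxE.
Qed.

Definition ev (x : A) (p : {poly C}) : A := horner_alg x p.

Lemma ev_lin x : linmap (ev x).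
Proof. by move=> a p q; rewrite /ev rmorphD -mul_polyC rmorphM /= horner_algC mulr_algl. Qed.

Lemma ev_comm x p : ev x p * x = x * ev x p.
Proof. by rewrite -{2 3}(horner_algX x) -!rmorphM mulrC. Qed.

(** Modulo [J] the [r c] are left inverses of [b - c]. A dependence among them, multiplied by the
    product of the [b - c] involved, becomes a polynomial relation for [b], nonzero because its
    value at one node is. It is applied with [J] a maximal left ideal and with [J] zero. *)
Lemma resolvent_algebraic (D : set C) (J : A -> Prop) b (r : C -> A) :
  ~ countable D -> is_subspace J ->
  (forall y, J y -> J (y * b)) -> (forall c, D c -> B0 (r c)) ->
  (forall c, D c -> J (r c * (b - c%:A) - 1)) ->
  exists q : {poly C}, q != 0 /\ J (ev b q).
Proof.
move=> Dnc sJ Jb rB rJ.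
have Jev y p : J y -> J (y * ev b p).
  move=> Jy; elim/poly_ind: p => [|p c IH].
    by rewrite /ev rmorph0 mulr0; apply: subspace0.
  rewrite /ev rmorphD rmorphM /= horner_algX horner_algC mulrDr mulrA.
  rewrite -scalerAr mulr1; apply: (subspaceD sJ); [exact: Jb|exact: (subspaceZ sJ)].
have [n [l [a [linj lD [i0 ai0] a0]]]] := uncountable_dep Dnc rB.
pose Q i := \prod_(j < n | j != i) ('X - (l j)%:P).
exists (\sum_i a i *: Q i); split.
  apply/negP => /eqP /(congr1 (fun p => p.[l i0])).
  rewrite horner0 horner_sum (bigD1 i0) //= big1 => [|i ii].
    rewrite addr0 hornerZ /Q horner_prod => /eqP; rewrite mulf_eq0 (negPf ai0) /=.
    apply/negP/prodf_neq0 => j ji.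
    by rewrite hornerXsubC subr_eq0; apply: contra ji => /eqP /linj ->.
  rewrite hornerZ /Q horner_prod (bigD1 i0) 1?eq_sym //= hornerXsubC subrr mul0r.
  by rewrite mulr0.
pose P := \prod_(j < n) ('X - (l j)%:P).
have e0 : \sum_i a i *: (r (l i) * ev b P) = 0.
  by under eq_bigr do rewrite scalerAl; rewrite -mulr_suml a0 mul0r.
rewrite -[X in J X]opprK -[X in J (- X)]add0r -e0.
apply: (subspaceN sJ); rewrite (linmap_sum (ev_lin b)) -sumrB.
apply: (subspace_sum sJ) => i _.
rewrite (linmapZ (ev_lin b)) -scalerBr; apply: (subspaceZ sJ).
rewrite /ev /P (bigD1 i) //= rmorphM rmorphB /= horner_algX horner_algC mulrA.
rewrite -[X in J (_ - X)]mul1r -mulrBl; apply: Jev; exact: rJ.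
Qed.

Definition left_ideal (J : A -> Prop) :=
  [/\ is_subspace J, forall x, J x -> B0 x & forall b x, B0 b -> J x -> J (b * x)].

Lemma maximal_left_ideal (J0 : A -> Prop) : left_ideal J0 -> ~ J0 1 ->
  exists L : A -> Prop, [/\ left_ideal L, ~ L 1, forall x, J0 x -> L x &
    forall a, B0 a -> ~ L a -> exists2 b, B0 b & L (b * a - 1)].
Proof.
(* The conditions are imposed on [X] together with [J0], so that the empty chain, whose union is
   empty, also meets them. *)
move=> lJ0 J01; pose U (X : set A) : set A := fun x => X x \/ J0 x.
pose P : set (set A) := fun X => left_ideal (U X) /\ ~ U X 1.
have [|X [[LX X1] Xmax]] := @Zorn_bigcup A P.
  move=> F FP Ftot; split.
    split.
    - split; first by right; have [[]] := lJ0.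
      move=> a u v [[X FX Xu]|Ju] [[Y FY Yv]|Jv].
      + have [XY|YX] := Ftot _ _ FX FY.
          have [[[_ LY] _ _] _] := FP _ FY.
          by have [H|H] := LY a u v (or_introl (XY _ Xu)) (or_introl Yv); [left; exists Y|right].
        have [[[_ LX] _ _] _] := FP _ FX.
        by have [H|H] := LX a u v (or_introl Xu) (or_introl (YX _ Yv)); [left; exists X|right].
      + have [[[_ LX] _ _] _] := FP _ FX.
        by have [H|H] := LX a u v (or_introl Xu) (or_intror Jv); [left; exists X|right].
      + have [[[_ LY] _ _] _] := FP _ FY.
        by have [H|H] := LY a u v (or_intror Ju) (or_introl Yv); [left; exists Y|right].
      + by right; have [[_ H]] := lJ0; move=> _ _; apply: H.
    - move=> x [[X FX Xx]|Jx]; last by have [_ H _] := lJ0; apply: H.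
      by have [[_ H _] _] := FP _ FX; apply: H; left.
    - move=> b x Bb [[X FX Xx]|Jx]; last by right; have [_ _ H] := lJ0; apply: H.
      have [[_ _ H] _] := FP _ FX.
      by have [H'|H'] := H b x Bb (or_introl Xx); [left; exists X|right].
  move=> [[X FX X1]|//]; have [_] := FP _ FX; apply; by left.
exists (U X); split=> // [x Jx|a Ba nXa]; first by right.
apply: contrapT => nb.
have [XD XB XM] := LX.
pose Y : set A := fun x => exists b l, [/\ B0 b, U X l & x = b * a + l].
have XY x : U X x -> Y x.
  move=> Xx; exists 0, x; split=> //; first exact: subspace0.
  by rewrite mul0r add0r.
suff PY : P Y.
  apply: (Xmax Y) PY; split=> [x Xx|]; first by apply: XY; left.
  move=> /(_ a) H; apply: nXa; left; apply: H.
  exists 1, 0; split=> //; first by case: XD.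
  by rewrite mul1r addr0.
have UY x : U Y x <-> Y x.
  by split=> [[//|Jx]|Yx]; [apply: XY; right|left].
split; last first.
  move=> /UY [b [l [Bb Xl e]]]; apply: nb; exists b => //.
  rewrite e opprD addrA subrr add0r.
  exact: (subspaceN XD).
split.
- split; first by apply/UY/XY; case: XD.
  move=> k u v /UY [b [l [Bb Xl ->]]] /UY [c [m [Bc Xm ->]]]; apply/UY.
  exists (k *: b + c), (k *: l + m); split.
  + by case: B0sub => _; apply.
  + by case: XD => _; apply.
  + by rewrite mulrDl -scalerAl scalerDr addrACA.
- move=> x /UY [b [l [Bb Xl ->]]]; apply: (subspaceD B0sub); first exact: B0mul.
  exact: XB.
- move=> d x Bd /UY [b [l [Bb Xl ->]]]; apply/UY; exists (d * b), (d * l); split.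
  + exact: B0mul.
  + exact: XM.
  + by rewrite mulrDr mulrA.
Qed.

(** * Simple modules of an algebra of countable dimension *)

Section SimpleModule.
Variable L : A -> Prop.
Hypothesis Lid : left_ideal L.
Hypothesis L1 : ~ L 1.
Hypothesis Lmax : forall a, B0 a -> ~ L a -> exists2 b, B0 b & L (b * a - 1).
Hypothesis Cnc : ~ countable (setT : set C).

Let Lsub : is_subspace L. Proof. by case: Lid. Qed.
Let LB x : L x -> B0 x. Proof. by case: Lid => _ H _; apply: H. Qed.
Let Lmul b x : B0 b -> L x -> L (b * x). Proof. by case: Lid => _ _ H; apply: H. Qed.

(* Right multiplication by [b] is an endomorphism of the simple module B0/L, and
   Schur's lemma holds since B0 has countable dimension and [C] is uncountable. *)
Lemma simple_schur b : B0 b -> (forall y, L y -> L (y * b)) -> exists c, L (b - c%:A).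
Proof.
move=> Bb Lb; apply: contrapT => /forallNP nc.
have Bc c : B0 (b - c%:A) by apply: (subspaceB B0sub) => //; exact: (subspaceZ B0sub).
have /choice [r Hr] : forall c, exists r, B0 r /\ L (r * (b - c%:A) - 1).
  by move=> c; have [r Br Lr] := Lmax (Bc c) (@nc c); exists r.
have Lbc c y : L y -> L (y * (b - c%:A)).
  move=> Ly; rewrite mulrBr -scalerAr mulr1; apply: (subspaceB Lsub); first exact: Lb.
  exact: (subspaceZ Lsub).
have cancel c y : B0 y -> L (y * (b - c%:A)) -> L y.
  move=> By Lyb; apply: contrapT => /(Lmax By) [d Bd Ld]; apply: (@nc c).
  rewrite -[X in L X]mul1r -[X in L (X * _)](subKr (d * y)) mulrBl -mulrA.
  by apply: (subspaceB Lsub); [exact: Lmul|exact: Lbc].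
have [||q [q0]] := @resolvent_algebraic setT L b r Cnc Lsub Lb.
- by move=> c _; have [] := Hr c.
- by move=> c _; have [] := Hr c.
have [s ->] := closed_field_poly_normal q.
rewrite (linmapZ (ev_lin b)) => Lq.
have {Lq} : L (ev b (\prod_(z <- s) ('X - z%:P))).
  rewrite -[X in L X]scale1r -(mulVf (x := lead_coef q)) ?lead_coef_eq0 // -scalerA.
  exact: (subspaceZ Lsub).
elim/last_ind: s => [|s z IH]; first by rewrite big_nil /ev rmorph1.
rewrite big_rcons /= /ev rmorphM rmorphB /= horner_algX horner_algC.
move=> /cancel H; apply/IH/H => {H}.
elim/poly_ind: (\prod_(_ <- s) _) => [|p c IHp]; first by rewrite rmorph0; exact: subspace0.
 rewrite rmorphD rmorphM /= horner_algX horner_algC.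
by apply: (subspaceD B0sub); [exact: B0mul|exact: (subspaceZ B0sub)].
Qed.

(* Jacobson density for B0/L. *)
Lemma density n (e : 'I_n -> A) y : (forall i, B0 (e i)) -> B0 y ->
  (forall a, B0 a -> (forall i, L (a * e i)) -> L (a * y)) ->
  exists c : 'I_n -> C, L (y - \sum_i c i *: e i).
Proof.
elim: n e y => [|n IH] e y Be By H.
  exists (fun=> 0); rewrite big_ord0 subr0 -[y]mul1r; apply: H => // -[] //.
pose e' i := e (lift ord0 i); pose f := e ord0.
pose I a := B0 a /\ forall i, L (a * e' i).
have ext a : I a -> L (a * f) -> L (a * y).
  move=> [Ba He'] Lf; apply: H => // i.
  by case: (unliftP ord0 i) => [j|] ->; [exact: He'|exact: Lf].
have [HI|] := pselect (forall a, I a -> L (a * f)).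
  have [|||c Lc] := IH e' y.
  - by move=> i; apply: Be.
  - exact: By.
  - by move=> a Ba La; apply: ext; [split|apply: HI; split].
  exists (fun i => if unlift ord0 i is Some j then c j else 0).
  rewrite big_ord_recl unlift_none scale0r add0r.
  by under eq_bigr do rewrite liftK.
move=> /existsNP [a1 /not_implyP [[Ba1 Ia1] nLa1]].
have Bf : B0 f by apply: Be.
have [b1 Bb1 Lb1] := Lmax (B0mul Ba1 Bf) nLa1.
(* Modulo [L], [a0] kills [e'] and sends [f] to 1. The map taking [a * f] to [a * y], for [a]
   killing [e'], is thus right multiplication by [b], a scalar by [simple_schur]. *)
pose a0 := b1 * a1; pose b := a0 * y.
have Ba0 : B0 a0 by apply: B0mul.
have Ia0 i : L (a0 * e' i) by rewrite /a0 -mulrA; apply: Lmul.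
have La0f : L (a0 * f - 1) by rewrite /a0 -mulrA.
have Bb : B0 b by apply: B0mul.
have [l Ll|c Lc] := simple_schur Bb.
  rewrite /b mulrA; apply: ext.
    by split=> [|i]; [apply: B0mul => //; exact: LB|rewrite -mulrA; apply: Lmul => //; exact: LB].
  rewrite -mulrA -[a0 * f](subrK 1) mulrDr mulr1; apply: (subspaceD Lsub) => //.
  by apply: Lmul => //; apply: LB.
have [|||c' Lc'] := IH e' (y - c *: f).
- by move=> i; apply: Be.
- by apply: (subspaceB B0sub) => //; apply: (subspaceZ B0sub).
- move=> a Ba La; have Baf : B0 (a * f) by apply: B0mul.
  (* The element [a * f * a0] kills [e'] and agrees with [a] on [f], so the difference annihilates
     all of [e]. *)
  have : L ((a - a * f * a0) * y).
    apply: ext.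
      split=> [|i]; first by apply: (subspaceB B0sub) => //; apply: B0mul.
      by rewrite mulrBl -(mulrA _ a0); apply: (subspaceB Lsub) => //; apply: Lmul.
    rewrite mulrBl -(mulrA _ a0) -[X in L (X - _)]mulr1 -mulrBr -[X in L (_ * X)]opprB mulrN.
    by apply/(subspaceN Lsub)/Lmul.
  rewrite mulrBl -(mulrA _ a0) -/b => H1.
  have H2 : L (a * f * (b - c%:A)) by apply: Lmul.
  have := subspaceD Lsub H1 H2.
  rewrite [a * f * (_ - _)]mulrBr addrA subrK -scalerAr mulr1 mulrBr -scalerAr.
  by [].
exists (fun i => if unlift ord0 i is Some j then c' j else c).
rewrite big_ord_recl unlift_none opprD addrA.
by under eq_bigr do rewrite liftK.
Qed.

Definition indep n (e : 'I_n -> A) :=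
  (forall i, B0 (e i)) /\ forall c : 'I_n -> C, L (\sum_i c i *: e i) -> forall i, c i = 0.

Lemma matrix_unit n (e : 'I_n -> A) (t j : 'I_n) : indep e ->
  exists E, B0 E /\ forall i, L (E * e i - (i == j)%:R *: e t).
Proof.
case: n e t j => [|n] e t j [Be ie]; first by case: j.
have [a [Ba La nLa]] : exists a, [/\ B0 a, forall i, L (a * e (lift j i)) & ~ L (a * e j)].
  apply: contrapT => /forallNP H.
  have [|||c Lc] := @density n (fun i => e (lift j i)) (e j).
  - by move=> i; apply: Be.
  - exact: Be.
  - by move=> a Ba La; apply: contrapT => nL; apply: (H a).
  have := ie (fun i => if unlift j i is Some k then - c k else 1) _ j.
  rewrite unlift_none => /(_ _)/eqP; rewrite oner_eq0 => H1.
  suff : false by []. apply: H1.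
  rewrite (bigD1_ord j) //= unlift_none scale1r.
  by under eq_bigr do rewrite liftK scaleNr; rewrite sumrN.
have [b Bb Lb] := Lmax (B0mul Ba (Be j)) nLa.
exists (e t * b * a); split; first by apply: B0mul => //; apply: B0mul.
move=> i; case: (unliftP j i) => [k|] ->.
  rewrite eq_sym (negPf (neq_lift _ _)) scale0r subr0 -mulrA.
  by apply: Lmul => //; apply: B0mul.
rewrite eqxx scale1r -!mulrA -[X in L (_ - X)]mulr1 -mulrBr.
exact: Lmul.
Qed.

Section PI.
Context (k : nat) (S : seq (seq 'I_k)) (cf : seq 'I_k -> C) (w0 : seq 'I_k).
Hypothesis Suniq : uniq S.
Hypothesis w0S : w0 \in S.
Hypothesis cw0 : cf w0 != 0.
Hypothesis PI : forall a : 'I_k -> A, (forall i, B0 (a i)) ->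
  \sum_(w <- S) cf w *: \prod_(i <- w) a i = 0.

(* The letters act as partial shifts along the word [w0], so that among the words of
   length [size w0] only [w0] takes the last vector to the first one. *)
Lemma pi_indep (e : 'I_(size w0).+1 -> A) : ~ indep e.
Proof.
move=> ie; have [Be e0] := ie; pose l := size w0.
have /choice [E HE] : forall tj : 'I_l.+1 * 'I_l.+1, exists E,
    B0 E /\ forall i, L (E * e i - (i == tj.2)%:R *: e tj.1).
  by move=> [t j]; apply: matrix_unit.
pose en s := e (inord s).
(* The letter [i] takes vector [j.+1] to vector [j] at each position [j] where [w0] carries [i];
   words act from their right end. *)
pose a i := \sum_(j < l | tnth (in_tuple w0) j == i) E (inord j, inord j.+1).
have Ba i : B0 (a i) by apply: (subspace_sum B0sub) => j _; have [] := HE (inord j, inord j.+1).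
have step i s : (s <= l)%N ->
    L (a i * en s - (if suffix [:: i] (take s w0) then en s.-1 else 0)).
  move=> sl.
  have -> : (if suffix [:: i] (take s w0) then en s.-1 else 0) =
      \sum_(j < l | tnth (in_tuple w0) j == i) (s == j.+1)%:R *: en j.
    case: s sl => [|s] sl.
      rewrite take0 big1 => [|j _]; first by case: suffix (suffixs0 [:: i]) => //.
      by rewrite scale0r.
    rewrite (take_nth i) // -[[:: i]]/(rcons [::] i) suffix_rcons suffix0s andbT.
    case: eqVneq => [e1|n1].
      rewrite (bigD1 (Ordinal sl)) /=; last by rewrite (tnth_nth i) /= -e1.
      rewrite eqxx scale1r big1 ?addr0 // => j /andP[_ nj].
      rewrite eqSS; case: eqVneq => [sj|_]; last by rewrite scale0r.
      by move: nj; rewrite -val_eqE /= sj eqxx.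
    rewrite big1 // => j /eqP ij; rewrite eqSS; case: eqVneq => [sj|_]; last by rewrite scale0r.
    by have := tnth_nth i (in_tuple w0) j; rewrite ij /= -sj => e1; rewrite -e1 eqxx in n1.
  rewrite mulr_suml -sumrB; apply: (subspace_sum Lsub) => j _.
  have [_ /(_ (inord s))] := HE (inord j, inord j.+1); rewrite -/(en s) -/(en j).
  by rewrite -val_eqE /= !inordK // ltnS.
have word w s : (s <= l)%N ->
    L (\prod_(i <- w) a i * en s - (if suffix w (take s w0) then en (s - size w)%N else 0)).
  elim/last_ind: w s => [|w i IH] s sl.
    by rewrite big_nil mul1r suffix0s subn0 subrr; apply: subspace0.
  have Bw : B0 (\prod_(j <- w) a j).
    by elim: w {IH} => [|j w IH]; rewrite ?big_nil // big_cons; apply: B0mul.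
  rewrite big_rcons /= -mulrA.
  set v := if suffix [:: i] (take s w0) then en s.-1 else 0.
  rewrite -[a i * en s](subrK v) mulrDr -addrA; apply: (subspaceD Lsub).
    by apply: Lmul => //; apply: step.
  rewrite /v size_rcons; case: s sl @v => [|s] sl v.
    have -> : suffix (rcons w i) (take 0 w0) = false by case: (w) => [|? ?]; rewrite take0 suffixs0.
    by rewrite take0 suffixs0 /= mulr0 subr0; apply: subspace0.
  rewrite (take_nth i) // -[[:: i]]/(rcons [::] i) !suffix_rcons suffix0s andbT.
  case: eqVneq => [_|_] /=; last by rewrite mulr0 subr0; exact: subspace0.
  by rewrite subSS; apply: IH; apply: ltnW.
have LS : L (\sum_(w <- S) cf w *: (if suffix w w0 then en (l - size w)%N else 0)).
  have H : L (\sum_(w <- S) cf w *: (\prod_(i <- w) a i * en l -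
       (if suffix w (take l w0) then en (l - size w)%N else 0))).
    by apply: (subspace_sum Lsub) => w _; apply: (subspaceZ Lsub); apply: word.
  move: H; under eq_bigr do rewrite scalerBr.
  rewrite sumrB; under eq_bigr do rewrite scalerAl.
  rewrite -mulr_suml PI // mul0r sub0r take_size => /(subspaceN Lsub).
  by rewrite opprK.
have {}LS : L (\sum_(t < l.+1) (\sum_(w <- S) cf w * (suffix w w0 && (l - size w == t)%N)%:R) *: e t).
  move: LS; congr L; under [RHS]eq_bigr do rewrite scaler_suml.
  rewrite exchange_big /=; apply: eq_bigr => w _.
  under eq_bigr do rewrite -scalerA.
  rewrite -scaler_sumr; congr (_ *: _); case: (suffix w w0) => /=.
    rewrite (bigD1 (inord (l - size w))) //= inordK ?ltnS ?leq_subr // eqxx scale1r.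
    rewrite big1 ?addr0 // => t tl; case: eqVneq => [et|_]; last by rewrite scale0r.
    by rewrite et inord_val eqxx in tl.
  by rewrite big1 // => t _; rewrite scale0r.
(* At the first vector only suffixes of [w0] of full length contribute, that is, [w0] alone. *)
have := e0 _ LS ord0; rewrite (bigD1_seq w0) //= suffix_refl subnn eqxx mulr1 big1_seq.
  by rewrite addr0 => /eqP; rewrite (negPf cw0).
move=> w /andP[nw wS]; case: (boolP (suffix w w0)) => [sw|_]; last by rewrite mulr0.
rewrite /= subn_eq0; case: leqP => [lw|_]; last by rewrite mulr0.
move: sw nw => /suffixP [p ep]; have := congr1 size ep; rewrite size_cat => es.
have p0 : size p = 0%N by move: lw; rewrite /l es; case: (size p) => // m; rewrite addSn ltnNge leq_addl.
by move: ep; rewrite (size0nil p0) /= => ->; rewrite eqxx.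
Qed.

Lemma pi_basis : exists n (e : 'I_n -> A), indep e /\
  forall y, B0 y -> exists c : 'I_n -> C, L (y - \sum_i c i *: e i).
Proof.
pose P n := `[< exists e : 'I_n -> A, indep e >].
have P0 : exists n, P n.
  by exists 0%N; apply/asboolP; exists (fun=> 0); split=> [[]|c _ []].
have Ple n : P n -> (n <= size w0)%N.
  move=> /asboolP [e [Be ie]]; rewrite leqNgt; apply/negP => nw.
  apply: (@pi_indep (fun i => e (widen_ord nw i))); split=> [i|c Lc i]; first exact: Be.
  pose c' j := if insub j is Some i then c i else 0.
  pose e' j := if insub j is Some i then e i else 0.
  have ee j : e' (val j) = e j by rewrite /e' valK.
  have ce j : c' (val j) = c j by rewrite /c' valK.
  rewrite -ce; apply: (ie (c' \o val)  _ (widen_ord nw i)); move: Lc; congr L.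
  under eq_bigr do rewrite -ce -ee.
  rewrite (big_ord_widen n (fun j => c' j *: e' j)) // big_mkcond /=.
  apply: eq_bigr => j _; rewrite ee; case: ltnP => // lj.
  by rewrite /c' insubF ?scale0r // ltnNge lj.
case: (ex_maxnP P0 Ple) => n /asboolP [e [Be ie]] maxn.
exists n, e; split=> // y By; apply: contrapT => /forallNP Hy.
have /maxn : P n.+1; last by rewrite ltnn.
apply/asboolP; exists (fun i => if unlift ord0 i is Some j then e j else y).
split=> [i|c]; first by case: unlift.
rewrite big_ord_recl unlift_none; under eq_bigr do rewrite liftK.
move=> Lc; have c0 : c ord0 = 0.
  apply/eqP/negPn/negP => c0; apply: (Hy (fun i => - (c ord0)^-1 * c (lift ord0 i))).
  move: (subspaceZ Lsub (c ord0)^-1 Lc); rewrite scalerDr scalerA mulVf // scale1r.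
  congr L; congr (_ + _); rewrite scaler_sumr -sumrN; apply: eq_bigr => i _.
  by rewrite scalerA mulNr scaleNr opprK.
move: Lc; rewrite c0 scale0r add0r => /ie H i.
by case: (unliftP ord0 i) => [j|] ->; [exact: H|].
Qed.

Section Rep.
Context (g : vectType C) (br : g -> g -> g) (phi : g -> A).
Hypothesis phi_lin : linmap phi.
Hypothesis phi_br : forall x y, phi (br x y) = phi x * phi y - phi y * phi x.
Hypothesis Bphi : forall x, B0 (phi x).
Hypothesis Bgen : forall x, B0 x -> lspan (fun w => exists n, is_word (img phi (fun=> True)) n w) x.

(** In a basis of B0/L, left multiplication by [phi x] becomes a matrix [rho x], and [rho] is an
    irreducible representation of [g]. So [eta] acts by 0, in particular on the class of 1. *)
Lemma nil_radical_simple eta : nil_radical br eta -> L (phi eta).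
Proof.
move=> neta; have [n [e [[Be ie] espan]]] := pi_basis.
pose el (v : 'rV[C]_n) := \sum_j v 0 j *: e j.
have ellin : linmap el.
  move=> c u v; rewrite /el scaler_sumr -big_split; apply: eq_bigr => j _ /=.
  by rewrite !mxE scalerDl scalerA.
have elB v : B0 (el v) by apply: (subspace_sum B0sub) => j _; apply: (subspaceZ B0sub).
have elinj u v : L (el u - el v) -> u = v.
  rewrite -(linmapB ellin) => /ie H; apply/eqP; rewrite -subr_eq0; apply/eqP/rowP => j.
  by rewrite H mxE.
have eldelta j : el (delta_mx 0 j) = e j.
  rewrite /el (bigD1 j) //= mxE !eqxx scale1r big1 ?addr0 // => i kj.
  by rewrite mxE (negPf kj) andbF scale0r.
have elspan y : B0 y -> exists v, L (y - el v).
  move=> /espan [c Lc]; exists (\row_j c j); move: Lc; congr L; congr (_ - _).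
  by apply: eq_bigr => j _; rewrite mxE.
have /choice [R HR] : forall xj : g * 'I_n, exists v, L (phi xj.1 * e xj.2 - el v).
  by move=> [x j]; apply: elspan; apply: B0mul.
pose rho x : 'M[C]_n := (\matrix_j R (x, j))^T.
have rhoP x v : L (phi x * el v - el (v *m (rho x)^T)).
  rewrite trmxK mulmx_sum_row (linmap_sum ellin) mulr_sumr -sumrB.
  apply: (subspace_sum Lsub) => j _; rewrite (linmapZ ellin) -scalerAr -scalerBr.
  by apply: (subspaceZ Lsub); rewrite rowK; apply: (HR (x, j)).
have rhoU x (M : 'M[C]_n) : (forall v, L (phi x * el v - el (v *m M^T))) -> rho x = M.
  move=> H; apply/trmx_inj/row_matrixP => j; rewrite !rowE; apply: elinj.
  move: (subspaceB Lsub (H (delta_mx 0 j)) (rhoP x (delta_mx 0 j))); congr L.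
  by rewrite opprB addrC addrA subrK.
have rep : lie_rep br rho.
  split=> [a x y|x y]; apply: rhoU => v.
    rewrite phi_lin linearD linearZ /= mulmxDr -scalemxAr ellin mulrDl -scalerAl opprD addrACA.
    rewrite -scalerBr; apply: (subspaceD Lsub) => //; exact: (subspaceZ Lsub).
  rewrite phi_br raddfB /= !trmx_mul mulmxBr (linmapB ellin) mulrBl opprB.
  have comp a b : L (phi a * phi b * el v - el (v *m ((rho b)^T *m (rho a)^T))).
    rewrite mulmxA; set Y := el (_ *m (rho a)^T).
    have -> : phi a * phi b * el v - Y = phi a * (phi b * el v - el (v *m (rho b)^T)) +
        (phi a * el (v *m (rho b)^T) - Y) by rewrite mulrBr mulrA addrA subrK.
    by apply: (subspaceD Lsub); [apply: Lmul => //; exact: rhoP|exact: rhoP].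
  move: (subspaceB Lsub (comp x y) (comp y x)); congr L.
  by rewrite !opprB addrACA [RHS]addrACA; congr (_ + _); rewrite addrC.
have irr : lie_rep_irreducible rho.
  split=> [|W HW].
    case: (posnP n) => // n0; exfalso; apply: L1.
    have [v] := elspan 1 B01; rewrite /el big1 ?subr0 // => j.
    by have := ltn_ord j; rewrite {2}n0.
  case: (eqVneq W 0) => [->|W0]; first by left; apply: mxrank0.
  right; apply/eqP; rewrite -[_ == _]/(row_full W) -sub1mx; apply/row_subP => j.
  have act b v : B0 b -> (v <= W)%MS -> exists2 u, (u <= W)%MS & L (b * el v - el u).
    move=> /Bgen bw vW.
    pose P b := exists2 u, (u <= W)%MS & L (b * el v - el u).
    suff : P b by [].
    apply: lspan_sub bw; first split.
    - exists 0; first exact: sub0mx.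
      by rewrite mul0r (linmap0 ellin) subrr; apply: subspace0.
    - move=> a x y [u uW Lu] [t tW Lt]; exists (a *: u + t).
        by apply: addmx_sub => //; apply: scalemx_sub.
      rewrite ellin mulrDl -scalerAl opprD addrACA -scalerBr.
      by apply: (subspaceD Lsub) => //; apply: (subspaceZ Lsub).
    move=> w [m [s [_ sP ->]]] {m}; elim: s sP => [|z s IH] sP.
      by rewrite big_nil; exists v => //; rewrite mul1r subrr; apply: subspace0.
    have [|u uW Lu] := IH; first by move=> t ts; apply: sP; rewrite inE ts orbT.
    have [|x [_ ->]] := sP z; first by rewrite inE eqxx.
    exists (u *m (rho x)^T); first by apply: submx_trans (HW x); apply: submxMr.
    rewrite big_cons -mulrA -[_ * (_ * _)](subrK (phi x * el u)) -mulrBr -addrA.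
    by apply: (subspaceD Lsub); [apply: Lmul|apply: rhoP].
  have [i Wi] : exists i, row i W != 0.
    apply: contrapT => /forallNP H; move/negP: W0; apply; apply/eqP/row_matrixP => i.
    by rewrite row0; apply/eqP/negPn/negP/H.
  have nLi : ~ L (el (row i W)).
    move=> Li; move/negP: Wi; apply; apply/eqP/elinj.
    by rewrite (linmap0 ellin) subr0.
  (* A nonzero vector of [W] is carried to the class of 1 by [b], and from there to any basis
     vector. *)
  have [b Bb Lb] := Lmax (elB _) nLi.
  have Bjb : B0 (el (row j 1%:M) * b) by apply: B0mul.
  have [u uW Lu] := act _ _ Bjb (row_sub i W).
  suff -> : row j 1%:M = u by [].
  apply: elinj; have := Lmul (elB (row j 1%:M)) Lb.
  rewrite mulrBr mulr1 mulrA => H; move: (subspaceB Lsub Lu H); congr L.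
  by rewrite opprB addrC addrA subrK.
have r0 : rho eta = 0 by apply: neta.
have [v Lv] := elspan 1 B01.
rewrite -[phi eta]mulr1 -[1 in X in L X](subrK (el v)) mulrDr.
apply: (subspaceD Lsub); first exact: Lmul.
by have := rhoP eta v; rewrite r0 trmx0 mulmx0 (linmap0 ellin) subr0.
Qed.

End Rep.

End PI.

End SimpleModule.

End Algebraic.

Theorem pi_nil_radical (C : numClosedFieldType) (A : algType C) (g : vectType C)
    (br : g -> g -> g) (phi : g -> A) (B0 := lspan (fun w => exists n, is_word (img phi (fun=> True)) n w))
    (k : nat) (S : seq (seq 'I_k)) (cf : seq 'I_k -> C) (w0 : seq 'I_k) (eta : g) :
  ~ countable (setT : set C) ->
  linmap phi ->
  (forall x y, phi (br x y) = phi x * phi y - phi y * phi x) ->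
  uniq S -> w0 \in S -> cf w0 != 0 ->
  (forall a : 'I_k -> A, (forall i, B0 (a i)) ->
    \sum_(w <- S) cf w *: \prod_(i <- w) a i = 0) ->
  nil_radical br eta -> exists m, phi eta ^+ m = 0.
Proof.
move=> Cnc phil phib Su w0S cw0 PI neta.
have B0sub : is_subspace B0 by apply: lspan_subspace.
have B0mul x y : B0 x -> B0 y -> B0 (x * y).
  apply: lspan_mul => u v [n Hu] [m Hv]; apply: lspan_in.
  by exists (n + m)%N; apply: is_word_cat.
have B01 : B0 1 by apply: lspan_in; exists 0%N; apply: is_word0.
have Bphi x : B0 (phi x) by apply: lspan_in; exists 1%N; apply: is_word1; exists x.
pose d := \dim {:g}; pose e (i : 'I_d) := phi (vbasis {:g})`_i.
have B0count : exists u : nat -> A,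
    forall x, B0 x -> exists N (c : 'I_N -> C), x = \sum_i c i *: u i.
  (* Words in the images of a basis of [g] span [B0]; [pickle] enumerates them. *)
  pose u m := if (choice.unpickle m : option (seq 'I_d)) is Some s then \prod_(i <- s) e i else 0.
  exists u => x Bx.
  pose W y := exists s : seq 'I_d, y = \prod_(i <- s) e i.
  have Wmul y z : lspan W y -> lspan W z -> lspan W (y * z).
    apply: lspan_mul => _ _ [s ->] [t ->]; apply: lspan_in.
    by exists (s ++ t); rewrite big_cat.
  have {}Bx : lspan W x.
    apply: (lspan_sub (lspan_subspace _)) Bx => _ [n [s [_ sP ->]]].
    elim: s sP => [|y s IH] sP; first by apply: lspan_in; exists [::]; rewrite !big_nil.
    rewrite big_cons; apply: Wmul; last by apply: IH => z zs; apply: sP; rewrite inE zs orbT.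
    have [|v [_ ->]] := sP y; first by rewrite inE eqxx.
    rewrite (coord_vbasis (memvf v)) (linmap_sum phil).
    apply: (subspace_sum (lspan_subspace _)) => i _; rewrite (linmapZ phil).
    by apply/(subspaceZ (lspan_subspace _))/lspan_in; exists [:: i]; rewrite big_seq1.
  suff [N [c ->]] : exists N (c : nat -> C), x = \sum_(i < N) c i *: u i.
    by exists N, (fun i => c i).
  elim: Bx => [|a _ z [s ->] _ [N [c ->]]]; first by exists 0%N, (fun=> 0); rewrite big_ord0.
  pose m := choice.pickle s; have um : u m = \prod_(i <- s) e i by rewrite /u choice.pickleK.
  exists (maxn N m.+1), (fun i => (if i == m then a else 0) + (if (i < N)%N then c i else 0)).
  under [RHS]eq_bigr do rewrite scalerDl.
  rewrite big_split /= -um; congr (_ + _).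
    have mN : (m < maxn N m.+1)%N by rewrite leq_max leqnn orbT.
    rewrite (bigD1 (Ordinal mN)) //= eqxx big1 ?addr0 // => i im.
    by rewrite ifN ?scale0r.
  rewrite (big_ord_widen _ (fun i => c i *: u i) (leq_maxl N m.+1)) big_mkcond.
  by apply: eq_bigr => i _; case: ifP => // _; rewrite scale0r.
set x := phi eta.
have linv mu : mu != 0 -> exists r, B0 r /\ r * (x - mu%:A) - 1 = 0.
  move=> mu0; apply: contrapT => /forallNP H.
  have Bxm : B0 (x - mu%:A) by exact: (subspaceB B0sub (Bphi eta) (subspaceZ B0sub mu B01)).
  pose J0 y := exists r, B0 r /\ y = r * (x - mu%:A).
  have lJ0 : left_ideal B0 J0.
    split=> [|_ [r [Br ->]]|b _ Bb [r [Br ->]]]; last 2 first.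
    - exact: B0mul.
    - by exists (b * r); rewrite mulrA; split=> //; apply: B0mul.
    split=> [|a _ _ [r [Br ->]] [s [Bs ->]]]; first by exists 0; rewrite mul0r; split=> //; apply: subspace0.
    exists (a *: r + s); rewrite mulrDl -scalerAl; split=> //.
    by case: B0sub => _; apply.
  have [|L [lL L1 J0L Lmax]] := maximal_left_ideal B0sub B0mul B01 lJ0.
    by move=> [r [Br e1]]; apply: (H r); rewrite -e1 subrr.
  have Lx : L x.
    have T := nil_radical_simple B0sub B0mul B01 B0count lL L1 Lmax Cnc Su w0S cw0 PI phil phib Bphi (fun _ h => h) neta.
    exact: T.
  have Lxm : L (x - mu%:A).
    by apply: J0L; exists 1; rewrite mul1r.
  have [Lsub _ _] := lL; apply: L1.
  have := subspaceB Lsub Lx Lxm; rewrite opprB addrC subrK => /(subspaceZ Lsub mu^-1).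
  by rewrite scalerA mulVf // scale1r.
have /choice [r Hr] : forall mu, exists r, mu != 0 -> B0 r /\ r * (x - mu%:A) - 1 = 0.
  move=> mu; case: (eqVneq mu 0) => [->|mu0]; first by exists 0 => /eqP.
  by have [r Hr] := linv mu mu0; exists r.
pose D : set C := fun mu => mu != 0.
have Dnc : ~ countable D.
  move=> Dc; apply: Cnc; pose F (b : bool) : set C := if b then D else @classical_sets.set1 C 0.
  apply: (sub_countable (B := \bigcup_(b in setT) F b)).
    apply: subset_card_le => c _; case: (eqVneq c 0) => [->|c0']; first by exists false.
    by exists true.
  by apply: bigcup_countable => [|[] _ //]; [apply: countableP|apply: countable1].
have [||||q [q0 qx]] := @resolvent_algebraic C A B0 B0count D (fun y => y = 0) x r Dnc.
- by split=> // a u v -> ->; rewrite scaler0 addr0.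
- by move=> y ->; rewrite mul0r.
- by move=> c Dc; have [] := Hr c Dc.
- by move=> c Dc; have [] := Hr c Dc.
have [s qs] := closed_field_poly_normal q.
have {q0 qx qs} : ev x (\prod_(z <- s) ('X - z%:P)) * 1 = 0.
  move: qx; rewrite qs (linmapZ (ev_lin x)) => /eqP; rewrite scaler_eq0 lead_coef_eq0 (negPf q0) /=.
  by move=> /eqP ->; rewrite mul0r.
(* Factors with [z != 0] are cancelled by the left inverses [r z]; those with [z = 0] are moved into
   [y] as powers of [x]. *)
suff H y : ev x (\prod_(z <- s) ('X - z%:P)) * y = 0 -> exists m, x ^+ m * y = 0.
  by move=> /H [m]; rewrite mulr1; exists m.
elim: s y => [|z s IH] y; first by rewrite big_nil /ev rmorph1 mul1r => ->; exists 0%N; rewrite mulr0.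
rewrite big_cons /ev rmorphM rmorphB /= horner_algX horner_algC -mulrA.
case: (eqVneq z 0) => [->|z0].
  rewrite scale0r subr0 mulrA -/(ev x _) -ev_comm -mulrA => /IH [m e0].
  by exists m.+1; rewrite exprSr -mulrA.
move=> e0; apply: IH; have [_ /eqP] := Hr z z0; rewrite subr_eq0 => /eqP e1.
by rewrite -[LHS]mul1r -e1 -mulrA e0 mulr0.
Qed.

(** * Nilpotency implies a polynomial identity *)

(** The spanning vectors are taken from [Q] itself; for eigenvectors this makes each of their images
    nilpotent. *)
Lemma lspan_family (K : fieldType) (V : vectType K) (Q : V -> Prop) :
  exists n (e : 'I_n -> V), (forall i, Q (e i)) /\
    forall x, lspan Q x -> exists c : 'I_n -> K, x = \sum_i c i *: e i.
Proof.
pose good m := `[< exists X : seq V, (forall x, x \in X -> Q x) /\ \dim <<X>>%VS = m >].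
have g0 : exists m, good m.
  by exists 0%N; apply/asboolP; exists [::]; rewrite span_nil dimv0.
have gle m : good m -> (m <= \dim {:V})%N.
  by move=> /asboolP [X [_ <-]]; apply/dimvS/subvf.
case: (ex_maxnP g0 gle) => m /asboolP [X [XQ dX]] maxm.
exists (size X), (fun i => X`_i); split=> [i|x Qx]; first exact/XQ/mem_nth.
suff xX : x \in <<in_tuple X>>%VS.
  by exists (coord (in_tuple X) ^~ x); rewrite {1}(coord_span xX).
apply: (lspan_sub (P := fun x => x \in <<X>>%VS)) Qx => [|u Qu].
  by split=> [|a u v uX vX]; [exact: mem0v|rewrite rpredD ?rpredZ].
apply/negPn/negP => uX; have /maxm : good (\dim <<u :: X>>%VS).
  apply/asboolP; exists (u :: X); split=> // y.
  by rewrite inE => /orP[/eqP->|/XQ].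
have sX : (<<X>> <= <<u :: X>>)%VS by rewrite span_cons addvSr.
rewrite -dX leqNgt => /negP[]; rewrite ltn_neqAle dimvS // andbT.
apply/negP => /eqP ed; have /eqP eX : (<<X>> == <<u :: X>>)%VS by rewrite eqEdim sX ed leqnn.
by move: uX; rewrite eX memv_span // inE eqxx.
Qed.

(** * Reordering of words in nilpotent letters *)

Section PBW.
Context (K : fieldType) (A : algType K) (r : nat) (E : 'I_r -> A).
Hypothesis Ebr : forall i j, lspan (fun y => exists k, y = E k) (E i * E j - E j * E i).

Definition word (w : seq 'I_r) : A := \prod_(i <- w) E i.

Definition words_le m := lspan (fun y => exists w, (size w <= m)%N /\ y = word w).

Lemma words_le_mul m m' y z : words_le m y -> words_le m' z -> words_le (m + m') (y * z).
Proof.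
apply: lspan_mul => _ _ [w [sw ->]] [v [sv ->]]; apply: lspan_in; exists (w ++ v).
by rewrite size_cat leq_add // /word big_cat.
Qed.

Lemma words_le_word m w : (size w <= m)%N -> words_le m (word w).
Proof. by move=> sw; apply: lspan_in; exists w. Qed.

Lemma words_le1 i : words_le 1 (E i).
Proof. by apply: lspan_in; exists [:: i]; rewrite /word big_seq1. Qed.

Lemma word_move p x s :
  words_le (size p + size s) (word (p ++ x :: s) - word (x :: p ++ s)).
Proof.
elim: p => [|y p IH] /=; first by rewrite subrr; apply: lspan0.
have -> : word (y :: p ++ x :: s) - word [:: x, y & p ++ s] =
    E y * (word (p ++ x :: s) - word (x :: p ++ s)) + (E y * E x - E x * E y) * word (p ++ s).
  by rewrite /word !big_cons mulrBr mulrBl !mulrA addrA subrK.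
apply: (subspaceD (lspan_subspace _)); first exact: (words_le_mul (words_le1 y) IH).
rewrite addSn -add1n -size_cat; apply: words_le_mul; last exact: words_le_word.
by apply: lspan_sub (lspan_subspace _) _ _ (Ebr y x) => _ [k ->]; apply: words_le1.
Qed.

Lemma word_collect x c w : (c <= count_mem x w)%N ->
  exists w', (size w' + c = size w)%N /\ words_le (size w).-1 (word w - E x ^+ c * word w').
Proof.
elim: c w => [|c IH] w cw.
  by exists w; rewrite addn0 mul1r subrr; split=> //; apply: lspan0.
have xw : x \in w by rewrite -has_pred1 has_count (leq_trans _ cw).
case/splitPr: xw cw => p s; rewrite count_cat /= eqxx add1n addnS ltnS -count_cat => /IH [w' [sw' Hw']].
exists w'; rewrite addnS sw' !size_cat /= addnS; split=> //.
have -> : word (p ++ x :: s) - E x ^+ c.+1 * word w' =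
    (word (p ++ x :: s) - word (x :: p ++ s)) + E x * (word (p ++ s) - E x ^+ c * word w').
  by rewrite mulrBr exprS mulrA /word !big_cons addrA subrK.
apply: (subspaceD (lspan_subspace _)); first exact: word_move.
case: (posnP (size (p ++ s))) => [s0|s0].
  have /eqP : (size w' + c)%N = 0%N by rewrite sw'.
  rewrite addn_eq0 => /andP[/eqP /size0nil -> /eqP ->].
  by rewrite (size0nil s0) mul1r subrr mulr0; apply: lspan0.
rewrite -size_cat -[size (p ++ s)](prednK s0) -[_.+1]add1n.
exact: words_le_mul (words_le1 x) Hw'.
Qed.

(** A word longer than [r * N] repeats some letter [N] times. Collecting these copies in front costs
    only shorter words, and the collected power is 0. *)
Lemma words_le_all N : (forall i, E i ^+ N = 0) -> forall w, words_le (r * N) (word w).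
Proof.
move=> EN w; have [m] := ubnP (size w); elim: m w => // m IH w; rewrite ltnS => sw.
case: (leqP (size w) (r * N)) => [|wN]; first exact: words_le_word.
have [x Nx] : exists x, (N <= count_mem x w)%N.
  apply: contrapT => /forallNP H; move: wN; rewrite ltnNge => /negP; apply.
  have -> : size w = \sum_(x < r) count_mem x w.
    rewrite -sum1_size (partition_big id predT) //=; apply: eq_bigr => x _.
    by rewrite sum1_count.
  apply: (@leq_trans (\sum_(x < r) N)); last by rewrite sum_nat_const card_ord.
  by apply: leq_sum => x _; rewrite ltnW // ltnNge; apply/negP/H.
have [w' [_ ]] := word_collect Nx; rewrite EN mul0r subr0.
apply: lspan_sub (lspan_subspace _) _ _ => _ [v [sv ->]]; apply: IH.
apply: leq_trans sw; rewrite -(prednK (n := size w)) ?ltnS //.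
exact: leq_ltn_trans wN.
Qed.

Lemma pbw_finite N : (forall i, E i ^+ N = 0) ->
  exists (J : finType) (f : J -> A), (forall j, exists w, f j = word w) /\
    forall w, lspan (fun y => exists j, y = f j) (word w).
Proof.
move=> EN; exists ((r * N).-bseq 'I_r), (fun j : (r * N).-bseq 'I_r => word j).
split=> [j|w]; first by exists j.
apply: lspan_mono (words_le_all EN w) => _ [v [sv ->]].
by exists (Bseq sv).
Qed.

End PBW.

(** * The standard identity modulo a nilpotent ideal *)

Section StandardIdentity.
Context (C : numClosedFieldType) (A : algType C).
Variables (B0 I : A -> Prop).
Hypothesis B0sub : is_subspace B0.
Hypothesis B0mul : forall x y, B0 x -> B0 y -> B0 (x * y).
Hypothesis B01 : B0 1.
Hypothesis Isub : is_subspace I.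
Hypothesis Imull : forall b x, B0 b -> I x -> I (b * x).
Hypothesis Imulr : forall b x, B0 b -> I x -> I (x * b).
Variable Q : A -> Prop.
Hypothesis QB : forall x, Q x -> B0 x.
Hypothesis Qcomm : forall c a, Q c -> B0 a -> I (c * a - a * c).
Variables (J : finType) (f : J -> A).
Hypothesis fB : forall j, B0 (f j).
Hypothesis fspan : forall y, B0 y ->
  exists c : J -> A, (forall j, Q (c j)) /\ I (y - \sum_j f j * c j).

Definition eqI x y := I (x - y).

Lemma eqI_refl x : eqI x x. Proof. by rewrite /eqI subrr; apply: subspace0. Qed.

Lemma eqI_trans y x z : eqI x y -> eqI y z -> eqI x z.
Proof. by rewrite /eqI => xy yz; rewrite -(subrKA y); apply: (subspaceD Isub). Qed.

Lemma eqI_mul x y x' y' : B0 x' -> B0 y -> eqI x x' -> eqI y y' -> eqI (x * y) (x' * y').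
Proof.
move=> Bx' By xx yy; apply: (@eqI_trans (x' * y)); rewrite /eqI.
  by rewrite -mulrBl; apply: Imulr.
by rewrite -mulrBr; apply: Imull.
Qed.

Lemma eqI_sum (T : Type) (s : seq T) (F G : T -> A) :
  (forall i, eqI (F i) (G i)) -> eqI (\sum_(i <- s) F i) (\sum_(i <- s) G i).
Proof. by move=> FG; rewrite /eqI -sumrB; apply: (subspace_sum Isub) => i _; apply: FG. Qed.

Lemma eqI_scale k x y : eqI x y -> eqI (k *: x) (k *: y).
Proof. by rewrite /eqI -scalerBr; apply: subspaceZ. Qed.

Lemma B0prod (T : Type) (s : seq T) (F : T -> A) :
  (forall i, B0 (F i)) -> B0 (\prod_(i <- s) F i).
Proof. by move=> BF; apply: big_ind. Qed.

Lemma eqI_prod (T : Type) (s : seq T) (F G : T -> A) :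
  (forall i, B0 (F i)) -> (forall i, B0 (G i)) -> (forall i, eqI (F i) (G i)) ->
  eqI (\prod_(i <- s) F i) (\prod_(i <- s) G i).
Proof.
move=> BF BG FG; elim: s => [|i s IH]; first by rewrite !big_nil; apply: eqI_refl.
by rewrite !big_cons; apply: eqI_mul => //; apply: B0prod.
Qed.

Lemma eqI_prod_mul (T : Type) (s : seq T) (F G : T -> A) :
  (forall i, B0 (F i)) -> (forall i, Q (G i)) ->
  eqI (\prod_(i <- s) (F i * G i)) ((\prod_(i <- s) F i) * \prod_(i <- s) G i).
Proof.
move=> BF QG; have BG i : B0 (G i) by apply: QB.
elim: s => [|i s IH]; first by rewrite !big_nil mulr1; apply: eqI_refl.
rewrite !big_cons; set P := \prod_(_ <- s) F _; set R := \prod_(_ <- s) G _.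
have BP : B0 P by apply: B0prod.
have BR : B0 R by apply: B0prod.
apply: (@eqI_trans (F i * G i * (P * R))).
  apply: eqI_mul => //; [exact: B0mul| |exact: eqI_refl].
  by apply: B0prod => j; apply: B0mul.
rewrite -!mulrA; apply: eqI_mul => //; [by do !apply: B0mul|exact: eqI_refl|].
rewrite !mulrA; apply: eqI_mul => //; [exact: B0mul| |exact: eqI_refl].
exact: Qcomm.
Qed.

Lemma eqI_perm (T : eqType) (s t : seq T) (G : T -> A) : (forall i, Q (G i)) ->
  perm_eq s t -> eqI (\prod_(i <- s) G i) (\prod_(i <- t) G i).
Proof.
move=> QG; have BG i : B0 (G i) by apply: QB.
elim: s t => [|i s IH] t pst.
  by have /perm_nilP -> : perm_eq t [::]; [rewrite perm_sym|apply: eqI_refl].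
have it : i \in t by rewrite -(perm_mem pst) inE eqxx.
case/splitPr: it pst => t1 t2; rewrite perm_sym perm_catC /= perm_cons perm_catC perm_sym => /IH H.
rewrite big_cons big_cat big_cons /=; apply: (@eqI_trans (G i * \prod_(j <- t1 ++ t2) G j)).
  apply: eqI_mul => //; [|exact: eqI_refl]; exact: B0prod.
rewrite big_cat /= !mulrA; apply: eqI_mul; try exact: B0prod.
- by apply: B0mul => //; apply: B0prod.
- by apply: Qcomm => //; apply: B0prod.
- exact: eqI_refl.
Qed.

Definition stdpoly n (a : 'I_n -> A) : A :=
  \sum_(s : {perm 'I_n}) (-1) ^+ (odd_perm s) *: \prod_(i < n) a (s i).

Lemma stdpoly_alt n (F : 'I_n -> A) p q : p != q -> F p = F q -> stdpoly F = 0.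
Proof.
move=> pq Fpq; suff e : stdpoly F = - stdpoly F.
  have := congr1 (fun x => x + stdpoly F) e; rewrite addNr -mulr2n -scaler_nat => /eqP.
  by rewrite scaler_eq0 pnatr_eq0 => /eqP.
rewrite {1}/stdpoly (reindex_inj (mulIg (tperm p q))) -sumrN; apply: eq_bigr => s _.
rewrite odd_permM odd_tperm pq addbT signrN scaleNr; congr (- (_ *: _)).
apply: eq_bigr => i _; rewrite permM; case: tpermP => // ->; by rewrite Fpq.
Qed.

(** Modulo [I], [B0] is generated by [#|J|] elements with coefficients in the central [Q]. The
    standard polynomial is multilinear and alternating, so with one more argument than generators it
    vanishes. *)
Lemma stdpoly_in_ideal (a : 'I_#|J|.+1 -> A) : (forall i, B0 (a i)) -> I (stdpoly a).
Proof.
move=> Ba; set n := #|J|.+1 in a Ba *.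
have /choice [c Hc] : forall i, exists c : J -> A, (forall j, Q (c j)) /\ I (a i - \sum_j f j * c j).
  by move=> i; apply: fspan.
have Qc i j : Q (c i j) by have [] := Hc i.
have BQc i j : B0 (c i j) by apply: QB.
pose b i := \sum_j f j * c i j.
have Bb i : B0 (b i) by apply: (subspace_sum B0sub) => j _; apply: B0mul.
have e1 : eqI (stdpoly a) (stdpoly b).
  apply: eqI_sum => s; apply: eqI_scale; apply: eqI_prod => // i.
  by have [_] := Hc (s i).
(* The choice functions are reindexed along [s], so that after reordering the central factor no
   longer depends on [s]. *)
have e2 : stdpoly b = \sum_(h : {ffun 'I_n -> J}) \sum_(s : {perm 'I_n})
    (-1) ^+ (odd_perm s) *: \prod_(i < n) (f (h (s i)) * c (s i) (h (s i))).
  rewrite exchange_big; apply: eq_bigr => s _ /=; rewrite -scaler_sumr; congr (_ *: _).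
  rewrite bigA_distr_bigA /= (reindex_inj (h := fun h : {ffun 'I_n -> J} => [ffun i => h (s i)])) /=.
    by apply: eq_bigr => h _; apply: eq_bigr => i _; rewrite ffunE.
  move=> h1 h2 /ffunP e; apply/ffunP => i; have := e (s^-1%g i).
  by rewrite !ffunE permKV.
have e3 : eqI (stdpoly b) (\sum_(h : {ffun 'I_n -> J}) stdpoly (fun i => f (h i)) *
    \prod_(i < n) c i (h i)).
  rewrite e2; apply: eqI_sum => h; rewrite /stdpoly mulr_suml; apply: eqI_sum => s.
  rewrite -scalerAl; apply: eqI_scale.
  apply: (eqI_trans (eqI_prod_mul _ (fun i => fB (h (s i))) (fun i => Qc (s i) (h (s i))))).
  apply: eqI_mul; [by apply: B0prod|by apply: B0prod|exact: eqI_refl|].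
  have -> : \prod_(i < n) c (s i) (h (s i)) =
      \prod_(i <- map s (index_enum 'I_n)) c i (h i) by rewrite big_map.
  apply: eqI_perm => //; apply: uniq_perm; rewrite ?map_inj_uniq ?index_enum_uniq //; first exact: perm_inj.
  move=> i; rewrite mem_index_enum; apply/mapP; exists (s^-1%g i); first by rewrite mem_index_enum.
  by rewrite permKV.
have : eqI (stdpoly a) 0.
  apply: (eqI_trans e1); apply: (eqI_trans e3); rewrite big1 => [|h _]; first exact: eqI_refl.
  have [p [q [pq hpq]]] : exists p q, p != q /\ h p = h q.
    have nh : ~~ injectiveb h.
      apply/negP => /injectiveP /card_codom => e.
      have := max_card (mem (codom h)); rewrite e card_ord.
      by rewrite /n ltnn.
    by have /injectivePn [p [q pq hpq]] := nh; exists p, q; rewrite eq_sym in pq *.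
  by rewrite (stdpoly_alt pq) ?mul0r // hpq.
by rewrite /eqI subr0.
Qed.

(** The identity is the [d]-th power of the standard polynomial. It is nonzero because its monomials
    are distinct: cutting such a word into blocks of length [n] recovers the permutations. *)
Lemma stdpoly_power_pi d : wordnil I d ->
  exists (k : nat) (S : seq (seq 'I_k)) (cf : seq 'I_k -> C),
    [/\ uniq S, exists2 w, w \in S & cf w != 0 &
     forall a : 'I_k -> A, (forall i, B0 (a i)) -> \sum_(w <- S) cf w *: \prod_(i <- w) a i = 0].
Proof.
move=> Id; set n := #|J|.+1.
have szI m : size (index_enum 'I_m) = m.
  by rewrite -sum1_size sum_nat_const card_ord muln1.
pose pw (s : {perm 'I_n}) := [seq s i | i <- index_enum 'I_n].
pose W (t : {ffun 'I_d -> {perm 'I_n}}) := flatten [seq pw (t j) | j <- index_enum 'I_d].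
have Winj : injective W.
  move=> t u; have shp v : shape [seq pw (v j) | j <- index_enum 'I_d] = [seq n | j <- index_enum 'I_d].
    by rewrite /shape -map_comp; apply: eq_map => j; rewrite /= size_map szI.
  move=> e; have : [seq pw (t j) | j <- index_enum 'I_d] = [seq pw (u j) | j <- index_enum 'I_d].
    by apply: eq_from_flatten_shape => //; rewrite !shp.
  move=> /eq_in_map H; apply/ffunP => j; apply/permP => i.
  have := H j; rewrite mem_index_enum => /(_ isT) /eq_in_map /(_ i).
  by rewrite mem_index_enum; apply.
pose sg (t : {ffun 'I_d -> {perm 'I_n}}) : C := \prod_(j < d) (-1) ^+ odd_perm (t j).
exists n, [seq W t | t <- enum {: {ffun 'I_d -> {perm 'I_n}}}],
  (fun w => \sum_t (W t == w)%:R * sg t).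
have cfW t : \sum_u (W u == W t)%:R * sg u = sg t.
  rewrite (bigD1 t) //= eqxx mul1r big1 ?addr0 // => u ut.
  by rewrite (inj_eq Winj) (negPf ut) mul0r.
split.
- by rewrite map_inj_uniq ?enum_uniq.
- exists (W [ffun=> 1%g]); first by apply: map_f; rewrite mem_enum.
  rewrite cfW /sg; by apply/prodf_neq0 => j _; rewrite signr_eq0.
move=> a Ba; rewrite big_map big_enum /=; under eq_bigr do rewrite cfW.
have : \prod_(j < d) stdpoly a = 0.
  rewrite -(big_map (fun=> stdpoly a) predT id); apply: Id; first by rewrite size_map szI.
  by move=> x /mapP [j _ ->]; apply: stdpoly_in_ideal.
rewrite /stdpoly bigA_distr_bigA /= => e; rewrite -[RHS]e; apply: eq_bigr => t _.
rewrite scaler_prod; congr (_ *: _).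
rewrite big_flatten big_map; apply: eq_bigr => j _.
by rewrite big_map.
Qed.

End StandardIdentity.

(** * A polynomial identity for the image of the enveloping algebra *)

Section NilpotentPI.
Context (C : numClosedFieldType) (A : algType C) (g : vectType C) (br : g -> g -> g).
Context (phi : g -> A).
Hypothesis Hbr : lie_bracket br.
Hypothesis phi_lin : linmap phi.
Hypothesis phi_br : forall x y, phi (br x y) = phi x * phi y - phi y * phi x.

Definition words_in (P : A -> Prop) := lspan (fun w => exists n, is_word P n w).

Lemma words_in_sub P : is_subspace (words_in P). Proof. exact: lspan_subspace. Qed.

Lemma words_in_mul P x y : words_in P x -> words_in P y -> words_in P (x * y).
Proof.
apply: lspan_mul => u v [n Hu] [m Hv]; apply: lspan_in.
by exists (n + m)%N; apply: is_word_cat.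
Qed.

Lemma words_in1 P : words_in P 1.
Proof. by apply: lspan_in; exists 0%N; apply: is_word0. Qed.

Lemma words_in_letter (P : A -> Prop) x : P x -> words_in P x.
Proof. by move=> Px; apply: lspan_in; exists 1%N; apply: is_word1. Qed.

Lemma words_in_ind (P T : A -> Prop) : is_subspace T -> T 1 ->
  (forall x y, P x -> words_in P y -> T y -> T (x * y)) -> forall y, words_in P y -> T y.
Proof.
move=> sT T1 TM; apply: lspan_sub => // _ [n [s [_ sP ->]]].
elim: s sP => [|x s IH] sP; first by rewrite big_nil.
have sP' y : y \in s -> P y by move=> ys; apply: sP; rewrite inE ys orbT.
rewrite big_cons; apply: TM; first by apply: sP; rewrite inE eqxx.
  by apply: lspan_in; exists (size s), s.
exact: IH.
Qed.

Let B0 := words_in (img phi (fun=> True)).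
Let nl := img phi (nil_radical br).

Lemma nl_comm x p : nl p -> nl (p * phi x - phi x * p).
Proof.
move=> [y [ny ->]]; exists (br y x); rewrite phi_br; split=> //.
rewrite (br_anti Hbr); apply: (subspaceN (nil_radical_subspace br)).
exact: nil_radical_ideal.
Qed.

(** The [r]-th power of the two-sided ideal generated by the image of the radical; since the radical
    is an ideal of [g], its letters can be gathered on the right. *)
Definition nideal r := lspan (fun y => exists a w, [/\ B0 a, is_word nl r w & y = a * w]).

Lemma nideal_mull r b x : B0 b -> nideal r x -> nideal r (b * x).
Proof.
move=> Bb; apply: (lspan_map (linmap_mull b)) => _ [a [w [Ba Hw ->]]].
by apply: lspan_in; exists (b * a), w; rewrite mulrA; split=> //; apply: words_in_mul.
Qed.

Lemma nideal_mulr r b x : B0 b -> nideal r x -> nideal r (x * b).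
Proof.
move=> Bb; move: b Bb x; apply: words_in_ind.
- split=> [x _|k u v Hu Hv x nx]; first by rewrite mulr0; apply: lspan0.
  rewrite mulrDr -scalerAr; apply: (subspaceD (lspan_subspace _)); last exact: Hv.
  by apply: (subspaceZ (lspan_subspace _)); apply: Hu.
- by move=> x; rewrite mulr1.
move=> _ y [z [_ ->]] _ IH x nx; rewrite mulrA; apply: IH.
apply: (lspan_map (linmap_mulr (phi z))) nx => _ [a [w [Ba Hw ->]]].
have -> : a * w * phi z = a * (w * phi z - phi z * w) + a * phi z * w.
  by rewrite mulrBr !mulrA subrK.
apply: (subspaceD (lspan_subspace _)); last first.
  apply: lspan_in; exists (a * phi z), w; split=> //; apply: words_in_mul => //.
  by apply: words_in_letter; exists z.
apply: (lspan_map (linmap_mull a)) (word_mul_comm (@nl_comm z) Hw) => u Hu.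
by apply: lspan_in; exists a, u.
Qed.

Lemma nideal_mul r r' x y : nideal r x -> nideal r' y -> nideal (r + r') (x * y).
Proof.
move=> nx; apply: (lspan_map (linmap_mull x)) => _ [b [v [Bb Hv ->]]].
rewrite mulrA; apply: (lspan_map (linmap_mulr v)) (nideal_mulr Bb nx) => _ [a [w [Ba Hw ->]]].
by apply: lspan_in; exists a, (w * v); rewrite mulrA; split=> //; apply: is_word_cat.
Qed.

Lemma nideal_prod s : (forall x, x \in s -> nideal 1 x) -> nideal (size s) (\prod_(x <- s) x).
Proof.
elim: s => [|x s IH] H.
  rewrite big_nil; apply: lspan_in; exists 1, 1; rewrite mulr1; split=> //.
    exact: words_in1.
  exact: is_word0.
rewrite big_cons; apply: (@nideal_mul 1); first by apply: H; rewrite inE eqxx.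
by apply: IH => y ys; apply: H; rewrite inE ys orbT.
Qed.

Theorem nil_radical_pi d : wordnil nl d ->
  (forall y, nonzero_eigvec br y -> exists k, phi y ^+ k = 0) ->
  exists (k : nat) (S : seq (seq 'I_k)) (cf : seq 'I_k -> C),
    [/\ uniq S, exists2 w, w \in S & cf w != 0 &
     forall a : 'I_k -> A, (forall i, B0 (a i)) -> \sum_(w <- S) cf w *: \prod_(i <- w) a i = 0].
Proof.
move=> nd eignil.
have [q [qsub qn qsplit]] := reductive_split Hbr.
have [r [e [eQ espan]]] := lspan_family (nonzero_eigvec br).
have Lspan x : lieL br x -> exists c : 'I_r -> C, x = \sum_i c i *: e i.
  by move=> Lx; apply/espan/(lieL_eigvec Hbr).
have Le i : lieL br (e i) by apply: eigvec_lieL.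
pose E i := phi (e i).
have /choice [k Hk] : forall i, exists k, E i ^+ k = 0 by move=> i; apply: eignil.
(* The sum serves as a common nilpotency exponent. *)
pose N := (\sum_i k i)%N.
have EN i : E i ^+ N = 0.
  by rewrite /N (bigD1 i) //= exprD Hk mul0r.
have Ebr i j : lspan (fun y => exists k, y = E k) (E i * E j - E j * E i).
  have [c ec] := Lspan _ (lieL_ideal Hbr (e i) (Le j)).
  rewrite -phi_br ec (linmap_sum phi_lin); apply: (subspace_sum (lspan_subspace _)) => m _.
  by rewrite (linmapZ phi_lin); apply/(subspaceZ (lspan_subspace _))/lspan_in; exists m.
have [J [f [fword fspan]]] := pbw_finite Ebr EN.
pose Q := words_in (img phi q).
have phiB x : B0 (phi x) by apply: words_in_letter; exists x.
have fB j : B0 (f j).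
  have [w ->] := fword j; rewrite /word; apply: big_ind => [|x y Bx By|i _].
  - exact: words_in1.
  - exact: words_in_mul.
  - exact: phiB.
have QB x : Q x -> B0 x.
  apply: words_in_ind; [exact: words_in_sub|exact: words_in1|].
  by move=> _ y [z [_ ->]] _ By; apply: (words_in_mul (phiB z) By).
have Isub : is_subspace (nideal 1) by apply: lspan_subspace.
have nI x : nil_radical br x -> nideal 1 (phi x).
  move=> nx; apply: lspan_in; exists 1, (phi x); rewrite mul1r; split=> //.
    exact: words_in1.
  by apply: is_word1; exists x.
have comm_mul c a b : B0 a -> B0 b -> nideal 1 (c * a - a * c) -> nideal 1 (c * b - b * c) ->
    nideal 1 (c * (a * b) - a * b * c).
  move=> Ba Bb Ha Hb.
  have -> : c * (a * b) - a * b * c = (c * a - a * c) * b + a * (c * b - b * c).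
    by rewrite mulrBl mulrBr !mulrA addrA subrK.
  by apply: (subspaceD Isub); [apply: nideal_mulr|apply: nideal_mull].
have comm_lin c : linmap (fun a : A => c * a - a * c).
  by move=> m u v; rewrite mulrDr mulrDl -scalerAr -scalerAl opprD addrACA scalerBr.
have Qcomm c a : Q c -> B0 a -> nideal 1 (c * a - a * c).
  (* Commutation modulo the ideal is extended from letters to words in [c] and then in [a]; for
     letters it is the image of [br z x] with [z] in [q], which is in the radical. *)
  move=> Qc Ba; have flip u v : nideal 1 (u * v - v * u) -> nideal 1 (v * u - u * v).
    by move/(subspaceN Isub); rewrite opprB.
  apply: (flip _ _); move: c Qc; apply: (words_in_ind (T := fun c => nideal 1 (a * c - c * a))).
  - exact: (subspace_preim (comm_lin a) Isub).
  - by rewrite mulr1 mul1r subrr; apply: lspan0.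
  move=> _ y [z [qz ->]] Qy Hy; apply: (comm_mul _ _ _) => //; first exact: QB.
  apply: (flip _ _); move: a Ba {Hy}; apply: (words_in_ind (T := fun a => nideal 1 (phi z * a - a * phi z))).
  - exact: (subspace_preim (comm_lin (phi z)) Isub).
  - by rewrite mulr1 mul1r subrr; apply: lspan0.
  move=> _ b [x [_ ->]] Bb Hb; apply: (comm_mul _ _ _) => //.
  by rewrite -phi_br; apply/nI/qn.
have ffspan l j : lieL br l -> lspan (fun y => exists j, y = f j) (phi l * f j).
  move=> /Lspan [c ->]; rewrite (linmap_sum phi_lin) mulr_suml.
  apply: (subspace_sum (lspan_subspace _)) => i _; rewrite (linmapZ phi_lin) -scalerAl.
  apply: (subspaceZ (lspan_subspace _)); have [w ->] := fword j.
  by have := fspan (i :: w); rewrite /word big_cons.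
pose Y y := exists c : J -> A, (forall j, Q (c j)) /\ nideal 1 (y - \sum_j f j * c j).
have Q0 : Q 0 by apply: subspace0 (words_in_sub _).
have Ysub : is_subspace Y.
  split=> [|a u v [c [Qc Hc]] [c' [Qc' Hc']]].
    exists (fun=> 0); split=> //; rewrite big1 => [|j _]; last exact: mulr0.
    by rewrite subr0; apply: lspan0.
  exists (fun j => a *: c j + c' j); split=> [j|].
    by have [_ H] := words_in_sub (img phi q); apply: H (Qc j) (Qc' j).
  under eq_bigr do rewrite mulrDr -scalerAr.
  rewrite big_split -scaler_sumr /= opprD addrACA -scalerBr.
  by apply: (subspaceD Isub) => //; apply: (subspaceZ Isub).
have YI y z : nideal 1 (y - z) -> Y z -> Y y.
  move=> yz [c [Qc Hc]]; exists c; split=> //.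
  by rewrite -(subrKA z); apply: (subspaceD Isub).
have Yfc y c : lspan (fun y => exists j, y = f j) y -> Q c -> Y (y * c).
  move=> fy Qc; elim: fy => [|a _ v [j ->] _ IH]; first by rewrite mul0r; case: Ysub.
  rewrite mulrDl -scalerAl; apply: (subspaceD Ysub) => //; apply: (subspaceZ Ysub).
  exists (fun i => if i == j then c else 0); split=> [i|]; first by case: eqP.
  rewrite (bigD1 j) //= eqxx big1 ?addr0 ?subrr => [|i /negPf ->]; last exact: mulr0.
  exact: lspan0.
have YB y : B0 y -> Y y.
  apply: words_in_ind => //.
    rewrite -[1]mulr1; apply: Yfc; last exact: words_in1.
    by have := fspan [::]; rewrite /word big_nil.
  move=> _ {}y [x [_ ->]] By [c [Qc Hc]].
  apply: (YI _ (phi x * \sum_j f j * c j)).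
    by rewrite -mulrBr; apply: nideal_mull.
  (* The part [l] is absorbed into the span of [f], while [phi z] is moved past [f j] into the
     coefficient. *)
  have [l [z [Ll qz ->]]] := qsplit x.
  rewrite (linmapD phi_lin) mulrDl !mulr_sumr; apply: (subspaceD Ysub).
    apply: (subspace_sum Ysub) => j _; rewrite mulrA; apply: Yfc => //.
    exact: ffspan.
  apply: (subspace_sum Ysub) => j _; apply: (YI _ (f j * (phi z * c j))).
    rewrite !mulrA -mulrBl; apply: nideal_mulr; first exact: QB.
    by apply: Qcomm => //; apply: words_in_letter; exists z.
  apply: Yfc; first by apply: lspan_in; exists j.
  have Qz : Q (phi z) by apply: words_in_letter; exists z.
  exact: words_in_mul Qz (Qc j).
have nId : wordnil (nideal 1) d.
  move=> s ss sP; have := nideal_prod sP; rewrite ss => H.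
  apply: (lspan_eq0 H) => _ [a [w [Ba [t [st tP ->]] ->]]].
  by rewrite nd // mulr0.
apply: (stdpoly_power_pi (words_in_sub _) (@words_in_mul _) (@words_in1 _) Isub
  (@nideal_mull 1) (@nideal_mulr 1) QB Qcomm fB YB nId).
Qed.

End NilpotentPI.

(** * Banach algebras and the exponential *)

Section BanachRing.
Context (R : realType) (B : completeNormedModType R[i]) (mul : B -> B -> B) (one : B).
Hypothesis HB : banach_algebra mul one.
Hypothesis one_neq0 : one != 0.

(** A copy of [B] for the algebra structure. The two proofs are parameters of the type so that the
    instances can use them; [one != 0] is among the ring axioms. *)
Definition balg (_ : banach_algebra mul one) (_ : one != 0) : Type := B.
Notation A := (balg HB one_neq0).

HB.instance Definition _ := GRing.Lmodule.copy A (B : lmodType R[i]).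

Fact balg_mulA : associative (mul : A -> A -> A). Proof. by have [[H _] _ _ _] := HB. Qed.
Fact balg_mul1r : left_id (one : A) (mul : A -> A -> A).
Proof. by have [[_ [H _]] _ _ _] := HB. Qed.
Fact balg_mulr1 : right_id (one : A) (mul : A -> A -> A).
Proof. by have [[_ [_ H]] _ _ _] := HB. Qed.
Fact balg_mulDl : left_distributive (mul : A -> A -> A) +%R.
Proof. by move=> x y z; have [_ Hl _ _] := HB; have := Hl 1 x y z; rewrite !scale1r. Qed.
Fact balg_mulDr : right_distributive (mul : A -> A -> A) +%R.
Proof. by move=> x y z; have [_ _ Hr _] := HB; have := Hr 1 y z x; rewrite !scale1r. Qed.

HB.instance Definition _ := GRing.Zmodule_isNzRing.Build A
  balg_mulA balg_mul1r balg_mulr1 balg_mulDl balg_mulDr one_neq0.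

Fact balg_scaleAl (a : R[i]) (x y : A) : a *: (x * y) = (a *: x) * y.
Proof.
have [_ Hl _ _] := HB; have y0 : mul 0 (y : B) = 0 := mul0r (y : A).
have E : mul (a *: (x : B)) y = a *: mul x y.
  by have := Hl a x 0 y; rewrite addr0 y0 addr0.
exact: esym E.
Qed.

HB.instance Definition _ := GRing.Lmodule_isLalgebra.Build R[i] A balg_scaleAl.

Fact balg_scaleAr (a : R[i]) (x y : A) : a *: (x * y) = x * (a *: y).
Proof.
have [_ _ Hr _] := HB; have x0 : mul (x : B) 0 = 0 := mulr0 (x : A).
have E : mul x (a *: (y : B)) = a *: mul x y.
  by have := Hr a y 0 x; rewrite addr0 x0 addr0.
exact: esym E.
Qed.

HB.instance Definition _ := GRing.Lalgebra_isAlgebra.Build R[i] A balg_scaleAr.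

Lemma balg_powE (x : A) k : bpow mul one x k = x ^+ k.
Proof. by elim: k => // k IH; rewrite exprS -IH. Qed.

Lemma balg_eval_word k (a : 'I_k -> A) w : eval_word mul one a w = \prod_(i <- w) a i.
Proof. by elim: w => [|i w IH]; rewrite ?big_nil // big_cons -IH. Qed.

(** The norm of [B] takes values in [R[i]]; its real part allows estimates in the ordered field
    [R]. *)
Definition nr (x : A) : R := complex.Re `|x : B|.
Definition cmod (a : R[i]) : R := complex.Re `|a|.

Lemma nrE (x : A) : `|x : B| = (nr x)%:C%C.
Proof. by rewrite /nr RRe_real // ger0_real. Qed.

Lemma cmodE (a : R[i]) : `|a| = (cmod a)%:C%C.
Proof. by rewrite /cmod RRe_real // ger0_real. Qed.

Lemma nr_ge0 x : 0 <= nr x.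
Proof. by have := normr_ge0 (x : B); rewrite nrE ler0c. Qed.

Lemma nr0 : nr 0 = 0.
Proof. by rewrite /nr normr0. Qed.

Lemma nr0_eq x : nr x = 0 -> x = 0.
Proof. by move=> e; apply: (@normr0_eq0 _ B); rewrite nrE e. Qed.

Lemma nrD x y : nr (x + y) <= nr x + nr y.
Proof. by have := ler_normD (x : B) y; rewrite !nrE -rmorphD lecR. Qed.

Lemma nrN x : nr (- x) = nr x.
Proof. by rewrite /nr normrN. Qed.

Lemma nrB x y : nr (x - y) <= nr x + nr y.
Proof. by rewrite -(nrN y); apply: nrD. Qed.

Lemma nrZ a x : nr (a *: x) = cmod a * nr x.
Proof. by have := normrZ a (x : B); rewrite cmodE !nrE -rmorphM => -[]. Qed.

Lemma nrM x y : nr (x * y) <= nr x * nr y.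
Proof. by have [_ _ _ H] := HB; have := H x y; rewrite !nrE -rmorphM lecR. Qed.

(** The factor [nr 1] accounts for [k = 0], as the unit may have norm other than 1. *)
Lemma nrX x k : nr (x ^+ k) <= nr 1 * nr x ^+ k.
Proof.
elim: k => [|k IH]; first by rewrite mulr1.
rewrite exprS; apply: (le_trans (nrM _ _)).
by rewrite [nr x ^+ _]exprS mulrCA; apply: ler_wpM2l => //; exact: nr_ge0.
Qed.

Lemma nr_sum (I : Type) (s : seq I) (F : I -> A) :
  nr (\sum_(i <- s) F i) <= \sum_(i <- s) nr (F i).
Proof.
elim: s => [|i s IH]; first by rewrite !big_nil nr0.
by rewrite !big_cons; apply: (le_trans (nrD _ _)); apply: lerD.
Qed.

Lemma nr_small x : (forall e, 0 < e -> nr x < e) -> x = 0.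
Proof.
move=> H; apply: nr0_eq; apply/eqP; rewrite eq_le nr_ge0 andbT.
by apply/ler_addgt0Pl => e e0; rewrite addr0 ltW ?H.
Qed.

Lemma cmod_ge0 a : 0 <= cmod a.
Proof. by have := normr_ge0 a; rewrite cmodE ler0c. Qed.

Lemma cmodM a b : cmod (a * b) = cmod a * cmod b.
Proof. by have := normrM a b; rewrite !cmodE -rmorphM => -[]. Qed.

Lemma cmod_real (t : R) : 0 <= t -> cmod t%:C%C = t.
Proof. by move=> t0; rewrite /cmod ger0_norm // ler0c. Qed.

Lemma cmod_eq0 a : cmod a = 0 -> a = 0.
Proof. by move=> e; apply/normr0_eq0; rewrite cmodE e. Qed.

Lemma cmod_natV n : cmod (n%:R)^-1 = (n%:R)^-1.
Proof.
have -> : (n%:R : R[i])^-1 = ((n%:R : R)^-1)%:C%C by rewrite fmorphV rmorph_nat.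
by rewrite cmod_real // invr_ge0 ler0n.
Qed.

Lemma cvg_nr (u : nat -> A) (l : A) : ((u : nat -> B) @ \oo --> (l : B))%classic <->
  forall e : R, 0 < e -> exists N, forall n, (N <= n)%N -> nr (l - u n) < e.
Proof.
split=> [/cvgrPdist_lt H e e0|H].
  have [|N _ HN] := H (e%:C)%C; first by rewrite ltcR.
  by exists N => n Nn; have := HN n Nn; rewrite /= nrE ltcR.
apply/cvgrPdist_lt => e e0.
have ee : e = (complex.Re e)%:C%C by rewrite RRe_real // gtr0_real.
have [|N HN] := H (complex.Re e); first by move: e0; rewrite ee ltcR.
exists N => // n Nn /=; rewrite ee nrE ltcR; exact: HN.
Qed.

End BanachRing.

Section Exponential.
Context (R : realType) (B : completeNormedModType R[i]) (mul : B -> B -> B) (one : B).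
Context (HB : banach_algebra mul one) (one_neq0 : one != 0).
Notation A := (balg HB one_neq0).
Notation nr := (@nr R B mul one HB one_neq0).

Definition expsum (x : A) n : A := \sum_(k < n) (k`!%:R : R[i])^-1 *: x ^+ k.
Definition expA (x : A) : A := bexp mul one x.

Lemma expsum_series (x : A) :
  series (fun k : nat => (k`!%:R : R[i])^-1 *: bpow mul one x k) = expsum x :> (nat -> B).
Proof.
apply/funext => n; rewrite /series /expsum /= big_mkord.
by apply: eq_bigr => k _; rewrite balg_powE.
Qed.

Lemma nr_expterm (x : A) rho k : nr x <= rho ->
  nr ((k`!%:R : R[i])^-1 *: x ^+ k) <= nr 1 * exp_coeff rho k.
Proof.
move=> xr; rewrite nrZ cmod_natV /exp_coeff /= mulrC mulrA ler_wpM2r ?invr_ge0 //.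
apply: (le_trans (nrX _ _)); apply: ler_wpM2l; first exact: nr_ge0.
by apply: lerXn2r => //; rewrite nnegrE; [exact: nr_ge0|apply: le_trans xr; exact: nr_ge0].
Qed.

Lemma exp_coeff_cauchy (rho e : R) : 0 < e -> exists N, forall n m, (N <= n)%N -> (n <= m)%N ->
  \sum_(n <= k < m) exp_coeff rho k < e.
Proof.
move=> e0; have /cvg_ex [l /cvgrPdist_lt /(_ (e / 2)) []] := @is_cvg_series_exp_coeff R rho.
  by rewrite divr_gt0.
move=> N _ HN; exists N => n m Nn nm.
have -> : \sum_(n <= k < m) exp_coeff rho k = series (exp_coeff rho) m - series (exp_coeff rho) n.
  by rewrite /series /= (big_cat_nat (leq0n n) nm) //= addrAC subrr add0r.
have h1 := HN n Nn; have h2 := HN m (leq_trans Nn nm); rewrite /= in h1 h2.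
apply: (le_lt_trans (ler_norm _)).
rewrite -(subrKA l) [e]splitr; apply: (le_lt_trans (ler_normD _ _)); apply: ltrD => //.
by rewrite distrC.
Qed.

Lemma expsumB (x : A) n m : (n <= m)%N ->
  expsum x m - expsum x n = \sum_(n <= k < m) (k`!%:R : R[i])^-1 *: x ^+ k.
Proof.
move=> nm; rewrite /expsum -!(big_mkord predT (fun k => (k`!%:R : R[i])^-1 *: x ^+ k)).
by rewrite (big_cat_nat (leq0n n) nm) //= addrAC subrr add0r.
Qed.

Lemma nr_expsumB (x : A) rho n m : (n <= m)%N -> nr x <= rho ->
  nr (expsum x m - expsum x n) <= nr 1 * \sum_(n <= k < m) exp_coeff rho k.
Proof.
move=> nm xr; rewrite expsumB //; apply: (le_trans (nr_sum _ _)).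
by rewrite mulr_sumr; apply: ler_sum => k _; apply: nr_expterm.
Qed.

Lemma expsum_cauchy rho (e : R) : 0 < e -> exists N, forall (x : A) n m, nr x <= rho ->
  (N <= n)%N -> (n <= m)%N -> nr (expsum x m - expsum x n) < e.
Proof.
move=> e0; have p0 : 0 < nr 1 + 1 by apply: ltr_wpDl => //; exact: nr_ge0.
have [N HN] := @exp_coeff_cauchy rho (e / (nr 1 + 1)) (divr_gt0 e0 p0).
exists N => x n m xr Nn nm; apply: (le_lt_trans (nr_expsumB nm xr)).
apply: (le_lt_trans (y := (nr 1 + 1) * \sum_(n <= k < m) exp_coeff rho k)).
  rewrite ler_wpM2r ?lerDl // sumr_ge0 // => k _; apply: exp_coeff_ge0.
  by apply: le_trans xr; exact: nr_ge0.
by rewrite mulrC -ltr_pdivlMr //; apply: HN.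
Qed.

Lemma expA_cvg (x : A) (e : R) : 0 < e -> exists N, forall n, (N <= n)%N -> nr (expA x - expsum x n) < e.
Proof.
move: e; apply/cvg_nr; rewrite /expA /bexp expsum_series.
rewrite -expsum_series; set u := fun k : nat => _ *: bpow mul one x k.
suff : cvgn (series u) by [].
apply: cauchy_cvg; apply/cauchy_seriesP => e e0.
have ee : e = (complex.Re e)%:C%C by rewrite RRe_real // gtr0_real.
have e0' : 0 < complex.Re e by move: e0; rewrite {1}ee ltcR.
have [N HN] := @expsum_cauchy (nr x) _ e0'.
exists ([set n | (N <= n)%N]%classic, [set n | (N <= n)%N]%classic).
  by split; exists N.
move=> [n m] [/= Nn Nm]; case: (leqP n m) => [nm|/ltnW mn]; last by rewrite big_geq // normr0.
have := HN x n m (lexx _) Nn nm; rewrite expsumB // ee (@nrE _ _ _ _ HB one_neq0) ltcR; congr (_ < _).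
by congr nr; apply: eq_bigr => k _; rewrite /u balg_powE.
Qed.

(** The bound is uniform on balls, as [cauchy_estimate] truncates at all points of a circle at
    once. *)
Lemma expA_tail rho (e : R) : 0 < e -> exists N, forall (x : A) n, nr x <= rho ->
  (N <= n)%N -> nr (expA x - expsum x n) < e.
Proof.
move=> e0; have e2 : 0 < e / 2 by rewrite divr_gt0.
have [N HN] := @expsum_cauchy rho _ e2; exists N => x n xr Nn.
have [M HM] := expA_cvg x e2; pose m := maxn n M.
rewrite -(subrKA (expsum x m)) [e]splitr.
apply: (le_lt_trans (nrD _ _)); apply: ltrD; first by apply: HM; rewrite leq_maxr.
by apply: HN => //; rewrite leq_maxl.
Qed.

Lemma expA_comm (x : A) : x * expA x = expA x * x.
Proof.
apply/eqP; rewrite -subr_eq0; apply/eqP/nr_small => e e0.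
have p0 : 0 < 2 * (nr x + 1) by rewrite mulr_gt0 // ltr_wpDl // nr_ge0.
have [N HN] := expA_cvg x (divr_gt0 e0 p0).
have {HN} := HN N (leqnn N); set d := nr _ => dN.
have cS : x * expsum x N = expsum x N * x.
  rewrite /expsum mulr_sumr mulr_suml; apply: eq_bigr => k _.
  by rewrite -scalerAr -scalerAl -exprS -exprSr.
have -> : x * expA x - expA x * x = x * (expA x - expsum x N) - (expA x - expsum x N) * x.
  by rewrite mulrBr mulrBl cS opprB addrA subrK.
apply: (le_lt_trans (nrB _ _)); apply: (le_lt_trans (lerD (nrM _ _) (nrM _ _))).
have d0 : 0 <= d by apply: nr_ge0.
have x0 := nr_ge0 x.
move: dN; rewrite ltr_pdivlMr // -/d; nra.
Qed.

Lemma expA_nil (x : A) d : x ^+ d = 0 -> expA x = expsum x d.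
Proof.
move=> xd; apply/eqP; rewrite -subr_eq0; apply/eqP/nr_small => e e0.
have [N HN] := expA_cvg x e0; have := HN (maxn N d) (leq_maxl _ _).
suff -> : expsum x (maxn N d) = expsum x d by [].
apply/eqP; rewrite -subr_eq0 expsumB ?leq_maxr //; apply/eqP.
rewrite big_nat big1 // => k /andP[dk _].
by rewrite -(subnK dk) exprD xd mulr0 scaler0.
Qed.

Lemma geo_quarter n : \sum_(2 <= k < n) (4^-1 : R) ^+ k.-1 <= 2^-1.
Proof.
have pos m : 0 <= (4^-1 : R) ^+ m by rewrite exprn_ge0 // invr_ge0.
suff H m : \sum_(2 <= k < m.+2) (4^-1 : R) ^+ k.-1 <= 3^-1 - 4 / 3 * 4^-1 ^+ m.+1.
  case: n => [|[|m]]; try by rewrite big_geq // invr_ge0.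
  by apply: (le_trans (H m)); have := pos m.+1; lra.
elim: m => [|m IH]; first by rewrite big_geq // expr1; lra.
rewrite big_nat_recr //=; apply: (le_trans (lerD IH (lexx _))).
rewrite [X in _ <= _ - _ * X]exprS.
by have := pos m.+1; lra.
Qed.

(* [expA x - 1 = x + x W] with [nr W <= 1/2]. *)
Lemma expA_cancel (x y : A) : nr x <= 4^-1 -> y * (expA x - 1) = 0 -> y * x = 0.
Proof.
move=> x4 yE; apply: nr_small => e e0.
have p0 : 0 < 2 * (nr y + 1) by rewrite mulr_gt0 // ltr_wpDl // nr_ge0.
have [N0 HN] := expA_cvg x (divr_gt0 e0 p0); pose N := N0.+2.
have {HN} := HN N (leqW (leqW (leqnn N0))); set d := nr _ => dN.
pose W := \sum_(2 <= k < N) (k`!%:R : R[i])^-1 *: x ^+ k.-1.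
have SW : expsum x N = 1 + x + x * W.
  rewrite /expsum -(big_mkord predT (fun k => (k`!%:R : R[i])^-1 *: x ^+ k)).
  rewrite (big_cat_nat (n := 2)) //= big_ltn // big_ltn // big_geq //.
  rewrite !fact0 expr0 expr1 invr1 !scale1r addr0; congr (_ + _).
  rewrite mulr_sumr big_nat [RHS]big_nat; apply: eq_bigr => -[|k] // _.
  by rewrite -scalerAr -exprS.
have nW : nr W <= 2^-1.
  apply: (le_trans (nr_sum _ _)); apply: le_trans (geo_quarter N).
  rewrite big_nat [leRHS]big_nat; apply: ler_sum => -[|[|k]] // _.
  rewrite nrZ cmod_natV -[leRHS]mul1r; apply: ler_pM => //.
  - exact: nr_ge0.
  - by rewrite invf_le1 ?ltr0n ?fact_gt0 // ler1n fact_gt0.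
  - have nX j : nr (x ^+ j.+1) <= nr x ^+ j.+1.
      elim: j => [|j IH]; first by rewrite !expr1.
      rewrite exprS [leRHS]exprS; apply: (le_trans (nrM _ _)).
      by apply: ler_wpM2l => //; exact: nr_ge0.
    by apply: (le_trans (nX k)); apply: lerXn2r => //; rewrite nnegrE ?nr_ge0 ?invr_ge0.
have e1 : y * x = - (y * (expA x - expsum x N)) - y * x * W.
  have -> : expA x - expsum x N = (expA x - 1) - x - x * W.
    by rewrite SW !opprD !addrA.
  by rewrite mulrBr [y * (_ - x)]mulrBr yE sub0r opprD !opprK mulrA addrK.
have : nr (y * x) <= nr y * d + nr (y * x) * 2^-1.
  rewrite {1}e1; apply: (le_trans (nrB _ _)); rewrite nrN; apply: lerD.
    exact: nrM.
  by apply: (le_trans (nrM _ _)); apply: ler_wpM2l => //; exact: nr_ge0.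
have := nr_ge0 y; have : 0 <= d by apply: nr_ge0.
move: dN; rewrite ltr_pdivlMr //; move: (nr (y * x)) (nr y) => u v; nra.
Qed.

(** Each use of [expA_cancel] trades one factor [expA x - 1] for a factor [x]. *)
Lemma expA_unipotent (x : A) k : nr x <= 4^-1 -> (expA x - 1) ^+ k = 0 -> x ^+ k = 0.
Proof.
move=> x4 Ek.
have cX : GRing.comm x (expA x - 1).
  by rewrite /GRing.comm mulrBr mulrBl expA_comm mulr1 mul1r.
suff H j : (j <= k)%N -> (expA x - 1) ^+ (k - j) * x ^+ j = 0.
  by have := H k (leqnn k); rewrite subnn mul1r.
elim: j => [|j IH] jk; first by rewrite subn0 mulr1.
have := IH (ltnW jk); rewrite -[(k - j)%N]prednK ?subn_gt0 // -subnS exprSr -mulrA.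
rewrite (commrX j (commr_sym cX)) mulrA => /(expA_cancel x4).
by rewrite -mulrA -exprSr.
Qed.

End Exponential.

Lemma primitive_root_exists (F : numClosedFieldType) n : (0 < n)%N ->
  exists z : F, n.-primitive_root z.
Proof.
move=> n_gt0; pose p : {poly F} := 'X^n - 1.
have [r Dp] := closed_field_poly_normal p.
rewrite (monicP _) ?monicXnsubC // scale1r in Dp.
have rn1 : all n.-unity_root r by apply/allP=> z; rewrite -root_prod_XsubC -Dp.
have sz_r : (n < (size r).+1)%N.
  by rewrite -(size_prod_XsubC r id) -Dp size_XnsubC.
have [|z] := hasP (has_prim_root n_gt0 rn1 _ sz_r); last by exists z.
by rewrite -separable_prod_XsubC -Dp separable_Xn_sub_1 // pnatr_eq0 -lt0n.
Qed.

Section Banach.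
Context (R : realType) (B : completeNormedModType R[i]) (mul : B -> B -> B) (one : B).
Context (HB : banach_algebra mul one) (one_neq0 : one != 0).
Notation A := (balg HB one_neq0).
Notation nr := (@nr R B mul one HB one_neq0).
Notation expA := (@expA R B mul one HB one_neq0).

Lemma cmod1 : cmod (1 : R[i]) = 1.
Proof. by rewrite -[1 in LHS](rmorph1 (real_complex R)) cmod_real. Qed.

Lemma cmodX (a : R[i]) n : cmod (a ^+ n) = cmod a ^+ n.
Proof. by elim: n => [|n IH]; rewrite ?cmod1 // !exprS cmodM IH. Qed.

Definition adA (h y : A) : A := h * y - y * h.

Lemma adA_lin h : linmap (adA h).
Proof.
by move=> m u v; rewrite /adA mulrDr mulrDl -scalerAr -scalerAl opprD addrACA scalerBr.
Qed.

(** The operator [adA h] has norm at most [2 * nr h], which bounds its eigenvalues. *)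
Lemma geig_bounded (h z : A) c n : 2 * nr h < cmod c -> geig (adA h) c n z -> z = 0.
Proof.
move=> hc; elim: n z => [|n IH] z; first by [].
rewrite /geig iterS => e.
suff : iter n (gshift (adA h) c) z = 0 by move/IH.
set w := iter n _ z in e *; apply: nr0_eq; apply/eqP; rewrite eq_le nr_ge0 andbT.
have cw : c *: w = adA h w by move/eqP: e; rewrite subr_eq0 => /eqP.
have : cmod c * nr w <= 2 * nr h * nr w.
  rewrite -nrZ cw; apply: (le_trans (nrB _ _)).
  by apply: (le_trans (lerD (nrM _ _) (nrM _ _))); rewrite [nr w * _]mulrC -mulrDl -mulr2n mulr_natl.
have := nr_ge0 w; nra.
Qed.

Lemma geig_nilpotent (h y : A) nu n : nu != 0 -> geig (adA h) nu n y -> exists k, y ^+ k = 0.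
Proof.
move=> nu0 yn.
have yk k : exists m, geig (adA h) (k%:R * nu) m (y ^+ k).
  elim: k => [|k [m IH]].
    by exists 1%N; rewrite mul0r /geig /gshift /= scale0r subr0 /adA mulr1 mul1r subrr.
  exists (n + m)%N; rewrite -natr1 mulrDl mul1r addrC exprS.
  apply: (geig_leibniz (f1 := adA h) (f2 := adA h)) yn IH => [|a|b|a b].
  - exact: adA_lin.
  - exact: linmap_mull.
  - exact: linmap_mulr.
  - by rewrite /adA mulrBl mulrBr !mulrA addrA subrK.
have cnu : 0 < cmod nu.
  by rewrite lt_neqAle cmod_ge0 andbT eq_sym; apply: contra nu0 => /eqP /cmod_eq0 ->.
pose k := Num.bound (2 * nr h / cmod nu).
have [m ykm] := yk k; exists k; apply: geig_bounded ykm.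
have -> : k%:R * nu = (k%:R : R)%:C%C * nu by rewrite rmorph_nat.
rewrite cmodM cmod_real ?ler0n // -ltr_pdivrMr //.
apply: le_lt_trans (archi_boundP _); rewrite ?ler_norm //.
by rewrite divr_ge0 // ?cmod_ge0 // mulr_ge0 ?nr_ge0.
Qed.

(* Averaging over the [n]-th roots of unity extracts the coefficient [x^k / k!]. *)
Lemma cauchy_estimate (x : A) k (r M : R) : 0 < r ->
  (forall z, cmod z = r -> nr (expA (z *: x)) <= M) -> r ^+ k * nr (x ^+ k) <= k`!%:R * M.
Proof.
move=> r0 HM; have k0 : 0 < (k`!%:R : R) by rewrite ltr0n fact_gt0.
rewrite -ler_pdivrMl //; apply/ler_addgt0Pr => e e0.
(* Besides controlling the tail, [n] exceeds [k], so that the term of index [k] occurs and is the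
   only index below [n] congruent to [k]. *)
have [N HN] := expA_tail HB one_neq0 (r * nr x) e0; pose n := maxn N k.+1.
have kn : (k < n)%N by rewrite leq_max leqnn orbT.
have n0 : (0 < n)%N by apply: leq_ltn_trans kn.
have [w wp] := @primitive_root_exists R[i] n n0.
have c1 : cmod (w : R[i]) = 1.
  apply/eqP; rewrite -(@pexpr_eq1 _ _ n) ?cmod_ge0 // -cmodX (prim_expr_order wp).
  by rewrite cmod1.
have cw j : cmod (w ^+ j) = 1 by rewrite cmodX c1 expr1n.
(* The exponent [n - k] stands for [- k], since [w ^+ n = 1]. *)
have sumw m : (m < n)%N -> \sum_(j < n) (w ^+ j) ^+ (n - k) * (w ^+ j) ^+ m = (n%:R * (m == k)%:R : R[i]).
  move=> mn; have -> : \sum_(j < n) (w ^+ j) ^+ (n - k) * (w ^+ j) ^+ m = \sum_(j < n) (w ^+ (n - k + m)) ^+ j.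
    by apply: eq_bigr => j _; rewrite -exprD -!exprM mulnC.
  case: (eqVneq m k) => [->|mk].
    rewrite mulr1 subnK ?(ltnW kn) // (prim_expr_order wp).
    by under eq_bigr do rewrite expr1n; rewrite sumr_const card_ord.
  rewrite mulr0; set z := w ^+ (n - k + m).
  have zn : z ^+ n = 1 by rewrite -exprM mulnC exprM (prim_expr_order wp) expr1n.
  have z1 : z - 1 != 0.
    rewrite subr_eq0 -(prim_order_dvd wp); apply/negP => /dvdnP [q qe].
    case: q qe => [|[|q]] qe; move: qe mk; first by lia.
      by rewrite mul1n => qe /eqP; lia.
    by rewrite !mulSn => qe /eqP; lia.
  apply: (mulfI z1); rewrite mulr0 -subrX1 zn subrr //.
have key : \sum_(j < n) ((w ^+ j) ^+ (n - k)) *: expsum ((w ^+ j * r%:C%C) *: x) n =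
    (n%:R * (r%:C%C ^+ k * (k`!%:R)^-1) : R[i]) *: x ^+ k.
  rewrite /expsum; under eq_bigr do rewrite scaler_sumr.
  rewrite exchange_big /= (bigD1 (Ordinal kn)) //= [X in _ + X]big1 ?addr0 => [|m mk].
    under eq_bigr => j _.
      rewrite exprZn !scalerA exprMn; rewrite [X in X *: _](_ : _ = (w ^+ j) ^+ (n - k) * (w ^+ j) ^+ k * (r%:C%C ^+ k * (k`!%:R)^-1)); last by ring.
      over.
    by rewrite -scaler_suml -mulr_suml sumw // eqxx mulr1.
  under eq_bigr => j _.
    rewrite exprZn !scalerA exprMn; rewrite [X in X *: _](_ : _ = (w ^+ j) ^+ (n - k) * (w ^+ j) ^+ m * (r%:C%C ^+ m * (m`!%:R)^-1)); last by ring.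
    over.
  have mk' : (m == k :> nat) = false by apply: negbTE; apply: contra mk => /eqP mk; apply/eqP/val_inj.
  by rewrite -scaler_suml -mulr_suml sumw // mk' mulr0 mul0r scale0r.
have nn : 0 < (n%:R : R) by rewrite ltr0n.
rewrite -(ler_pM2l nn).
have cn : cmod (n%:R : R[i]) = n%:R.
  by rewrite -(rmorph_nat (real_complex R)) cmod_real // ler0n.
have -> : n%:R * (k`!%:R^-1 * (r ^+ k * nr (x ^+ k))) =
    nr ((n%:R * (r%:C%C ^+ k * (k`!%:R)^-1) : R[i]) *: x ^+ k).
  rewrite nrZ !cmodM cmodX cn cmod_natV cmod_real ?ltW //; ring.
rewrite -key; apply: (le_trans (nr_sum _ _)).
have -> : n%:R * (M + e) = \sum_(j < n) (M + e) by rewrite sumr_const card_ord mulr_natl.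
apply: ler_sum => j _; rewrite nrZ cmodX cw expr1n mul1r.
set z := w ^+ j * _; have cz : cmod z = r by rewrite /z cmodM cw mul1r cmod_real // ltW.
rewrite -[expsum _ _](subKr (expA (z *: x))); apply: (le_trans (nrB _ _)).
apply: lerD; first exact: HM.
by apply/ltW/HN; rewrite ?leq_maxl // nrZ cz.
Qed.

End Banach.

(** * Norms on the nilpotent radical *)

Lemma mx_entry_norm (R : realType) k (u : 'rV[R]_k) i : `|u 0 i| <= `|u|.
Proof.
rewrite /Num.norm /= mx_normrE; exact: (le_bigmax _ (fun i => `|u i.1 i.2|) (0, i)).
Qed.

(** The function [F] is Lipschitz, hence continuous, and positive on the compact unit sphere; its
    minimum there is the constant. *)
Lemma seminorm_lower_bound (R : realType) k (F : 'rV[R]_k -> R) :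
  (forall u v, F (u + v) <= F u + F v) -> (forall t u, F (t *: u) = `|t| * F u) ->
  (forall u, F u = 0 -> u = 0) -> exists2 d, 0 < d & forall u, d * `|u| <= F u.
Proof.
move=> FD FZ F0.
have F00 : F 0 = 0 by rewrite -(scale0r 0) FZ normr0 mul0r.
have FN u : F (- u) = F u by rewrite -scaleN1r FZ normrN1 mul1r.
have Fge u : 0 <= F u.
  by have := FD u (- u); rewrite subrr F00 FN; lra.
pose K := \sum_i F (delta_mx 0 i).
have FK u : F u <= K * `|u|.
  rewrite {1}(matrix_sum_delta u) big_ord1 /K mulr_suml.
  elim/big_rec2: _ => [|i y z _ IH]; first by rewrite F00.
  apply: (le_trans (FD _ _)); apply: lerD => //.
  by rewrite FZ mulrC; apply: ler_wpM2l => //; exact: mx_entry_norm.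
have K0 : 0 <= K by apply: sumr_ge0.
have Fcont : continuous F.
  move=> u; apply/(@cvgrPdist_lt _ _ _ (nbhs u) _ F (F u)) => e e0.
  have d0 : 0 < e / (K + 1) by rewrite divr_gt0 // ltr_wpDl.
  have N : \forall v \near u, `|u - v| < e / (K + 1) by apply/nbhs_normP; exists (e / (K + 1)).
  apply: filterS N => v uv.
  have lip : `|F u - F v| <= K * `|u - v|.
    have h1 := FD (u - v) v; have h2 := FD (v - u) u; rewrite !subrK in h1 h2.
    have h3 := FK (u - v); have h4 : F (v - u) <= K * `|u - v| by rewrite distrC; apply: FK.
    rewrite ler_norml; apply/andP; split; lra.
  apply: (le_lt_trans lip).
  move: uv; rewrite ltr_pdivlMr ?ltr_wpDl //; have := normr_ge0 (u - v); nra.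
(* For [k = 0] the sphere is empty and has no minimum. *)
case: k F FD FZ F0 F00 FN Fge K FK K0 Fcont => [|k] F FD FZ F0 F00 FN Fge K FK K0 Fcont.
  by exists 1 => // u; rewrite [u]thinmx0 normr0 mulr0.
pose S : set 'rV[R]_k.+1 := [set u | `|u| = 1]%classic.
have Sc : compact S.
  apply: bounded_closed_compact.
    by exists 1; split; [exact: num_real|move=> x x1 u /= ->; exact: ltW].
  rewrite /S -[X in closed X]/((fun u : 'rV[R]_k.+1 => `|u|) @^-1` [set x | x = 1])%classic.
  apply: preimage_closed; first by move=> u _; exact: norm_continuous.
  exact: closed_eq.
have S0 : (S !=set0)%classic.
  exists (const_mx 1); rewrite /S /= /Num.norm /= mx_normrE.
  apply/eqP; rewrite eq_le; apply/andP; split.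
    by apply: bigmax_le => // i _; rewrite mxE normr1.
  have := le_bigmax 0 (fun i : 'I_1 * 'I_k.+1 => `|(const_mx 1 : 'rV[R]_k.+1) i.1 i.2|) (0, 0).
  by rewrite mxE normr1.
have [c cS Hc] := EVT_min_rV S0 Sc (continuous_subspaceT Fcont).
have c1 : `|c| = 1 by move: cS; rewrite inE.
have Fc : 0 < F c.
  rewrite lt_neqAle Fge andbT eq_sym; apply/negP => /eqP /F0 c0.
  by move: c1; rewrite c0 normr0 => /eqP; rewrite eq_sym oner_eq0.
exists (F c) => // u; have [->|u0] := eqVneq u 0; first by rewrite normr0 mulr0.
have nu : 0 < `|u| by rewrite normr_gt0.
rewrite -ler_pdivlMr // mulrC -[`|u|^-1]ger0_norm ?invr_ge0 // -FZ; apply: Hc.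
by rewrite inE /S /= normrZ normfV normr_id mulVf // gt_eqF.
Qed.

(** A countable set has Lebesgue measure 0, while the unit interval has measure 1. *)
Lemma complex_uncountable (R : realType) : ~ countable (setT : set R[i]).
Proof.
move=> /countable_injP [f finj].
have cR : countable (`[0, 1]%classic : set R).
  apply/countable_injP; exists (fun t => f t%:C%C) => s t _ _ e.
  by apply: (@complexI R); apply: finj; rewrite ?inE.
have := countable_lebesgue_measure0 cR; rewrite lebesgue_measure_itv /=.
by rewrite lte_fin ltr01 -EFinB subr0 => -[] /eqP; rewrite oner_eq0.
Qed.

Lemma cmodD (R : realType) (a b : R[i]) : cmod (a + b) <= cmod a + cmod b.
Proof. by have := ler_normD a b; rewrite !cmodE -rmorphD lecR. Qed.

Lemma cmod_realabs (R : realType) (t : R) : cmod t%:C%C = `|t|.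
Proof.
case: (lerP 0 t) => [t0|/ltW t0]; first by rewrite cmod_real // ger0_norm.
have -> : t%:C%C = - (- t)%:C%C by rewrite rmorphN opprK.
by rewrite /cmod normrN -/(cmod _) cmod_real ?oppr_ge0 // ler0_norm.
Qed.

Lemma cmod_i (R : realType) : cmod ('i%C : R[i]) = 1.
Proof. by rewrite complexiE /cmod normCi. Qed.

Section Bounded.
Context (R : realType) (B : completeNormedModType R[i]) (mul : B -> B -> B) (one : B).
Context (HB : banach_algebra mul one) (one_neq0 : one != 0).
Notation A := (balg HB one_neq0).
Notation nr := (@nr R B mul one HB one_neq0).

Context (g : vectType R[i]) (n : g -> Prop) (nrm : g -> R) (phi : g -> A).
Hypothesis nsub : is_subspace n.
Hypothesis Hnrm : norm_on n nrm.
Hypothesis phi_lin : linmap phi.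

Lemma nrm_scale a x : n x -> nrm (a *: x) = cmod a * nrm x.
Proof. by case: Hnrm => _ _ H _ nx; have := H a x nx; rewrite cmodE -rmorphM => -[]. Qed.

Lemma norm_on_bound : exists2 K, 0 <= K & forall x, n x -> nr (phi x) <= K * nrm x.
Proof.
have [ge0 eq0 _ tri] := Hnrm.
have [U HU] := subspace_vspace nsub; pose d := \dim U.
pose b (j : 'I_d) := (vbasis U)`_j.
have nb j : n (b j) by apply/HU/vbasis_mem/mem_nth; rewrite size_tuple.
(* Real and imaginary parts give [d + d] real coordinates, to which the compactness bound over [R]
   applies. *)
pose cf (u : 'rV[R]_(d + d)) j : R[i] := (u 0 (lshift d j))%:C%C + 'i%C * (u 0 (rshift d j))%:C%C.
pose L u := \sum_j cf u j *: b j.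
have nL u : n (L u) by apply: (subspace_sum nsub) => j _; apply: (subspaceZ nsub).
have LD u v : L (u + v) = L u + L v.
  rewrite /L -big_split; apply: eq_bigr => j _ /=; rewrite -scalerDl; congr (_ *: _).
  by rewrite /cf !mxE !rmorphD mulrDr addrACA.
have LZ t u : L (t *: u) = t%:C%C *: L u.
  rewrite /L scaler_sumr; apply: eq_bigr => j _; rewrite scalerA; congr (_ *: _).
  by rewrite /cf !mxE !rmorphM mulrDr; congr (_ + _); rewrite mulrCA.
have [|||dl dl0 Hdl] := @seminorm_lower_bound R (d + d) (fun u => nrm (L u)).
- by move=> u v; rewrite LD; apply: tri.
- by move=> t u; rewrite LZ nrm_scale // cmod_realabs.
- move=> u /(eq0 _ (nL u)) Lu0.
  have c0 j : cf u j = 0.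
    by have /freeP H := basis_free (vbasisP U); exact: (H (cf u) Lu0 j).
  apply/rowP => k; rewrite mxE; case: (splitP k) => j kj.
    have -> : k = lshift d j by apply: val_inj.
    have := congr1 (@complex.Re R) (c0 j); rewrite /cf /=.
    by rewrite ?mul0r ?mulr0 ?subr0 ?oppr0 ?addr0 ?add0r ?subrr ?addr0 => ->.
  have -> : k = rshift d j by apply: val_inj.
  have := congr1 (@complex.Im R) (c0 j); rewrite /cf /=.
  by rewrite ?mul0r ?mulr0 ?mul1r ?add0r ?addr0 => ->.
pose M := \sum_j 2 * nr (phi (b j)).
have M0 : 0 <= M by apply: sumr_ge0 => j _; rewrite mulr_ge0 // nr_ge0.
exists (M / dl); first by rewrite divr_ge0 // ltW.
move=> x nx; have xU : x \in U by apply/HU.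
pose u : 'rV[R]_(d + d) := row_mx (\row_j complex.Re (coord (vbasis U) j x)) (\row_j complex.Im (coord (vbasis U) j x)).
have xL : x = L u.
  rewrite {1}(coord_vbasis xU); apply: eq_bigr => j _; congr (_ *: _).
  by rewrite /cf /u row_mxEl row_mxEr !mxE -complexE.
have cfu j : cmod (cf u j) <= 2 * `|u|.
  apply: (le_trans (cmodD _ _)); rewrite cmodM cmod_i mul1r !cmod_realabs mulr_natl mulr2n.
  by apply: lerD; apply: mx_entry_norm.
have : nr (phi x) <= M * `|u|.
  rewrite xL (linmap_sum phi_lin) mulr_suml; apply: (le_trans (nr_sum _ _)).
  apply: ler_sum => j _; rewrite (linmapZ phi_lin) nrZ mulrAC.
  by apply: ler_wpM2r; [exact: nr_ge0|exact: cfu].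
move=> /le_trans; apply; rewrite -mulrA; apply: ler_wpM2l => //.
by rewrite mulrC ler_pdivlMr // mulrC xL; apply: Hdl.
Qed.

End Bounded.

(** * Density, growth, and the equivalences *)

Section Density.
Context (R : realType) (B : completeNormedModType R[i]) (mul : B -> B -> B) (one : B).
Context (HB : banach_algebra mul one) (one_neq0 : one != 0).
Notation A := (balg HB one_neq0).
Notation nr := (@nr R B mul one HB one_neq0).

Definition cont_at k (a : 'I_k -> A) (F : ('I_k -> A) -> A) :=
  forall e : R, 0 < e -> exists2 d, 0 < d &
    forall a', (forall i, nr (a i - a' i) < d) -> nr (F a - F a') < e.

Lemma cont_at_mul k (a : 'I_k -> A) F G :
  cont_at a F -> cont_at a G -> cont_at a (fun a => F a * G a).
Proof.
move=> cF cG e e0.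
have f0 := nr_ge0 (F a); have g0 := nr_ge0 (G a).
have pG : 0 < 2 * (nr (G a) + 1) by lra.
have pF : 0 < 2 * (nr (F a) + 1) by lra.
have [dF dF0 HF] := cF _ (divr_gt0 e0 pG).
have [dG dG0 HG] := cG _ (divr_gt0 e0 pF).
have [d1 d10 H1] := cG 1 ltr01.
exists (Order.min dF (Order.min dG d1)); first by rewrite !lt_min dF0 dG0 d10.
move=> a' Ha'.
have hF : nr (F a - F a') < e / (2 * (nr (G a) + 1)).
  by apply: HF => i; apply: (lt_le_trans (Ha' i)); rewrite ge_min lexx.
have hG : nr (G a - G a') < e / (2 * (nr (F a) + 1)).
  by apply: HG => i; apply: (lt_le_trans (Ha' i)); rewrite !ge_min lexx orbT.
have h1 : nr (G a - G a') < 1.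
  by apply: H1 => i; apply: (lt_le_trans (Ha' i)); rewrite !ge_min lexx !orbT.
have g' : nr (G a') <= nr (G a) + 1.
  have := nrB (G a) (G a - G a'); rewrite subKr => /le_trans; apply.
  by rewrite lerD2l ltW.
have -> : F a * G a - F a' * G a' = (F a - F a') * G a' + F a * (G a - G a').
  by rewrite mulrBl mulrBr [RHS]addrC addrA subrK.
apply: (le_lt_trans (nrD _ _)); apply: (le_lt_trans (lerD (nrM _ _) (nrM _ _))).
move: hF hG; rewrite !ltr_pdivlMr //.
have x0 := nr_ge0 (F a - F a'); have y0 := nr_ge0 (G a - G a').
move: (nr (F a - F a')) (nr (G a - G a')) (nr (G a')) (nr (G a)) (nr (F a)) g' x0 y0 f0 g0.
move=> x y z gg ff; nra.
Qed.

Lemma cont_at_word k (a : 'I_k -> A) w : cont_at a (fun a => \prod_(i <- w) a i).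
Proof.
elim: w => [|i w IH].
  by move=> e e0; exists 1 => // a' _; rewrite !big_nil subrr nr0.
have -> : (fun a : 'I_k -> A => \prod_(j <- i :: w) a j) = (fun a => a i * \prod_(j <- w) a j).
  by apply/funext => b; rewrite big_cons.
apply: cont_at_mul => // e e0; by exists e.
Qed.

Lemma cont_at_sum k (a : 'I_k -> A) (S : seq (seq 'I_k)) (c : seq 'I_k -> R[i]) :
  cont_at a (fun a => \sum_(w <- S) c w *: \prod_(i <- w) a i).
Proof.
elim: S => [|w S IH] e e0.
  by exists 1 => // a' _; rewrite !big_nil subrr nr0.
have e2 : 0 < e / 2 by rewrite divr_gt0.
have c0 : 0 < cmod (c w) + 1 by rewrite ltr_wpDl // cmod_ge0.
have [d1 d10 H1] := IH _ e2.
have [d2 d20 H2] := cont_at_word a w (divr_gt0 e2 c0).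
exists (Order.min d1 d2); first by rewrite lt_min d10 d20.
move=> a' Ha'; rewrite !big_cons opprD addrACA -scalerBr [e]splitr.
apply: (le_lt_trans (nrD _ _)); apply: ltrD.
  rewrite nrZ; have := H2 a'; set y := nr _ => Hy.
  have {}Hy : y < e / 2 / (cmod (c w) + 1).
    by apply: Hy => i; apply: (lt_le_trans (Ha' i)); rewrite ge_min lexx orbT.
  have y0 : 0 <= y by apply: nr_ge0.
  move: Hy; rewrite ltr_pdivlMr //; lra.
by apply: H1 => i; apply: (lt_le_trans (Ha' i)); rewrite ge_min lexx.
Qed.

Lemma dense_pi (D : A -> Prop) k (S : seq (seq 'I_k)) (c : seq 'I_k -> R[i]) :
  (forall y e, 0 < e -> exists2 x, D x & nr (y - x) < e) ->
  (forall a, (forall i, D (a i)) -> \sum_(w <- S) c w *: \prod_(i <- w) a i = 0) ->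
  forall a : 'I_k -> A, \sum_(w <- S) c w *: \prod_(i <- w) a i = 0.
Proof.
move=> dD pD a; apply: nr_small => e e0.
have [d d0 Hd] := cont_at_sum a S c e0.
have /choice [a' Ha'] : forall i, exists x, D x /\ nr (a i - x) < d.
  by move=> i; have [x] := dD (a i) d d0; exists x.
have P0 := pD a' (fun i => proj1 (Ha' i)).
by have := Hd a' (fun i => proj2 (Ha' i)); rewrite P0 subr0.
Qed.

Lemma closure_dense (D : set B) : (closure D = setT)%classic ->
  forall (y : A) e, 0 < e -> exists2 x : A, D x & nr (y - x) < e.
Proof.
move=> cD y e e0; have : closure D (y : B) by rewrite cD.
move=> /(_ [set x | `|(y : B) - x| < e%:C%C]%classic) [].
  by apply/nbhs_normP; exists e%:C%C => //=; rewrite ltcR.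
by move=> x [Dx /=]; rewrite (@nrE _ _ _ _ HB one_neq0) ltcR => h; exists x.
Qed.

End Density.

Section Growth.
Context (R : realType) (B : completeNormedModType R[i]) (mul : B -> B -> B) (one : B).
Context (HB : banach_algebra mul one) (one_neq0 : one != 0).
Notation A := (balg HB one_neq0).
Notation nr := (@nr R B mul one HB one_neq0).
Notation expA := (@expA R B mul one HB one_neq0).

(** For [m >= alpha] and radius [r >= 1], [cauchy_estimate] in degree [m.+1] sets [r ^+ m.+1]
    against growth of order [r ^+ m]; a large [r] forces [x ^+ m.+1 = 0]. *)
Lemma polynomial_growth_nilpotent (x : A) (Cc alpha a : R) :
  0 <= a -> 0 < Cc -> 0 < alpha ->
  (forall z, nr (expA (z *: x)) <= Cc * (1 + cmod z * a) `^ alpha) -> exists k, x ^+ k = 0.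
Proof.
move=> a0 C0 al0 H; pose m := Num.bound alpha; exists m.+1.
have am : alpha <= m%:R by apply/ltW/archi_boundP/ltW.
pose T := (m.+1)`!%:R * (Cc * (1 + a) ^+ m).
have a1 : 0 <= (1 + a) ^+ m by rewrite exprn_ge0 // addr_ge0.
have T0 : 0 <= T by rewrite !mulr_ge0 // ltW.
have key r : 1 <= r -> r * nr (x ^+ m.+1) <= T.
  move=> r1; have r0 : 0 < r by apply: lt_le_trans r1.
  have ra : 0 <= r * a by rewrite mulr_ge0 // ltW.
  have rm : 0 < r ^+ m by rewrite exprn_gt0.
  rewrite -(ler_pM2l rm) mulrA -exprSr.
  apply: (le_trans (@cauchy_estimate _ _ _ _ HB one_neq0 x m.+1 r (Cc * (r ^+ m * (1 + a) ^+ m)) r0 _)).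
    move=> z cz; apply: (le_trans (H z)); rewrite cz; apply: ler_wpM2l; first exact: ltW.
    apply: (@le_trans _ _ ((1 + r * a) `^ m%:R)); first by apply: ler_powR => //; lra.
    rewrite powR_mulrn; last by lra.
    by rewrite -exprMn; apply: lerXn2r; rewrite ?nnegrE; nra.
  by rewrite /T le_eqVlt; apply/orP; left; apply/eqP; ring.
apply: nr0_eq; apply/eqP; rewrite eq_le nr_ge0 andbT leNgt; apply/negP => p0.
(* At this radius the left side of [key] is [nr (x ^+ m.+1) + T]. *)
have r1 : 1 <= 1 + T / nr (x ^+ m.+1) by rewrite lerDl divr_ge0 // ltW.
have := key _ r1; rewrite mulrDl mul1r divfK ?gt_eqF //; lra.
Qed.

Lemma expA_nil_bound (x : A) d : x ^+ d = 0 -> nr (expA x) <= d%:R * nr 1 * (1 + nr x) ^+ d.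
Proof.
move=> xd; rewrite (expA_nil xd); apply: (le_trans (nr_sum _ _)).
have -> : d%:R * nr 1 * (1 + nr x) ^+ d = \sum_(k < d) nr 1 * (1 + nr x) ^+ d.
  by rewrite sumr_const card_ord -[RHS]mulr_natl mulrA.
have x0 := nr_ge0 x.
apply: ler_sum => k _; rewrite nrZ cmod_natV -[leRHS]mul1r; apply: ler_pM.
- by rewrite invr_ge0.
- exact: nr_ge0.
- by rewrite invf_le1 ?ltr0n ?fact_gt0 // ler1n fact_gt0.
apply: (le_trans (nrX _ _)); apply: ler_wpM2l; first exact: nr_ge0.
apply: (@le_trans _ _ ((1 + nr x) ^+ k)).
  by apply: lerXn2r; rewrite ?nnegrE; lra.
by apply: ler_weXn2l; [lra|apply: ltnW].
Qed.

Lemma expA_nil_unipotent (x : A) d : x ^+ d = 0 -> (expA x - 1) ^+ d = 0.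
Proof.
case: d => [|d] xd; first by rewrite expr0 in xd.
rewrite (expA_nil xd) /expsum big_ord_recl fact0 invr1 scale1r expr0 addrAC subrr add0r.
pose W : A := \sum_(k < d) (k.+1`!%:R : R[i])^-1 *: x ^+ k.
have cW : x * W = W * x.
  by rewrite mulr_sumr mulr_suml; apply: eq_bigr => k _; rewrite -scalerAr -scalerAl -exprS -exprSr.
have -> : \sum_(k < d) ((lift ord0 k)`!%:R : R[i])^-1 *: x ^+ lift ord0 k = x * W.
  by rewrite mulr_sumr; apply: eq_bigr => k _; rewrite -scalerAr -exprS.
by rewrite exprMn_comm // xd mul0r.
Qed.

End Growth.

(** * The implications between the conditions *)

Section Equivalences.
Context (R : realType) (g : vectType R[i]) (br : g -> g -> g).
Hypothesis Hbr : lie_bracket br.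
Context (B : completeNormedModType R[i]) (mul : B -> B -> B) (one : B).
Hypothesis HB : banach_algebra mul one.
Context (nrm : g -> R) (phi : g -> B).
Hypothesis Hnrm : norm_on (nil_radical br) nrm.
Hypothesis Hphi : lie_hom_to br mul phi.
Hypothesis Hdense : (closure (ualg_gen mul one (phi @` setT)) = setT)%classic.
Hypothesis one_neq0 : one != 0.
Notation A := (balg HB one_neq0).
Notation n := (nil_radical br).
Notation nil_img := (img (phi : g -> A) n).
Notation all_img := (img (phi : g -> A) (fun=> True)).

Let phi_lin : linmap (phi : g -> A). Proof. by case: Hphi. Qed.
Let phi_br x y : (phi (br x y) : A) = (phi x : A) * (phi y : A) - (phi y : A) * (phi x : A).
Proof. by case: Hphi => _; apply. Qed.

Definition wordnil_img := exists d, wordnil nil_img d.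

Lemma bnilpotentP (x : A) : bnilpotent mul one x <-> exists k, x ^+ k = 0.
Proof. by split=> -[k]; [rewrite balg_powE|rewrite -balg_powE]; exists k. Qed.

Lemma nilpotent_wordnil :
  (forall eta, n eta -> bnilpotent mul one (phi eta)) -> wordnil_img.
Proof.
move=> H; apply: (engel (br_linl Hbr) (br_linr Hbr) (br_anti Hbr) phi_lin phi_br
  (nil_radical_subspace br)).
  by move=> x y _; apply: nil_radical_ideal.
by move=> x /H /bnilpotentP.
Qed.

Lemma wordnil_pow eta d : n eta -> wordnil nil_img d -> (phi eta : A) ^+ d = 0.
Proof.
move=> neta Hd; have := Hd (nseq d (phi eta : A)).
rewrite size_nseq big_nseq iter_mulr_1; apply=> // x.
by rewrite mem_nseq => /andP[_ /eqP ->]; exists eta.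
Qed.

Lemma wordnil_nilpotent :
  wordnil_img -> forall eta, n eta -> bnilpotent mul one (phi eta).
Proof. by move=> [d Hd] eta neta; apply/bnilpotentP; exists d; apply: wordnil_pow. Qed.

(** Elements generated without the unit are combinations of words with at least one letter, so a
    product of [d] of them has at least [d] letters in each word. *)
Lemma nalg_gen_wordnil :
  wordnil_img <-> nilpotent_subalg mul one (nalg_gen mul (phi @` n)%classic).
Proof.
have prodE d (a : 'I_d -> A) : \big[mul/one]_(i < d) a i = \prod_(i < d) a i by [].
split=> -[d Hd]; exists d.
  move=> a Ha; rewrite prodE.
  pose T m := lspan (fun y : A => exists2 k, (m <= k)%N & is_word nil_img k y).
  have Tmul i j x y : T i x -> T j y -> T (i + j)%N (x * y).
    apply: lspan_mul => u v [k ik Hu] [l jl Hv]; apply: lspan_in.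
    by exists (k + l)%N; [exact: leq_add|exact: is_word_cat].
  have T1 x : nalg_gen mul (phi @` n)%classic x -> T 1%N (x : A).
    elim=> {x} [x [eta neta <-]||x y _ Tx _ Ty|c x _ Tx|x y _ Tx _ Ty].
    - by apply: lspan_in; exists 1%N => //; apply: is_word1; exists eta.
    - exact: lspan0.
    - exact: (subspaceD (lspan_subspace _) Tx Ty).
    - exact: (subspaceZ (lspan_subspace _) c Tx).
    - apply: lspan_mono (Tmul _ _ _ _ Tx Ty) => z [k k2 Hk].
      by exists k => //; apply: leq_trans k2.
  have Td k (s : seq 'I_k) (b : 'I_k -> A) : (forall i, T 1%N (b i)) -> T (size s) (\prod_(i <- s) b i).
    move=> Tb; elim: s => [|i s IH].
      by rewrite big_nil; apply: lspan_in; exists 0%N => //; apply: is_word0.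
    by rewrite big_cons; apply: (Tmul 1%N).
  have szI : size (index_enum 'I_d) = d by rewrite -sum1_size sum_nat_const card_ord muln1.
  have := Td d (index_enum 'I_d) a (fun i => T1 _ (Ha i)); rewrite szI => Ta.
  apply: (lspan_eq0 Ta) => y [k dk [s [sk sP ->]]].
  exact: (wordnil_le dk Hd).
move=> s sd sP; case: d / sd Hd => Hd.
rewrite (big_nth 0) big_mkord -prodE; apply: Hd => i.
apply: ng_in; have [eta [neta ->]] := sP _ (mem_nth 0 (ltn_ord i)).
by exists eta.
Qed.

Lemma ualg_gen_words x : ualg_gen mul one (phi @` setT)%classic x -> words_in all_img (x : A).
Proof.
elim=> {x} [x [y _ <-]||x y _ Hx _ Hy|c x _ Hx|x y _ Hx _ Hy].
- by apply: words_in_letter; exists y.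
- exact: words_in1.
- exact: (subspaceD (words_in_sub _) Hx Hy).
- exact: (subspaceZ (words_in_sub _) c Hx).
- exact: words_in_mul Hx Hy.
Qed.

Lemma PI_nilpotent : PI_algebra mul one ->
  forall eta, n eta -> bnilpotent mul one (phi eta).
Proof.
move=> [k [S [c [Su [w wS cw] HPI]]]] eta neta; apply/bnilpotentP.
apply: (pi_nil_radical (@complex_uncountable R) phi_lin phi_br Su wS cw _ neta).
move=> a _; rewrite -[RHS](HPI a); apply: eq_bigr => v _.
by rewrite (balg_eval_word (HB := HB) (one_neq0 := one_neq0)).
Qed.

Lemma wordnil_PI : wordnil_img -> PI_algebra mul one.
Proof.
move=> [d Hd].
have eign y : nonzero_eigvec br y -> exists k, (phi y : A) ^+ k = 0.
  move=> [x [nu [m [nu0 ym]]]]; apply: (geig_nilpotent (h := phi x) nu0 (n := m)).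
  suff E : phi (iter m (gshift (br x) nu) y) = iter m (gshift (adA (phi x : A)) nu) (phi y : A).
    by rewrite /geig -E ym (linmap0 phi_lin).
  elim: m y {ym} => // m IH y; rewrite !iterSr IH; congr (iter _ _ _).
  by rewrite /gshift (linmapB phi_lin) (linmapZ phi_lin) phi_br.
have [k [S [c [Su Sc HPI]]]] := nil_radical_pi Hbr phi_lin phi_br Hd eign.
exists k, S, c; split=> // a.
have dD (y : A) e : 0 < e -> exists2 x : A, words_in all_img x & nr (y - x) < e.
  move=> e0; have [x Dx xe] := closure_dense (HB := HB) (one_neq0 := one_neq0) Hdense y e0.
  by exists x => //; apply: ualg_gen_words.
rewrite -[RHS](dense_pi dD HPI (a : 'I_k -> A)); apply: eq_bigr => v _.
by rewrite (balg_eval_word (HB := HB) (one_neq0 := one_neq0)).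
Qed.

Notation E := (fun eta => bexp mul one (phi eta)).

Lemma wordnil_unipotent : wordnil_img ->
  exists d : nat, forall eta, n eta -> bpow mul one (E eta - one) d = 0.
Proof.
move=> [d Hd]; exists d => eta neta.
rewrite (balg_powE (HB := HB) (one_neq0 := one_neq0)).
exact: expA_nil_unipotent (wordnil_pow neta Hd).
Qed.

Lemma unipotent_nilpotent : (forall eta, n eta -> bnilpotent mul one (E eta - one)) ->
  forall eta, n eta -> bnilpotent mul one (phi eta).
Proof.
move=> H eta neta; apply/bnilpotentP.
have p0 : 0 < 4 * (1 + nr (phi eta : A)) by rewrite mulr_gt0 // ltr_wpDr // nr_ge0.
(* The scaling brings the norm below 1/4, as [expA_unipotent] requires; the summand 1 keeps the
   denominator nonzero. *)
pose t := (4 * (1 + nr (phi eta : A)))^-1; have t0 : 0 < t by rewrite invr_gt0.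
have nt : n (t%:C%C *: eta) by apply: (subspaceZ (nil_radical_subspace br)).
have /(bnilpotentP (_ : A)) [k Ek] := H _ nt; exists k.
have x4 : nr (phi (t%:C%C *: eta) : A) <= 4^-1.
  rewrite (linmapZ phi_lin) nrZ (cmod_real (ltW t0)) /t.
  have := nr_ge0 (phi eta : A); set p := nr _ => pp.
  by rewrite [leLHS]mulrC ler_pdivrMr //; lra.
have := expA_unipotent x4 Ek; rewrite (linmapZ phi_lin) exprZn => /eqP.
rewrite scaler_eq0 expf_eq0 => /orP[/andP[_ /eqP t00]|/eqP //].
by move: t0; rewrite (complexI t00) ltxx.
Qed.

Lemma nrm_ge0 eta : n eta -> 0 <= nrm eta.
Proof. by case: Hnrm => H _ _ _; apply: H. Qed.

Lemma wordnil_growth : wordnil_img ->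
  exists (Cc alpha : R), [/\ 0 < Cc, 0 < alpha &
    forall eta, n eta -> `|E eta| <= (Cc * powR (1 + nrm eta) alpha)%:C%C].
Proof.
move=> [d Hd].
have [K K0 HK] := norm_on_bound (nil_radical_subspace br) Hnrm phi_lin.
have n1 := nr_ge0 (1 : A).
have C0 : 0 <= d%:R * nr (1 : A) * (1 + K) ^+ d.
  by rewrite !mulr_ge0 // exprn_ge0 // addr_ge0.
(* Adding 1 and taking the exponent [d.+1] keep both constants positive, also for [d = 0]. *)
exists (d%:R * nr (1 : A) * (1 + K) ^+ d + 1), d.+1%:R; split.
- by rewrite ltr_wpDl.
- by rewrite ltr0n.
move=> eta neta; rewrite (@nrE _ _ _ _ HB one_neq0) lecR.
have a0 := nrm_ge0 neta; set a := nrm eta in a0 *.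
have a1 : 1 <= 1 + a by lra.
rewrite powR_mulrn; last by lra.
apply: (le_trans (expA_nil_bound (wordnil_pow neta Hd))).
have h : 1 + nr (phi eta : A) <= (1 + K) * (1 + a).
  by have := HK _ neta; rewrite -/a; nra.
apply: (@le_trans _ _ (d%:R * nr (1 : A) * ((1 + K) * (1 + a)) ^+ d)).
  apply: ler_wpM2l; first by rewrite mulr_ge0.
  by apply: lerXn2r; rewrite ?nnegrE //; have := nr_ge0 (phi eta : A); nra.
rewrite exprMn mulrA; apply: ler_pM => //.
- by rewrite exprn_ge0 //; lra.
- by rewrite lerDl.
- by apply: ler_weXn2l.
Qed.

Lemma growth_nilpotent (Cc alpha : R) : 0 < Cc -> 0 < alpha ->
  (forall eta, n eta -> `|E eta| <= (Cc * powR (1 + nrm eta) alpha)%:C%C) ->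
  forall eta, n eta -> bnilpotent mul one (phi eta).
Proof.
move=> C0 al0 H eta neta; apply/bnilpotentP.
apply: (polynomial_growth_nilpotent (nrm_ge0 neta) C0 al0) => z.
have nz : n (z *: eta) by apply: (subspaceZ (nil_radical_subspace br)).
have := H _ nz; rewrite (@nrE _ _ _ _ HB one_neq0) lecR (nrm_scale Hnrm z neta).
by rewrite (linmapZ phi_lin).
Qed.

End Equivalences.

Local Open Scope complex_scope.
Local Open Scope classical_set_scope.

(* theta : U(g) -> B is encoded by its restriction phi = theta|_g (universal
   property of U(g)); theta(U(g)) = ualg_gen (phi @` setT),
   theta(U(n)_0) = nalg_gen (phi @` n). *)
Theorem theorem2 (R : realType)
    (g : vectType R[i]) (br : g -> g -> g) (Hbr : lie_bracket br)
    (B : completeNormedModType R[i]) (mul : B -> B -> B) (one : B)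
    (HB : banach_algebra mul one)
    (nrm : g -> R) (Hnrm : norm_on (nil_radical br) nrm)
    (phi : g -> B) (Hphi : lie_hom_to br mul phi)
    (Hdense : closure (ualg_gen mul one (phi @` setT)) = setT) :
  let n := nil_radical br in
  let E := fun eta => bexp mul one (phi eta) in
  [/\ (PI_algebra mul one <-> forall eta, n eta -> bnilpotent mul one (phi eta)),
      ((forall eta, n eta -> bnilpotent mul one (phi eta)) <->
         nilpotent_subalg mul one (nalg_gen mul (phi @` n))),
      (nilpotent_subalg mul one (nalg_gen mul (phi @` n)) <->
         forall eta, n eta -> bnilpotent mul one (E eta - one)),
      ((forall eta, n eta -> bnilpotent mul one (E eta - one)) <->
         exists d : nat, forall eta, n eta -> bpow mul one (E eta - one) d = 0) &
      ((exists d : nat, forall eta, n eta -> bpow mul one (E eta - one) d = 0) <->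
         exists (Cc alpha : R), [/\ 0 < Cc, 0 < alpha &
           forall eta, n eta ->
             `|E eta| <= (Cc * powR (1 + nrm eta) alpha)%:C])].
Proof.
(* The zero algebra is treated apart, as [balg] asks for [one != 0]; there all conditions hold, with
   the constant polynomial 1 as identity. *)
move=> n E; case: (eqVneq one 0) => [one0|one_neq0].
  have B0 (x : B) : x = 0.
    have [[_ [mul1 _]] Hl _ _] := HB; rewrite -[LHS]mul1 one0.
    by have := Hl 1 0 0 x; rewrite !scale1r addr0 -{1}[mul 0 x]addr0 => /addrI <-.
  have pi1 : PI_algebra mul one.
    exists 0%N, [:: [::]], (fun=> 1); split=> //.
    by exists [::]; rewrite ?inE ?oner_eq0.
  have nil1 x : bnilpotent mul one x by exists 0%N.
  have sub1 : nilpotent_subalg mul one (nalg_gen mul (phi @` n)).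
    by exists 0%N => a _; apply: B0.
  have pow1 : exists d : nat, forall eta, n eta -> bpow mul one (E eta - one) d = 0.
    by exists 0%N => eta _; apply: B0.
  have growth1 : exists (Cc alpha : R), [/\ 0 < Cc, 0 < alpha &
      forall eta, n eta -> `|E eta| <= (Cc * powR (1 + nrm eta) alpha)%:C].
    exists 1, 1; split=> // eta _; rewrite [E eta]B0 normr0 ler0c mul1r.
    exact: powR_ge0.
  by split; split.
have h12 := PI_nilpotent HB Hphi one_neq0.
have h22 := nilpotent_wordnil Hbr HB Hphi one_neq0.
have h2 := wordnil_nilpotent (HB := HB) (one_neq0 := one_neq0) (br := br) (phi := phi).
have h2b := nalg_gen_wordnil br HB phi one_neq0.
have h21 := wordnil_PI (HB := HB) (one_neq0 := one_neq0) Hbr Hphi Hdense.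
have h23 := wordnil_unipotent (HB := HB) (one_neq0 := one_neq0) (br := br) (phi := phi).
have h32 := unipotent_nilpotent HB Hphi one_neq0.
have h24 := wordnil_growth (HB := HB) (one_neq0 := one_neq0) Hnrm Hphi.
have h42 := growth_nilpotent HB Hnrm Hphi one_neq0.
have h3 : (exists d : nat, forall eta, n eta -> bpow mul one (E eta - one) d = 0) ->
    forall eta, n eta -> bnilpotent mul one (E eta - one).
  by move=> [d Hd] eta neta; exists d; apply: Hd.
split; split.
- exact: h12.
- by move=> /h22 /h21.
- by move=> /h22 /h2b.
- by move=> /h2b /h2.
- by move=> /h2b /h23 /h3.
- by move=> /h32 /h22 /h2b.
- by move=> /h32 /h22 /h23.
- exact: h3.
- by move=> /h3 /h32 /h22 /h24.
- by move=> [Cc [alpha [C0 al0 H]]]; apply/h23/h22/(h42 _ _ C0 al0 H).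
Qed.
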